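(* Let $M$ be an $n$-dimensional manifold endowed with an equiprojective $SL(n,\mathbb{R})$-structure $(\eta,\nabla)$, and let $1\le p\le n-1$. Then there exists on $M$ (around any given point) a local coordinate system $x^1,\dots,x^n$ in which an arbitrary Killing-Yano tensor $\omega$ of degree $p$ has the components $$\omega_{i_1\dots i_p}=e^{(p+1)\psi}\left(A_{i_0i_1\dots i_p}x^{i_0}+B_{i_1\dots i_p}\right)$$ (summation over $i_0$), where $A_{i_0i_1\dots i_p}$ and $B_{i_1\dots i_p}$ are arbitrary constants, skew-symmetric with respect to all their indices, and $\psi=(n+1)^{-1}\ln(\eta)$, with $\eta$ here denoting the component $\eta_{1\dots n}>0$ of the volume element in the coordinates $x^1,\dots,x^n$, i.e. $\eta=\eta_{1\dots n}\,dx^1\wedge\dots\wedge dx^n$.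
   Context: $M$ is a connected differentiable manifold of dimension $n>2$. An equiaffine $SL(n,\mathbb{R})$-structure on $M$ is a pair $(\eta,\nabla)$, where $\eta$ is a nowhere vanishing $n$-form (volume element) and $\nabla$ is a torsion-free linear connection with $\nabla\eta=0$ (so its Ricci tensor is symmetric). It is called equiprojective if its Weyl projective curvature tensor vanishes, i.e. the curvature tensor satisfies $R=(n-1)^{-1}[\mathrm{id}_M\otimes Ric-Ric\otimes \mathrm{id}_M]$, that is, $R(X,Y)Z=\frac{1}{n-1}\left(Ric(Y,Z)X-Ric(X,Z)Y\right)$ for all vector fields $X,Y,Z$, where $Ric(Y,Z)=\mathrm{trace}(X\mapsto R(X,Y)Z)$. A skew-symmetric covariant tensor field ($p$-form) $\omega$ of degree $p$, $1\le p\le n-1$, is called a Killing-Yano tensor of degree $p$ if for every geodesic $\gamma$ of $\nabla$ with affine parameter $t$ the contraction $i_{d\gamma/dt}\,\omega$ is parallel along $\gamma$; equivalently, $\nabla\omega$ is totally skew-symmetric, i.e. $\nabla_{i_0}\omega_{i_1i_2\dots i_p}+\nabla_{i_1}\omega_{i_0i_2\dots i_p}=0$. The word ''arbitrary'' for the constants means that, on the coordinate domain, Killing-Yano tensors of degree $p$ are exactly the forms given by the displayed formula for some such constants. *)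

(* Defs.v *)
From HB Require Import structures.
From mathcomp Require Export all_boot all_order all_algebra all_fingroup.
From mathcomp Require Export all_classical all_reals all_analysis.

Set Implicit Arguments.
Unset Strict Implicit.
Unset Printing Implicit Defensive.

Import Order.TTheory GRing.Theory Num.Theory.
Import numFieldNormedType.Exports.

Local Open Scope classical_set_scope.
Local Open Scope ring_scope.

Section Euclidean.
Variables (R : realType) (n : nat).
Implicit Types (U : set 'rV[R]_n) (f : 'rV[R]_n -> R).

(* The intended U is open; then only the values of f on U matter. *)
Fixpoint Ck (k : nat) U f : Prop :=
  (forall y, U y -> {for y, continuous f}) /\
  (if k is k'.+1 then
     forall i : 'I_n,
       (forall y, U y -> derivable f y (delta_mx 0 i)) /\
       Ck k' U (fun y => 'D_(delta_mx 0 i) f y)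
   else True).

Definition smooth U f : Prop := forall k, Ck k U f.

End Euclidean.

Section MultiIndex.
Variables (R : realType) (n p : nat).
Implicit Types (t : p.-tuple 'I_n) (w : p.-tuple 'I_n -> R).

Definition skew w : Prop := forall t (s : 'S_p),
  w [tuple tnth t (s m) | m < p] = (-1) ^+ s * w t.

Definition subst_index t (k : 'I_p) (l : 'I_n) : p.-tuple 'I_n :=
  [tuple if m == k then l else tnth t m | m < p].

(* With G l i j = Gamma^l_{ij}, the connection part of nabla_v w:
   (nabla_v w)_t = v(w_t)
     - \sum_k \sum_i \sum_l v^i Gamma^l_{i t_k} w_{t_1 .. l .. t_p}. *)
Definition conn_term (G : 'I_n -> 'I_n -> 'I_n -> R) (v : 'rV[R]_n) w t : R :=
  \sum_(k < p) \sum_(i < n) \sum_(l < n)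
     v 0 i * G l i (tnth t k) * w (subst_index t k l).

End MultiIndex.

(* i_v w, v being inserted in the first slot; i_v vanishes on 0-forms. *)
Definition contraction (R : realType) (n p : nat) (v : 'rV[R]_n) :
    (p.-tuple 'I_n -> R) -> p.-1.-tuple 'I_n -> R :=
  match p with
  | 0 => fun _ _ => 0
  | q.+1 => fun w t => \sum_(i < n) v 0 i * w [tuple of i :: t]
  end.

Section Manifold.
Variables (R : realType) (n : nat) (M : topologicalType).

(* crd and par are total; their values outside chart_dom and chart_cod are irrelevant. *)
Record chart := Chart {
  chart_dom : set M;
  chart_cod : set 'rV[R]_n;
  crd : M -> 'rV[R]_n;
  par : 'rV[R]_n -> M;
  dom_open : open chart_dom;
  cod_open : open chart_cod;
  crd_cod : forall x, chart_dom x -> chart_cod (crd x);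
  par_dom : forall y, chart_cod y -> chart_dom (par y);
  crdK : forall x, chart_dom x -> par (crd x) = x;
  parK : forall y, chart_cod y -> crd (par y) = y;
  crd_continuous : forall x, chart_dom x -> {for x, continuous crd};
  par_continuous : forall y, chart_cod y -> {for y, continuous par} }.

Definition coordinate (c : chart) (i : 'I_n) (x : M) : R := crd c x 0 i.

Definition compatible (c c' : chart) : Prop :=
  (forall i, smooth (chart_cod c' `&` par c' @^-1` chart_dom c)
     (coordinate c i \o par c')) /\
  (forall i, smooth (chart_cod c `&` par c @^-1` chart_dom c')
     (coordinate c' i \o par c)).

Record manifold := Manifold {
  manifold_hausdorff : hausdorff_space M;
  manifold_second_countable : @second_countable M;
  atlas : set chart;
  atlas_cover : forall x, exists2 c, atlas c & chart_dom c x;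
  atlas_compatible : forall c c', atlas c -> atlas c' -> compatible c c';
  atlas_maximal :
    forall c, (forall c', atlas c' -> compatible c c') -> atlas c }.

(* (d f / d x^j)(x) in the coordinates of c, for x in chart_dom c. *)
Definition pderiv (c : chart) (j : 'I_n) (f : M -> R) (x : M) : R :=
  'D_(delta_mx 0 j) (f \o par c) (crd c x).

(* jac c c' a i x = (d x^a / d y^i)(x), x^a the coordinates of c and y^i those
   of c'. *)
Definition jac (c c' : chart) (a i : 'I_n) (x : M) : R :=
  pderiv c' i (coordinate c a) x.

Variable S : manifold.

(* A p-form on the open set W, given by its components fcomp c x in every chart
   c of the atlas, at the points x of chart_dom c lying in W. *)
Record pform (W : set M) (p : nat) := PForm {
  fcomp :> chart -> M -> p.-tuple 'I_n -> R;
  form_skew : forall c x, atlas S c -> chart_dom c x -> W x -> skew (fcomp c x);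
  form_smooth : forall c t, atlas S c ->
    smooth (chart_cod c `&` par c @^-1` W) (fun y => fcomp c (par c y) t);
  form_change : forall c c' x t, atlas S c -> atlas S c' ->
    chart_dom c x -> chart_dom c' x -> W x ->
    fcomp c' x t = \sum_(s : p.-tuple 'I_n)
      (\prod_(k < p) jac c c' (tnth s k) (tnth t k) x) * fcomp c x s }.

(* A linear connection: conn c x k i j is the Christoffel symbol Gamma^k_{ij}
   in the chart c at the point x, i.e.
   nabla_{d_i} d_j = \sum_k Gamma^k_{ij} d_k. *)
Record connection := Connection {
  conn :> chart -> M -> 'I_n -> 'I_n -> 'I_n -> R;
  conn_smooth : forall c k i j, atlas S c ->
    smooth (chart_cod c) (fun y => conn c (par c y) k i j);
  conn_change : forall c c' x k i j, atlas S c -> atlas S c' ->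
    chart_dom c x -> chart_dom c' x ->
    conn c' x k i j = \sum_(l < n) jac c' c k l x *
      (pderiv c' i (pderiv c' j (coordinate c l)) x +
       \sum_(a < n) \sum_(b < n)
         jac c c' a i x * jac c c' b j x * conn c x l a b) }.

Variable nabla : connection.

Definition torsion_free : Prop := forall c x k i j,
  atlas S c -> chart_dom c x -> nabla c x k i j = nabla c x k j i.

Definition cov_deriv W p (w : pform W p) (c : chart) (x : M) (j : 'I_n)
    (t : p.-tuple 'I_n) : R :=
  pderiv c j (fun z => w c z t) x
  - conn_term (nabla c x) (delta_mx 0 j) (w c x) t.

Definition nowhere_vanishing p (w : pform setT p) : Prop :=
  forall c x, atlas S c -> chart_dom c x -> exists t, w c x t != 0.

Record equiaffine (eta : pform setT n) : Prop := Equiaffine {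
  equiaffine_volume : nowhere_vanishing eta;
  equiaffine_torsion_free : torsion_free;
  equiaffine_parallel : forall c x j t,
    atlas S c -> chart_dom c x -> cov_deriv eta c x j t = 0 }.

(* The l-th component of R(d_i, d_j) d_k, where
   R(X, Y) Z = nabla_X nabla_Y Z - nabla_Y nabla_X Z - nabla_[X, Y] Z. *)
Definition curv_comp (c : chart) (x : M) (l i j k : 'I_n) : R :=
  pderiv c i (fun z => nabla c z l j k) x
  - pderiv c j (fun z => nabla c z l i k) x
  + \sum_(m < n) (nabla c x l i m * nabla c x m j k
                  - nabla c x l j m * nabla c x m i k).

Definition curv (c : chart) (x : M) (X Y Z : 'rV[R]_n) : 'rV[R]_n :=
  \row_l \sum_(i < n) \sum_(j < n) \sum_(k < n)
    X 0 i * Y 0 j * Z 0 k * curv_comp c x l i j k.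

Definition ricci (c : chart) (x : M) (Y Z : 'rV[R]_n) : R :=
  \tr (lin1_mx (fun X => curv c x X Y Z)).

Definition equiprojective : Prop := forall c x (X Y Z : 'rV[R]_n),
  atlas S c -> chart_dom c x ->
  curv c x X Y Z =
    (n%:R - 1)^-1 *: (ricci c x Y Z *: X - ricci c x X Z *: Y).

Definition velocity (c : chart) (g : R -> M) (t : R) : 'rV[R]_n :=
  \row_i derive1 (coordinate c i \o g) t.

(* I is the (open) interval of definition; t is an affine parameter. *)
Definition geodesic (I : set R) (g : R -> M) : Prop :=
  (forall t, I t -> {for t, continuous g}) /\
  (forall c t, atlas S c -> I t -> chart_dom c (g t) -> forall k : 'I_n,
     [/\ derivable (coordinate c k \o g) t 1,
         derivable (fun u => velocity c g u 0 k) t 1 &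
         derive1 (fun u => velocity c g u 0 k) t +
           \sum_(i < n) \sum_(j < n) nabla c (g t) k i j *
             velocity c g t 0 i * velocity c g t 0 j = 0]).

(* th c t : components, in the chart c, of a covariant tensor at g t. *)
Definition parallel_along (I : set R) (g : R -> M) q
    (th : chart -> R -> q.-tuple 'I_n -> R) : Prop :=
  forall c t, atlas S c -> I t -> chart_dom c (g t) -> forall s,
    derivable (fun u => th c u s) t 1 /\
    derive1 (fun u => th c u s) t
      - conn_term (nabla c (g t)) (velocity c g t) (th c t) s = 0.

Definition killing_yano W p (w : pform W p) : Prop :=
  forall (I : set R) (g : R -> M), open I -> is_interval I ->
    (forall t, I t -> W (g t)) -> geodesic I g ->
    parallel_along I g
      (fun c t => contraction (velocity c g t) (w c (g t))).

End Manifold.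

(* Main.v *)
(**
  Equiprojective equiaffine connections are projectively flat. With
  P = Ric / (n - 1), the linear system D_i D_j y = Gamma^k_ij D_k y - P_ij y for
  (y, D_1 y, .., D_n y) is completely integrable: P is symmetric because the
  volume form is parallel, and D_a P_cj is symmetric in a, c by the second
  Bianchi identity when n > 2. If y^0, .., y^n are local solutions with
  independent initial data, then in the coordinates x^i = y^i / y^0 one gets
  Gamma^k_ij = d^k_j phi_i + d^k_i phi_j, and the trace of this identity together
  with nabla eta = 0 gives phi = d psi.

  In such a chart put omega = e^((p+1) psi) theta. Along a geodesic with velocity
  v, the covariant derivative of i_v omega is e^((p+1) psi) v^i v^j D_j theta_(i ..),
  and there is a geodesic through every point in every direction (straight
  lines, reparametrised). So omega is Killing-Yano iff D theta is totally skew.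
  Then D D theta, symmetric in its first two indices and skew in the second and
  third one, vanishes, and theta is affine.

  Solutions of the integrable system are obtained as limits of the Euler
  products prod_j (1 + h x.A(j h x)), h = 1/N, whose defect is O(h).
*)

From HB Require Import structures.
Require Import Defs.
From mathcomp Require Import ring lra.

Set Implicit Arguments.
Unset Strict Implicit.
Unset Printing Implicit Defensive.

Import Order.TTheory GRing.Theory Num.Theory.
Import numFieldNormedType.Exports.

Local Open Scope classical_set_scope.
Local Open Scope ring_scope.

(** * Functions of class C^k on R^n *)

Section Lines.
Variables (R : realType) (V W : normedModType R).

(** In the flat model the linear system reads D_i D_j y = 0, its solutions are the affine functions,
    and the ratios of n + 1 independent ones are projective coordinates; this is why quotients are
    taken. The Euler products run along rays, which yields one candidate for all directions at once;
    flatness is what makes a solution of the radial equation satisfy the equations in the other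
    directions too. All estimates carry explicit rates, so that the derivatives of the limit are
    read off from bounds uniform in N. The final chart is cut down until its image is a ball:
    convexity turns vanishing derivatives into constancy and keeps the sign of the volume component.
    Geodesics and parallel tensors are tested in every chart of the atlas; [geodesic_of_chart] and
    [parallel_change] reduce this to the one chart in which everything is computed. The speed of a
    reparametrised straight line is proportional to e^(-2 psi), the same exponential family that
    rescales the form. *)

Lemma is_derive_line (f : V -> W) (z v : V) (s : R) :
  derivable f (s *: v + z) v ->
  is_derive s (1:R) (fun t : R => f (t *: v + z)) ('D_v f (s *: v + z)).
Proof.
have E : (fun h : R => h^-1 *: (((fun t : R => f (t *: v + z)) \o shift s) (h *: 1)
      - f (s *: v + z)))
   = (fun h : R => h^-1 *: ((f \o shift (s *: v + z)) (h *: v) - f (s *: v + z))).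
  by apply/funext => h /=; rewrite [h *: 1]mulr1 scalerDl addrA.
by move=> df; split; rewrite /derivable /derive E.
Qed.

End Lines.

Section MVTline.
Variables (R : realType) (V : normedModType R).

(** Positive and negative [h] use different segments; the intermediate point is located only by
    [|c| <= |h|], which is the form that the ball estimates consume. *)
Lemma MVT_line (f : V -> R) (z v : V) (h : R) :
  (forall s : R, `|s| <= `|h| -> derivable f (s *: v + z) v) ->
  exists2 c, `|c| <= `|h| & f (h *: v + z) - f z = h * 'D_v f (c *: v + z).
Proof.
move=> df.
have dg (s : R) : `|s| <= `|h| ->
    is_derive s (1:R) (fun t : R => f (t *: v + z)) ('D_v f (s *: v + z)).
  by move=> /df; exact: is_derive_line.
have cg (a b : R) : (forall s : R, a <= s <= b -> `|s| <= `|h|) ->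
    {within `[a, b], continuous (fun t : R => f (t *: v + z))}.
  move=> ab; apply: derivable_within_continuous => s /[!in_itv]/= /ab /dg.
  by case.
have [h0|h0] := leP 0 h.
  have H s : 0 <= s <= h -> `|s| <= `|h|.
    by case/andP => s0 sh; rewrite !ger0_norm.
  have [s||c /[!in_itv]/= /H ch] := @MVT_segment R (fun t : R => f (t *: v + z))
     (fun s => 'D_v f (s *: v + z)) 0 h h0; last 1 first.
  - by rewrite scale0r add0r subr0 mulrC => ->; exists c.
  - by rewrite in_itv/= => /andP[s0 sh]; apply: dg; apply: H; rewrite !ltW.
  - exact: cg.
have H s : h <= s <= 0 -> `|s| <= `|h|.
  by case/andP => hs s0; rewrite (ltr0_norm h0) ler0_norm ?lerN2.
have [s||c /[!in_itv]/= /H ch] := @MVT_segment R (fun t : R => f (t *: v + z))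
   (fun s => 'D_v f (s *: v + z)) h 0 (ltW h0); last 1 first.
- rewrite scale0r add0r sub0r => E; exists c => //.
  by rewrite -opprB E mulrN opprK mulrC.
- by rewrite in_itv/= => /andP[s0 sh]; apply: dg; apply: H; rewrite !ltW.
- exact: cg.
Qed.

End MVTline.

Lemma cvg_sumR (R : realType) (T : Type) (F : set_system T) (I : Type) (r : seq I)
    (P : pred I) (f : I -> T -> R) (l : I -> R) : Filter F ->
  (forall i, P i -> f i @ F --> l i) ->
  (fun y => \sum_(i <- r | P i) f i y) @ F --> \sum_(i <- r | P i) l i.
Proof.
move=> FF H; elim: r => [|i r IH].
  rewrite big_nil; under eq_fun do rewrite big_nil; exact: cvg_cst.
rewrite big_cons; under eq_fun do rewrite big_cons.
by case: ifP => // Pi; apply: cvgD => //; exact: H.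
Qed.

(** * Partial derivatives, differentiability, and closure of C^k under algebraic operations *)

Section Coordinates.
Variables (R : realType) (n : nat).
Implicit Types (x y z h v : 'rV[R]_n) (f g : 'rV[R]_n -> R) (U : set 'rV[R]_n).

Local Notation e_ i := (delta_mx 0 i : 'rV[R]_n).
Local Notation "'d_ i f" := (fun y => 'D_(e_ i) f y)
  (at level 10, i at level 2, f at level 9).

Lemma coord_le_norm v (i : 'I_n) : `|v 0 i| <= `|v|.
Proof.
rewrite [leRHS]/Num.Def.normr/= mx_normrE.
exact: (le_bigmax _ _ (ord0, i)).
Qed.

Lemma norm_le_coord v (r : R) : 0 <= r -> (forall i, `|v 0 i| <= r) -> `|v| <= r.
Proof.
move=> r0 H; rewrite [leLHS]/Num.Def.normr/= mx_normrE.
by apply: bigmax_le => // -[i j] _ /=; rewrite ord1.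
Qed.

Lemma norm_lt_coord v (r : R) : 0 < r -> (forall i, `|v 0 i| < r) -> `|v| < r.
Proof.
move=> r0 H; rewrite [ltLHS]/Num.Def.normr/= mx_normrE.
by apply: bigmax_lt => // -[i j] _ /=; rewrite ord1.
Qed.

Definition is_C1 U f := forall i,
  (forall y, U y -> derivable f y (e_ i)) /\
  (forall y, U y -> {for y, continuous ('d_ i f)}).

(** Vertices of the axis-parallel path from 0 to [h]: consecutive ones differ in a single
    coordinate, so that an increment of [f] is controlled by one partial derivative at a time. *)
Definition truncate h (k : nat) : 'rV[R]_n := \row_i (if (i < k)%N then h 0 i else 0).

Lemma truncate0 h : truncate h 0 = 0.
Proof. by apply/rowP => i; rewrite !mxE ltn0. Qed.

Lemma truncate_full h : truncate h n = h.
Proof. by apply/rowP => i; rewrite !mxE ltn_ord. Qed.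

Lemma truncateS h (k : 'I_n) : truncate h k.+1 = h 0 k *: e_ k + truncate h k.
Proof.
apply/rowP => i; rewrite !mxE eqxx/= ltnS leq_eqVlt.
have [->|ik] := eqVneq i k; first by rewrite eqxx ltnn mulr1 addr0.
by rewrite (negbTE (ik : (i : nat) != k)) mulr0 add0r.
Qed.

Lemma norm_truncate_line h (k : 'I_n) (c : R) :
  `|c| <= `|h 0 k| -> `|c *: e_ k + truncate h k| <= `|h|.
Proof.
move=> ch; apply: norm_le_coord => // i; rewrite !mxE eqxx/=.
have [->|ik] := eqVneq i k.
  by rewrite ltnn mulr1 addr0 (le_trans ch)// coord_le_norm.
rewrite mulr0 add0r; case: ifP => _; last by rewrite normr0.
exact: coord_le_norm.
Qed.

Definition lin_form (a : 'I_n -> R) (h : 'rV[R]_n) : R := \sum_i h 0 i * a i.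

(** The increment of [f] telescopes along the path of truncations, and the mean value theorem on
    each edge compares it with the partial derivative at [y]. *)
Lemma C1_differentiable_aux U f y : open U -> is_C1 U f -> U y ->
  differentiable f y /\ 'd f y = lin_form (fun i => 'D_(e_ i) f y) :> ('rV[R]_n -> R).
Proof.
move=> oU f1 Uy.
pose L := lin_form (fun i => 'D_(e_ i) f y).
have linL : linear L.
  move=> a u v; rewrite /L /lin_form scaler_sumr -big_split/=.
  by apply: eq_bigr => i _; rewrite !mxE mulrDl -mulrA.
pose LM := GRing.isLinear.Build _ _ _ _ _ linL.
pose LL : {linear 'rV[R]_n -> R} := HB.pack L LM.
have cL : continuous L.
  move=> z; rewrite /L /lin_form.
  apply: (@cvg_sumR _ _ (nbhs z)) => i _; apply: cvgMr_tmp.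
  exact: coord_continuous.
suff E : 'd f y = L :> ('rV[R]_n -> R) /\ f \o shift y = cst (f y) + 'd f y +o_ (0 : 'rV[R]_n) id.
  case: E => E1 E2; split=> //; apply/diff_locallyP; split => //.
  by rewrite E1.
suff fL : f \o shift y = cst (f y) + (LL : 'rV[R]_n -> R) +o_ (0 : 'rV[R]_n) id.
  have E : 'd f y = L :> ('rV[R]_n -> R) by exact: (@diff_unique _ _ _ f LL y cL fL).
  by split=> //; rewrite E.
  apply/eqaddoP => eps eps0.
  (* Each of the [n] edges contributes at most [e' * |h|]; the denominator [n.+1] keeps the quotient
     meaningful for [n = 0]. *)
  pose e' := eps / (n.+1)%:R.
  have e'0 : 0 < e' by rewrite divr_gt0.
  have near_y i : \forall z \near y, `|'D_(e_ i) f z - 'D_(e_ i) f y| <= e'.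
    have [_ /(_ y Uy)] := f1 i.
    move/cvgrPdist_le => /(_ e' e'0); apply: filterS => z.
    by rewrite distrC.
  have : \forall z \near y, U z /\ forall i, `|'D_(e_ i) f z - 'D_(e_ i) f y| <= e'.
    apply: filterI; first exact: open_nbhs_nbhs.
    exact: (@filter_forall _ _ _ (nbhs y) _ near_y).
  move=> /nbhs_ballP[r /= r0 Hr].
  apply/nbhs_ballP; exists r => //= h; rewrite -ball_normE/= sub0r normrN => hr.
  have inb (z : 'rV[R]_n) : `|z| <= `|h| -> ball y r (z + y).
    move=> zh; rewrite -ball_normE/= opprD addrCA subrr addr0 normrN.
    exact: le_lt_trans zh hr.
  have step (k : 'I_n) : `|f (truncate h k.+1 + y) - f (truncate h k + y)
        - h 0 k * 'D_(e_ k) f y| <= e' * `|h|.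
    have [|c ch E] := @MVT_line R _ f (truncate h k + y) (e_ k) (h 0 k).
      move=> s sh; have [+ _] := f1 k; apply.
      by rewrite addrA; have [] := Hr _ (inb _ (norm_truncate_line sh)).
    rewrite truncateS -(addrA (h 0 k *: _)) E -mulrBr normrM mulrC ler_pM//; last exact: coord_le_norm.
    by rewrite addrA; have [_ ] := Hr _ (inb _ (norm_truncate_line ch)); exact.
  have -> : (f \o shift y - (cst (f y) + (LL : 'rV[R]_n -> R))) h =
    \sum_(k < n) (f (truncate h k.+1 + y) - f (truncate h k + y)
        - h 0 k * 'D_(e_ k) f y).
    rewrite sumrB -/(lin_form _ h) -/(L h).
    rewrite -(big_mkord xpredT (fun k => f (truncate h k.+1 + y) - f (truncate h k + y))).
    rewrite (telescope_sumr (fun k => f (truncate h k + y)))//.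
    rewrite truncate0 truncate_full add0r.
    by rewrite -[LHS]/(f (h + y) - (f y + L h)) opprD addrA.
  apply: le_trans (ler_norm_sum _ _ _) _.
  apply: le_trans (ler_sum _ (fun k _ => step k)) _.
  rewrite sumr_const card_ord /= -mulrnAl ler_wpM2r//.
  by rewrite /e' -mulr_natr -mulrA ler_piMr ?ltW// mulrC ltr_pdivrMr// mul1r ltr_nat.
Qed.

Lemma Ck1_C1 U f : Ck 1 U f -> is_C1 U f.
Proof. by case=> _ H i; have [? []] := H i. Qed.

Lemma Ck_cont k U f y : Ck k U f -> U y -> {for y, continuous f}.
Proof. by case: k => [|k] [H _]; exact: H. Qed.

Lemma CkS k U f : Ck k.+1 U f -> Ck k U f.
Proof.
elim: k f => [|k IH] f [cf H]; split=> // i; have [d1 d2] := H i; split=> //.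
exact: IH.
Qed.

Lemma Ck_C1 k U f : Ck k.+1 U f -> Ck 1 U f.
Proof. by elim: k => // k IH /CkS. Qed.

Lemma Ck_pd k U f i : Ck k.+1 U f -> Ck k U ('d_ i f).
Proof. by case=> _ /(_ i)[]. Qed.

Lemma Ck_derivable k U f i y : Ck k.+1 U f -> U y -> derivable f y (e_ i).
Proof. by case=> _ /(_ i)[+ _]; exact. Qed.

Lemma Ck_differentiable k U f y : open U -> Ck k.+1 U f -> U y -> differentiable f y.
Proof.
by move=> oU /Ck_C1 /Ck1_C1 f1 Uy; have [] := C1_differentiable_aux oU f1 Uy.
Qed.

Lemma Ck_sub k U (V : set 'rV[R]_n) f : V `<=` U -> Ck k U f -> Ck k V f.
Proof.
move=> VU; elim: k f => [|k IH] f [cf H].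
  by split=> // y /VU; exact: cf.
split=> [y /VU|i]; first exact: cf.
by have [H1 H2] := H i; split=> [y /VU|]; [exact: H1|exact: IH].
Qed.

Lemma near_eq_open U f g y : open U -> (forall y, U y -> f y = g y) -> U y ->
  \forall z \near y, f z = g z.
Proof.
move=> oU fg Uy; near=> z; apply: fg; near: z; exact: open_nbhs_nbhs.
Unshelve. all: by end_near. Qed.

Lemma Ck_eq k U f g : open U -> (forall y, U y -> f y = g y) -> Ck k U f -> Ck k U g.
Proof.
move=> oU.
have ceq f1 g1 : (forall y, U y -> f1 y = g1 y) ->
    (forall y, U y -> {for y, continuous f1}) ->
    forall y, U y -> {for y, continuous g1}.
  move=> fg cf y Uy; rewrite /prop_for /continuous_at -(fg y Uy).
  apply: cvg_trans (cf y Uy); exact: (@near_eq_cvg _ _ (nbhs y) _ f1 g1 (near_eq_open oU fg Uy)).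
elim: k f g => [|k IH] f g fg [cf H]; first by split=> //; exact: ceq cf.
split=> [|i]; first exact: ceq cf.
have [H1 H2] := H i; split.
  by move=> y Uy; apply: near_eq_derivable (H1 y Uy); exact: (near_eq_open oU).
apply: IH H2 => y Uy; apply: near_eq_derive; exact: (near_eq_open oU).
Qed.

Lemma Ck_cst k U (a : R) : Ck k U (fun=> a).
Proof.
elim: k a => [|k IH] a; first by split=> [y _|]; [exact: (@cvg_cst _ _ _ (nbhs y))|].
split=> [y _|i]; first exact: (@cvg_cst _ _ _ (nbhs y)).
split=> [y _|]; first exact: derivable_cst.
by under eq_fun do rewrite derive_cst; exact: IH.
Qed.

Lemma Ck_add k U f g : open U -> Ck k U f -> Ck k U g -> Ck k U (fun y => f y + g y).
Proof.
move=> oU; elim: k f g => [|k IH] f g [cf Hf] [cg Hg].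
  by split=> // y Uy; apply: continuousD; [exact: cf|exact: cg].
split=> [y Uy|i]; first by apply: continuousD; [exact: cf|exact: cg].
have [f1 f2] := Hf i; have [g1 g2] := Hg i; split=> [y Uy|].
  by apply: derivableD; [exact: f1|exact: g1].
apply: Ck_eq (IH _ _ f2 g2) => // y Uy.
by rewrite [RHS]deriveD//; [exact: f1|exact: g1].
Qed.

Lemma Ck_mul k U f g : open U -> Ck k U f -> Ck k U g -> Ck k U (fun y => f y * g y).
Proof.
move=> oU; elim: k f g => [|k IH] f g Cf Cg; have [cf Hf] := Cf; have [cg Hg] := Cg.
  by split=> // y Uy; apply: continuousM; [exact: cf|exact: cg].
split=> [y Uy|i]; first by apply: continuousM; [exact: cf|exact: cg].
have [f1 f2] := Hf i; have [g1 g2] := Hg i; split=> [y Uy|].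
  by apply: derivableM; [exact: f1|exact: g1].
apply: Ck_eq (Ck_add oU (IH _ _ (CkS Cf) g2) (IH _ _ (CkS Cg) f2)) => // y Uy.
by rewrite [RHS]deriveM//; [exact: f1|exact: g1].
Qed.

Lemma Ck_sum k U (I : Type) (r : seq I) (P : pred I) (F : I -> 'rV[R]_n -> R) :
  open U -> (forall i, P i -> Ck k U (F i)) ->
  Ck k U (fun y => \sum_(i <- r | P i) F i y).
Proof.
move=> oU H; elim: r => [|i r IH].
  rewrite (_ : (fun y => _) = fun=> 0); first exact: Ck_cst.
  by apply/funext => y; rewrite big_nil.
rewrite (_ : (fun y => _) = fun y => if P i then +%R (F i y) (\sum_(i <- r | P i) F i y)
  else \sum_(i <- r | P i) F i y).
  by case Pi : (P i) => //; apply: Ck_add => //; exact: H.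
by apply/funext => y; rewrite big_cons.
Qed.

Lemma Ck_prod k U (I : Type) (r : seq I) (P : pred I) (F : I -> 'rV[R]_n -> R) :
  open U -> (forall i, P i -> Ck k U (F i)) ->
  Ck k U (fun y => \prod_(i <- r | P i) F i y).
Proof.
move=> oU H; elim: r => [|i r IH].
  rewrite (_ : (fun y => _) = fun=> 1); first exact: Ck_cst.
  by apply/funext => y; rewrite big_nil.
rewrite (_ : (fun y => _) = fun y => if P i then *%R (F i y) (\prod_(i <- r | P i) F i y)
  else \prod_(i <- r | P i) F i y).
  by case Pi : (P i) => //; apply: Ck_mul => //; exact: H.
by apply/funext => y; rewrite big_cons.
Qed.

Lemma is_derive_coord (i : 'I_n) y v :
  is_derive y v (fun z : 'rV[R]_n => z 0 i) (v 0 i).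
Proof.
have := @derivable_id R _ y v => /derivable_mxP /(_ 0 i) d.
apply: DeriveDef => //.
have := @derive_id R _ y v; rewrite derive_mx; last exact: derivable_id.
by move/rowP => /(_ i); rewrite mxE.
Qed.

Lemma pd_coord (i j : 'I_n) y :
  'D_(e_ j) (fun z : 'rV[R]_n => z 0 i) y = (i == j)%:R.
Proof. by rewrite (@derive_val _ _ _ _ _ _ _ (is_derive_coord i y _)) mxE eqxx. Qed.

Lemma Ck_coord k U (i : 'I_n) : Ck k U (fun y => y 0 i).
Proof.
case: k => [|k]; first by split=> // y _; exact: coord_continuous.
split=> [y _|j]; first exact: coord_continuous.
split=> [y _|]; first by case: (is_derive_coord i y (e_ j)).
by under eq_fun do rewrite pd_coord; exact: Ck_cst.
Qed.

Lemma Ck_inv k U f : open U -> (forall y, U y -> f y != 0) -> Ck k U f ->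
  Ck k U (fun y => (f y)^-1).
Proof.
move=> oU f0; elim: k => [|k IH] Cf; have [cf Hf] := Cf.
  by split=> // y Uy; apply: continuousV; [exact: f0|exact: cf].
split=> [y Uy|i]; first by apply: continuousV; [exact: f0|exact: cf].
have [f1 f2] := Hf i; split=> [y Uy|].
  by apply: derivableV; [exact: f0|exact: f1].
have Ci := IH (CkS Cf).
apply: Ck_eq (Ck_mul oU (Ck_mul oU (Ck_cst _ _ (-1)) (Ck_mul oU Ci Ci)) f2) => // y Uy.
rewrite [RHS]deriveV//; [|exact: f0|exact: f1].
rewrite mulN1r expr2 invfM -scaleNr; congr (_ * _).
Qed.

Lemma diff_dir f y v : differentiable f y ->
  'D_v f y = \sum_i v 0 i * 'D_(e_ i) f y.
Proof.
move=> df; rewrite deriveE// {1}(row_sum_delta v) linear_sum.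
by apply: eq_bigr => i _; rewrite linearZ deriveE.
Qed.

Lemma cvg_rowP (T : Type) (F : set_system T) (g : T -> 'rV[R]_n) y : Filter F ->
  (forall j, (fun u => g u 0 j) @ F --> y 0 j) -> g @ F --> y.
Proof.
move=> FF H; apply/cvgrPdist_lt => e e0.
have : \forall u \near F, forall j, `|y 0 j - g u 0 j| < e.
  by apply: filter_forall => j; have /cvgrPdist_lt := H j; exact.
apply: filterS => u Hx; apply: norm_lt_coord => // j; rewrite !mxE; exact: Hx.
Qed.

End Coordinates.

(** * Chain rule and composition of C^k maps *)

Section Chain.
Variables (R : realType) (n : nat) (V : normedModType R).

(** Only the derivative of [h] in the direction [v] is available, so the chain rule is applied to
    the curve [t |-> h (t *: v + y)], which is differentiable at 0. *)
Lemma is_derive_comp_rV (f : 'rV[R]_n -> R) (h : V -> 'rV[R]_n) (y v : V) :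
  (forall j, derivable (fun x => h x 0 j) y v) -> differentiable f (h y) ->
  is_derive y v (f \o h)
    (\sum_j 'D_v (fun x => h x 0 j) y * 'D_(delta_mx 0 j) f (h y)).
Proof.
move=> dh df.
have dhv : derivable h y v by apply/derivable_mxP => i j; rewrite ord1.
pose k (t : R) := h (t *: v + y).
have k0 : k 0 = h y by rewrite /k scale0r add0r.
have dk : differentiable k 0 by apply/derivable1_diffP; exact: ((derivable1P h y v).1 dhv).
have dfk : differentiable (f \o k) 0.
  by apply: differentiable_comp => //; rewrite k0.
have dfh : derivable (f \o h) y v by apply/derivable1P; apply/derivable1_diffP; exact: dfk.
apply: DeriveDef => //.
have L0 (W : normedModType R) (g : V -> W) : derivable g y v ->
    'D_v g y = 'D_1 (fun t : R => g (t *: v + y)) 0.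
  move=> dg; have := @is_derive_line R V W g y v 0.
  by rewrite scale0r add0r => /(_ dg) [_ ->].
rewrite (L0 _ _ dfh) -[LHS]/('D_1 (f \o k) 0) deriveE//.
rewrite diff_comp//= ?k0// -[X in 'd f _ X]deriveE// -(L0 _ h)//.
rewrite -deriveE// diff_dir//; apply: eq_bigr => j _.
by rewrite derive_mx// mxE.
Qed.

End Chain.

Lemma continuous_rowP (R : realType) (n : nat) (T : topologicalType)
    (g : T -> 'rV[R]_n) (y : T) :
  (forall j, {for y, continuous (fun u => g u 0 j)}) -> {for y, continuous g}.
Proof. by move=> H; exact: (@cvg_rowP R n T (nbhs y) g (g y) _ H). Qed.

Lemma continuous_mxP (R : realType) (m n : nat) (T : topologicalType)
    (g : T -> 'M[R]_(m, n)) (y : T) :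
  (forall i j, {for y, continuous (fun u => g u i j)}) -> {for y, continuous g}.
Proof.
move=> H; apply/cvgrPdist_lt => e e0.
have : \forall x \near y, forall ij : 'I_m * 'I_n, `|g y ij.1 ij.2 - g x ij.1 ij.2| < e.
  apply: (@filter_forall _ _ _ (nbhs y)) => -[i j] /=.
  by have /cvgrPdist_lt := H i j; exact.
apply: (@filterS _ (nbhs y)) => x Hx; rewrite [ltLHS]/Num.Def.normr/= mx_normrE.
by apply: bigmax_lt => // ij _ /=; rewrite !mxE; exact: Hx.
Qed.

Section Composition.
Variables (R : realType) (m n : nat).

Lemma Ck_comp k (U : set 'rV[R]_n) (V : set 'rV[R]_m) f (g : 'rV[R]_m -> 'rV[R]_n) :
  open U -> open V -> (forall y, V y -> U (g y)) ->
  Ck k U f -> (forall j, Ck k V (fun y => g y 0 j)) -> Ck k V (f \o g).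
Proof.
move=> oU oV VU; elim: k f => [|k IH] f Cf Cg.
- split=> // y Vy; apply: continuous_comp.
    by apply: continuous_rowP => j; have [+ _] := Cg j; apply.
  by have [+ _] := Cf; apply; exact: VU.
- have cg y : V y -> {for y, continuous g}.
    by move=> Vy; apply: continuous_rowP => j; have [+ _] := Cg j; apply.
  split=> [y Vy|i].
    by apply: continuous_comp; [exact: cg|have [+ _] := Cf; apply; exact: VU].
  have D y : V y -> is_derive y (delta_mx 0 i) (f \o g)
    (\sum_j 'D_(delta_mx 0 i) (fun x => g x 0 j) y * 'D_(delta_mx 0 j) f (g y)).
    move=> Vy; apply: is_derive_comp_rV; last exact: Ck_differentiable Cf (VU _ Vy).
    by move=> j; exact: Ck_derivable (Cg j) Vy.
  split=> [y Vy|]; first by case: (D y Vy).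
  apply: (@Ck_eq _ _ _ _ (fun y => \sum_j 'D_(delta_mx 0 i) (fun x => g x 0 j) y
      * 'D_(delta_mx 0 j) f (g y))) => // [y Vy|].
    by case: (D y Vy).
  apply: Ck_sum => // j _; apply: Ck_mul => //; first exact: Ck_pd.
  by apply: (IH ('D_(delta_mx 0 j) f)) => [|l]; [exact: Ck_pd|exact: CkS].
Qed.

End Composition.

(** * Mixed second derivatives, mean value inequalities, regularity of solutions *)

Section Second.
Variables (R : realType) (n : nat).
Implicit Types (x y z v : 'rV[R]_n) (f g : 'rV[R]_n -> R) (U : set 'rV[R]_n).

Local Notation e_ i := (delta_mx 0 i : 'rV[R]_n).

Lemma is_derive_translate (V W : normedModType R) (f : V -> W) (a z v : V) :
  derivable f (a + z) v -> is_derive z v (fun u => f (a + u)) ('D_v f (a + z)).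
Proof.
have E : (fun h : R => h^-1 *: (((fun u => f (a + u)) \o shift z) (h *: v)
      - f (a + z)))
   = (fun h : R => h^-1 *: ((f \o shift (a + z)) (h *: v) - f (a + z))).
  by apply/funext => h /=; rewrite addrCA.
by move=> df; split; rewrite /derivable /derive E.
Qed.

Lemma norm_delta (i : 'I_n) (s : R) : `|s *: e_ i| <= `|s|.
Proof.
apply: norm_le_coord => // j; rewrite !mxE eqxx/=.
by case: eqP => _; rewrite ?mulr1// mulr0 normr0.
Qed.

(** Two applications of the mean value theorem: to the increment [g] in direction [j], along
    direction [i], and then to ['D_(e_ i) f] along direction [j]. *)
Lemma second_difference U f y (i j : 'I_n) (r t : R) : open U -> Ck 2 U f ->
  ball y r `<=` U -> `|t| + `|t| < r ->
  exists2 p, `|p - y| <= `|t| + `|t| &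
    f (t *: e_ j + (t *: e_ i + y)) - f (t *: e_ i + y) - (f (t *: e_ j + y) - f y)
    = t * (t * 'D_(e_ j) ('D_(e_ i) f) p).
Proof.
move=> oU f2 yU tr.
have inU (s s' : R) : `|s| <= `|t| -> `|s'| <= `|t| ->
    `|s *: e_ j + (s' *: e_ i + y) - y| <= `|t| + `|t| /\
    U (s *: e_ j + (s' *: e_ i + y)).
  move=> st s't.
  have H : `|s *: e_ j + (s' *: e_ i + y) - y| <= `|t| + `|t|.
    rewrite addrA addrK (le_trans (ler_normD _ _))// lerD//.
      by rewrite (le_trans (norm_delta _ _)).
    by rewrite (le_trans (norm_delta _ _)).
  split=> //; apply: yU; rewrite -ball_normE/= distrC; exact: le_lt_trans tr.
have inU0 (s : R) : `|s| <= `|t| -> U (s *: e_ i + y).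
  by move=> st; have [||_] := inU 0 s; rewrite ?normr0// scale0r add0r.
pose g z := f (t *: e_ j + z) - f z.
have dg (s : R) : `|s| <= `|t| -> is_derive (s *: e_ i + y) (e_ i) g
    ('D_(e_ i) f (t *: e_ j + (s *: e_ i + y)) - 'D_(e_ i) f (s *: e_ i + y)).
  move=> st; have d1 : derivable f (t *: e_ j + (s *: e_ i + y)) (e_ i).
    by apply: Ck_derivable f2 _; have [] := inU t s (lexx _) st.
  have := is_derive_translate d1 => d2; apply: is_deriveB.
  by apply: derivableP; apply: Ck_derivable f2 _; exact: inU0.
have [|c ct Ec] := @MVT_line R _ g y (e_ i) t; first by move=> s /dg[].
have [|d dt Ed] := @MVT_line R _ ('D_(e_ i) f) (c *: e_ i + y) (e_ j) t.
  move=> s st; apply: (Ck_derivable (Ck_pd i f2)).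
  by have [] := inU s c st ct.
exists (d *: e_ j + (c *: e_ i + y)); first by have [] := inU d c dt ct.
rewrite -/(g (t *: e_ i + y)) -/(g y) Ec; congr (_ * _).
by have [_ ->] := dg c ct.
Qed.

(** The second difference is symmetric in the two directions, so the two mixed derivatives agree at
    two points which may differ but are both close to [y]; continuity at [y] concludes. *)
Lemma schwarz U f y (i j : 'I_n) : open U -> Ck 2 U f -> U y ->
  'D_(e_ i) ('D_(e_ j) f) y = 'D_(e_ j) ('D_(e_ i) f) y.
Proof.
move=> oU f2 Uy; apply/eqP; rewrite -subr_eq0 -normr_le0; apply/ler_addgt0Pr => eps e0.
rewrite add0r.
have c2 (a b : 'I_n) : \forall z \near y,
    `|'D_(e_ a) ('D_(e_ b) f) y - 'D_(e_ a) ('D_(e_ b) f) z| <= eps / 2.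
  have /cvgrPdist_le := Ck_cont (Ck_pd a (Ck_pd b f2)) Uy.
  by apply; rewrite divr_gt0.
have : \forall z \near y, U z /\
    (`|'D_(e_ i) ('D_(e_ j) f) y - 'D_(e_ i) ('D_(e_ j) f) z| <= eps / 2 /\
     `|'D_(e_ j) ('D_(e_ i) f) y - 'D_(e_ j) ('D_(e_ i) f) z| <= eps / 2).
  apply: (@filterI _ (nbhs y)); first exact: open_nbhs_nbhs.
  by apply: (@filterI _ (nbhs y)); exact: c2.
move=> /nbhs_ballP[r /= r0 Hr].
(* The intermediate points of [second_difference] lie within [2 * t] of [y], hence inside the ball
   of radius [r]. *)
pose t := r / 3.
have t0 : 0 < t by rewrite divr_gt0.
have tr : `|t| + `|t| < r.
  by rewrite gtr0_norm// /t -mulrDl ltr_pdivrMr//; lra.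
have yU : ball y r `<=` U by move=> z /Hr[].
have inb p : `|p - y| <= `|t| + `|t| -> ball y r p.
  by move=> H; rewrite -ball_normE/= distrC; exact: le_lt_trans H tr.
have [p /inb/Hr[_ [_ Hp]] Ep] := second_difference i j oU f2 yU tr.
have [q /inb/Hr[_ [Hq _]] Eq] := second_difference j i oU f2 yU tr.
have cancel2 (a b c d u v : R) : a - b - (c - d) = t * (t * u) ->
    a - c - (b - d) = t * (t * v) -> u = v.
  move=> Eu Ev; apply: (mulfI (lt0r_neq0 t0)); apply: (mulfI (lt0r_neq0 t0)).
  by rewrite -Eu -Ev; ring.
rewrite (addrCA (t *: e_ i)) in Eq; have E := cancel2 _ _ _ _ _ _ Ep Eq.
have close (a b u v : R) : `|a - v| <= eps / 2 -> `|b - u| <= eps / 2 -> u = v ->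
    `|a - b| <= eps.
  move=> av bu uv; rewrite (le_trans (ler_distD v _ _))// (splitr eps) lerD//.
  by rewrite -uv distrC.
exact: close Hq Hp E.
Qed.

Definition segment_closed U := forall x y (s : R), U x -> U y -> 0 <= s <= 1 ->
  U (s *: (y - x) + x).

Lemma norm_segment x y (s r : R) : `|x| <= r -> `|y| <= r -> 0 <= s <= 1 ->
  `|s *: (y - x) + x| <= r.
Proof.
move=> xr yr /andP[s0 s1].
have -> : s *: (y - x) + x = s *: y + (1 - s) *: x.
  by rewrite scalerBr scalerBl scale1r -addrA; congr (_ + _); rewrite addrC.
rewrite (le_trans (ler_normD _ _))// !normrZ !ger0_norm ?subr_ge0//.
have -> : r = s * r + (1 - s) * r by rewrite -mulrDl addrC subrK mul1r.
by rewrite lerD// ler_wpM2l// subr_ge0.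
Qed.

Lemma segment_closed_ball (r : R) : segment_closed (ball 0 r).
Proof.
move=> x y s; rewrite -ball_normE/= !sub0r !normrN => xr yr s01.
have : `|s *: (y - x) + x| <= Num.max `|x| `|y|.
  by apply: norm_segment => //; rewrite le_max lexx ?orbT.
by move/le_lt_trans; apply; rewrite gt_max xr yr.
Qed.

Lemma mean_value U f x y : open U -> Ck 1 U f ->
  (forall s : R, 0 <= s <= 1 -> U (s *: (y - x) + x)) ->
  exists2 c : R, 0 <= c <= 1 &
    f y - f x = \sum_i (y - x) 0 i * 'D_(e_ i) f (c *: (y - x) + x).
Proof.
move=> oU f1 xyU.
have dg (s : R) : 0 <= s <= 1 -> is_derive s (1 : R)
    (fun t : R => f (t *: (y - x) + x)) ('D_(y - x) f (s *: (y - x) + x)).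
  move=> s01; apply: is_derive_line; apply: diff_derivable.
  by apply: (Ck_differentiable oU f1); exact: xyU.
have [s||c /[!in_itv]/= c01] := @MVT_segment R (fun t : R => f (t *: (y - x) + x))
   (fun s => 'D_(y - x) f (s *: (y - x) + x)) 0 1 ler01; last 1 first.
- rewrite scale1r subrK scale0r add0r subr0 mulr1 => ->; exists c => //.
  by rewrite diff_dir//; apply: (Ck_differentiable oU f1); exact: xyU.
- by rewrite in_itv/= => /andP[s0 s1]; apply: dg; rewrite !ltW.
- by apply: derivable_within_continuous => s /[!in_itv]/= /dg[].
Qed.

Lemma mean_value_le U f x y (K : R) : open U -> Ck 1 U f ->
  (forall s : R, 0 <= s <= 1 -> U (s *: (y - x) + x)) ->
  (forall i (s : R), 0 <= s <= 1 -> `|'D_(e_ i) f (s *: (y - x) + x)| <= K) ->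
  `|f y - f x| <= n%:R * (`|y - x| * K).
Proof.
move=> oU f1 xyU fK; have [c c01 ->] := mean_value oU f1 xyU.
rewrite (le_trans (ler_norm_sum _ _ _))//.
apply: (@le_trans _ _ (\sum_(i < n) `|y - x| * K)).
  by apply: ler_sum => i _; rewrite normrM ler_pM// ?coord_le_norm// fK.
by rewrite sumr_const card_ord mulr_natl.
Qed.

Lemma zero_derivatives_cst U f x y : open U -> segment_closed U -> Ck 1 U f ->
  (forall i z, U z -> 'D_(e_ i) f z = 0) -> U x -> U y -> f x = f y.
Proof.
move=> oU cU f1 f0 Ux Uy.
have xyU (s : R) : 0 <= s <= 1 -> U (s *: (y - x) + x) by move=> ?; exact: cU.
have [c c01 E] := mean_value oU f1 xyU.
apply/esym/eqP; rewrite -subr_eq0 E big1// => i _.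
by rewrite f0 ?mulr0//; exact: xyU.
Qed.

(** The right-hand side of the linear system is as regular as the unknown itself, so a continuous
    solution gains one order of differentiability at each step. *)
Lemma bootstrap U (I : finType) (Y : I -> 'rV[R]_n -> R)
    (A : 'I_n -> I -> I -> 'rV[R]_n -> R) : open U ->
  (forall i a b, smooth U (A i a b)) ->
  (forall a y, U y -> {for y, continuous (Y a)}) ->
  (forall i a y, U y -> is_derive y (e_ i) (Y a) (\sum_b A i a b y * Y b y)) ->
  forall a, smooth U (Y a).
Proof.
move=> oU sA cY dY a k; elim: k a => [|k IH] a; first by split=> // y; exact: cY.
split=> [y|i]; first exact: cY.
split=> [y Uy|]; first by have [] := dY i a y Uy.
apply: (@Ck_eq _ _ _ _ (fun y => \sum_b A i a b y * Y b y)) => //.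
  by move=> y Uy; have [_ ->] := dY i a y Uy.
by apply: Ck_sum => // b _; apply: Ck_mul => //; exact: sA.
Qed.

Lemma compact_closed_ball0 (r : R) : compact [set x : 'rV[R]_n | `|x| <= r].
Proof.
apply: bounded_closed_compact.
  by exists r; split; [exact: num_real|move=> M rM x /= xr; rewrite (le_trans xr)// ltW].
have -> : [set x : 'rV[R]_n | `|x| <= r] = closed_ball_ (fun v => `|v|) 0 r.
  by apply/seteqP; split => x; rewrite /closed_ball_ /= sub0r normrN.
exact: closed_closed_ball_.
Qed.

Lemma bounded_on_closed_ball U f (r : R) : Ck 0 U f ->
  (forall x, `|x| <= r -> U x) -> 0 <= r ->
  exists2 K : R, 0 <= K & forall x, `|x| <= r -> `|f x| <= K.
Proof.
move=> [cf _] rU r0.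
have [|||c /[!inE]/= cr H] := @EVT_max_rV R n (fun x => `|f x|) [set x | `|x| <= r].
- by exists 0 => /=; rewrite normr0.
- exact: compact_closed_ball0.
- apply: continuous_in_subspaceT => x /[!inE]/= xr.
  by apply: continuous_comp; [exact/cf/rU|exact: norm_continuous].
by exists `|f c| => // x xr; apply: H; rewrite inE.
Qed.

End Second.

(** * Completely integrable linear systems *)

(* Makes ['M[R]_(m, n)] a [completeNormedModType]; the library lacks this join. *)
HB.instance Definition _ (R : realType) (m n : nat) :=
  Uniform_isComplete.Build 'M[R]_(m, n) (@mx_complete R m n).

Section MatrixNorm.
Variable R : realType.

Lemma mx_entry_le m n (A : 'M[R]_(m, n)) i j : `|A i j| <= `|A|.
Proof.
rewrite [leRHS]/Num.Def.normr/= mx_normrE.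
exact: (le_bigmax _ _ (i, j)).
Qed.

Lemma mx_norm_le m n (A : 'M[R]_(m, n)) (r : R) :
  0 <= r -> (forall i j, `|A i j| <= r) -> `|A| <= r.
Proof.
move=> r0 H; rewrite [leLHS]/Num.Def.normr/= mx_normrE.
by apply: bigmax_le => // -[i j].
Qed.

Lemma norm_mulmx_le m n p (A : 'M[R]_(m, n)) (B : 'M[R]_(n, p)) :
  `|A *m B| <= n%:R * (`|A| * `|B|).
Proof.
apply: mx_norm_le; first by rewrite !mulr_ge0.
move=> i j; rewrite mxE (le_trans (ler_norm_sum _ _ _))//.
apply: (@le_trans _ _ (\sum_(k < n) `|A| * `|B|)).
  by apply: ler_sum => k _; rewrite normrM ler_pM// mx_entry_le.
by rewrite sumr_const card_ord mulr_natl.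
Qed.

Lemma norm_mulmx_bound m n p (A : 'M[R]_(m, n)) (B : 'M[R]_(n, p)) (a b : R) :
  `|A| <= a -> `|B| <= b -> `|A *m B| <= n%:R * (a * b).
Proof.
move=> Aa Bb; rewrite (le_trans (norm_mulmx_le _ _))// ler_wpM2l// ler_pM//.
Qed.

End MatrixNorm.

(** * Limits with an explicit rate *)

Section Limits.
Variable R : realType.

Lemma ler_add_inv_nat (a b C : R) : (forall m : nat, a <= b + C / m.+1%:R) -> a <= b.
Proof.
move=> H; apply/ler_addgt0Pr => e e0.
have [C0|C0] := leP C 0.
  rewrite (le_trans (H 0%N))// lerD2l divr1; exact: le_trans C0 (ltW e0).
pose m := Num.truncn (C / e).
rewrite (le_trans (H m))// lerD2l ler_pdivrMr// mulrC -ler_pdivrMr//.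
by rewrite ltW// truncnS_gt.
Qed.

(** The rate survives in the limit. Applied pointwise with one and the same [C], it expresses
    uniform convergence without a topology on functions. *)
Lemma cauchy_inv_nat_limit (V : completeNormedModType R) (u : nat -> V) (C : R) :
  0 <= C -> (forall m l, `|u m - u l| <= C / m.+1%:R + C / l.+1%:R) ->
  exists y, forall m, `|u m - y| <= C / m.+1%:R.
Proof.
move=> C0 uC.
have cu : cvgn u.
  apply/cauchy_cvgP/cauchy_exP => e e0.
  pose k := Num.truncn (2 * C / e).
  have kP : C / k.+1%:R < e / 2.
    rewrite ltr_pdivrMr// mulrC -ltr_pdivrMr ?divr_gt0// invf_div mulrA (mulrC C).
    exact: truncnS_gt.
  exists (u k); exists k => // l /= kl; rewrite -ball_normE/=.
  rewrite (le_lt_trans (uC _ _))// (splitr e) ltrD// (le_lt_trans _ kP)//.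
  by rewrite ler_wpM2l// lef_pV2 ?posrE// ler_nat.
exists (limn u) => m; apply/ler_addgt0Pr => e e0.
have /cvgrPdist_le /(_ (e / 2)) := cu; rewrite divr_gt0// => /(_ isT) [k _ kP].
pose l := maxn k (Num.truncn (2 * C / e)).
have lP : C / l.+1%:R <= e / 2.
  rewrite ler_pdivrMr// mulrC -ler_pdivrMr ?divr_gt0// invf_div mulrA (mulrC C).
  rewrite (le_trans (ltW (truncnS_gt _)))// ler_nat ltnS leq_maxr//.
rewrite (le_trans (ler_distD (u l) _ _))//.
have -> : C / m.+1%:R + e = C / m.+1%:R + e / 2 + e / 2.
  by rewrite -addrA -splitr.
apply: lerD; first by rewrite (le_trans (uC _ _))// lerD2l.
by rewrite distrC; apply: kP; rewrite /= leq_maxl.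
Qed.

(** A quadratic remainder is an inequality between values and passes to limits of functions; this is
    how the limit of the Euler products and the inverse map are differentiated. *)
Lemma is_derive_quadratic (V : normedModType R) (f : V -> R) x v (d L e : R) : 0 < e ->
  (forall s : R, `|s| < e -> `|f (s *: v + x) - f x - s * d| <= L * s ^+ 2) ->
  is_derive x v f d.
Proof.
move=> e0 H.
have L1 : 0 < `|L| + 1 by rewrite ltr_wpDl.
have c : (fun h : R => h^-1 *: ((f \o shift x) (h *: v) - f x)) @ 0^' --> d.
  apply/cvgrPdist_le => eps eps0.
  near=> h.
  have h0 : h != 0 by near: h; exact: nbhs_dnbhs_neq.
  have he : `|h| < e by near: h; exact: dnbhs0_lt.
  have he2 : `|h| < eps / (`|L| + 1) by near: h; apply: dnbhs0_lt; rewrite divr_gt0.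
  have E : d - h^-1 *: ((f \o shift x) (h *: v) - f x)
      = - (h^-1 * (f (h *: v + x) - f x - h * d)).
    by rewrite /= mulrBr mulKf// opprB.
  rewrite E normrN normrM normfV.
  rewrite ler_pdivrMl ?normr_gt0// (le_trans (H _ he))//.
  rewrite -real_normK ?num_real// expr2 mulrCA ler_wpM2l//.
  apply: (@le_trans _ _ ((`|L| + 1) * `|h|)).
    by rewrite ler_wpM2r// (le_trans (ler_norm _))// lerDl.
  by rewrite mulrC -ler_pdivlMr// ltW.
apply: DeriveDef; first by apply/cvg_ex; exists d.
exact: cvg_lim.
Unshelve. all: by end_near. Qed.

Lemma locally_lipschitz_continuous (V W : normedModType R) (f : V -> W) x (L e : R) :
  0 < e -> (forall z, `|z - x| < e -> `|f z - f x| <= L * `|z - x|) ->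
  {for x, continuous f}.
Proof.
move=> e0 H; apply/cvgrPdist_le => d d0.
have L1 : 0 < `|L| + 1 by rewrite ltr_wpDl.
near=> z.
have ze : `|z - x| < e by rewrite distrC; near: z; exact: cvgr_dist_lt.
have zd : `|z - x| <= d / (`|L| + 1).
  by rewrite distrC; near: z; apply: cvgr_dist_le => //; rewrite divr_gt0.
rewrite distrC (le_trans (H z ze))//.
apply: (@le_trans _ _ ((`|L| + 1) * `|z - x|)).
  by rewrite ler_wpM2r// (le_trans (ler_norm _))// lerDl.
by rewrite mulrC -ler_pdivlMr.
Unshelve. all: by end_near. Qed.

End Limits.

(** * Approximate solutions of a linear system and their limit *)

Section FlatSystem.
Variables (R : realType) (n N : nat).
Implicit Types (x y z : 'rV[R]_n) (A : 'I_n -> 'rV[R]_n -> 'M[R]_N).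

Local Notation e_ i := (delta_mx 0 i : 'rV[R]_n).

Lemma ball0E (r : R) x : ball 0 r x = (`|x| < r) :> Prop.
Proof. by rewrite -ball_normE /= sub0r normrN. Qed.

Lemma open_ball0 (r : R) : open (ball (0 : 'rV[R]_n) r).
Proof. exact: ball_open. Qed.

Definition pdmx m p (i : 'I_n) (A : 'rV[R]_n -> 'M[R]_(m, p)) x : 'M[R]_(m, p) :=
  \matrix_(a, b) 'D_(e_ i) (fun y => A y a b) x.

Lemma bounded_family (I : finType) U (F : I -> 'rV[R]_n -> R) (r : R) :
  (forall i, Ck 0 U (F i)) -> (forall x, `|x| <= r -> U x) -> 0 <= r ->
  exists2 K : R, 0 <= K & forall i x, `|x| <= r -> `|F i x| <= K.
Proof.
move=> CF rU r0.
have /choice [K HK] (i : I) : exists K : R, 0 <= K /\ forall x, `|x| <= r -> `|F i x| <= K.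
  by have [K K0 HK] := bounded_on_closed_ball (CF i) rU r0; exists K.
exists (\sum_i K i); first by apply: sumr_ge0 => i _; have [] := HK i.
move=> i x xr; rewrite (bigD1 i)//= (le_trans ((HK i).2 x xr))// lerDl.
by apply: sumr_ge0 => j _; have [] := HK j.
Qed.

Lemma bounded_mx_family (I : finType) m p U (F : I -> 'rV[R]_n -> 'M[R]_(m, p)) (r : R) :
  (forall i a b, Ck 0 U (fun y => F i y a b)) -> (forall x, `|x| <= r -> U x) ->
  0 <= r -> exists2 K : R, 0 <= K & forall i x, `|x| <= r -> `|F i x| <= K.
Proof.
move=> CF rU r0.
have [|//|//|K K0 HK] := @bounded_family (I * 'I_m * 'I_p)%type U
    (fun t x => F t.1.1 x t.1.2 t.2) r.
  by move=> t; exact: CF.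
by exists K => // i x xr; apply: mx_norm_le => // a b; exact: (HK (i, a, b)).
Qed.

Lemma mean_value_mx m p (U : set 'rV[R]_n) (F : 'rV[R]_n -> 'M[R]_(m, p)) (r K : R) x y :
  open U -> (forall a b, Ck 1 U (fun z => F z a b)) -> (forall z, `|z| <= r -> U z) ->
  0 <= K -> (forall i z, `|z| <= r -> `|pdmx i F z| <= K) -> `|x| <= r -> `|y| <= r ->
  `|F y - F x| <= n%:R * (`|y - x| * K).
Proof.
move=> oU F1 rU K0 HK xr yr; apply: mx_norm_le; first by rewrite !mulr_ge0.
move=> a b; rewrite !mxE; apply: (mean_value_le oU (F1 a b)).
  by move=> s s01; apply: rU; exact: norm_segment.
move=> i s s01; have := mx_entry_le (pdmx i F (s *: (y - x) + x)) a b.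
rewrite mxE => /le_trans; apply; apply: HK; exact: norm_segment.
Qed.

Lemma pdmxB m p i (F G : 'rV[R]_n -> 'M[R]_(m, p)) x :
  (forall a b, derivable (fun z => F z a b) x (e_ i)) ->
  (forall a b, derivable (fun z => G z a b) x (e_ i)) ->
  pdmx i (fun z => F z - G z) x = pdmx i F x - pdmx i G x.
Proof.
move=> dF dG; apply/matrixP => a b; rewrite !mxE -deriveB//.
by congr ('D_ _ _ _); apply/funext => z; rewrite !mxE.
Qed.

Section Limit.
Variables (A : 'I_n -> 'rV[R]_n -> 'M[R]_N) (r0 r : R) (Y0 : 'cV[R]_N)
  (P : nat -> 'rV[R]_n -> 'cV[R]_N) (Q D : R).
Hypotheses (r_gt0 : 0 < r) (r_lt : r < r0) (Q_ge0 : 0 <= Q) (D_ge0 : 0 <= D)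
  (A_smooth : forall i a b, smooth (ball 0 r0) (fun y => A i y a b))
  (P_C1 : forall m a b, Ck 1 (ball 0 r0) (fun y => P m y a b))
  (P_at0 : forall m, P m 0 = Y0)
  (P_bounded : forall m x, `|x| <= r -> `|P m x| <= Q)
  (P_approx : forall m i x, `|x| <= r ->
     `|pdmx i (P m) x - A i x *m P m x| <= D / m.+1%:R).

Let in_ball0 x : `|x| <= r -> ball 0 r0 x.
Proof. by rewrite ball0E => /le_lt_trans; apply. Qed.

(* The difference [w] of two approximate solutions vanishes at [0] and satisfies
   |D w| <= N K |w| + O(1/m), so the mean value inequality on a small ball bounds
   sup |w| by half of itself plus O(1/m). *)
Lemma approximate_solutions_cauchy (K rho : R) : 0 <= K -> 0 < rho -> rho <= r ->
  (forall i x, `|x| <= r -> `|A i x| <= K) -> n%:R * (rho * (N%:R * K)) <= 1 / 2 ->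
  exists2 C : R, 0 <= C & forall x m l, `|x| <= rho ->
    `|P m x - P l x| <= C / m.+1%:R + C / l.+1%:R.
Proof.
move=> K0 rho0 rhor AK small.
exists (2 * (n%:R * (rho * D))); first by rewrite !mulr_ge0// ltW.
move=> x m l xr.
pose w z := P m z - P l z.
have cw : forall a b, Ck 1 (ball 0 r0) (fun z => w z a b).
  move=> a b; apply: (@Ck_eq _ _ _ _ (fun z => P m z a b + (-1) * P l z a b)).
  - exact: open_ball0.
  - by move=> y _; rewrite !mxE mulN1r.
  - apply: Ck_add; [exact: open_ball0|exact: P_C1|].
    by apply: Ck_mul; [exact: open_ball0|exact: Ck_cst|exact: P_C1].
have rhoU z : `|z| <= rho -> ball 0 r0 z by move=> /le_trans /(_ rhor); exact: in_ball0.
have [c cr Hc] : exists2 c, `|c| <= rho & forall z, `|z| <= rho -> `|w z| <= `|w c|.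
  have [|||c /[!inE]/= cr H] := @EVT_max_rV R n (fun x => `|w x|) [set x | `|x| <= rho].
  - by exists 0 => /=; rewrite normr0 ltW.
  - exact: compact_closed_ball0.
  - apply: continuous_in_subspaceT => z /[!inE]/= xr'.
    apply: continuous_comp; last exact: norm_continuous.
    by apply: continuous_mxP => a b; apply: (Ck_cont (cw a b)); exact: rhoU.
  - by exists c => // z zr; apply: H; rewrite inE.
pose M := `|w c|; pose d := D / m.+1%:R + D / l.+1%:R.
have d0 : 0 <= d by rewrite addr_ge0// divr_ge0.
have dw i z : `|z| <= rho -> `|pdmx i w z| <= N%:R * (K * M) + d.
  move=> zr; have zr' := le_trans zr rhor.
  rewrite pdmxB; last 2 first.
    by move=> a b; apply: (Ck_derivable (P_C1 m a b)); exact: in_ball0.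
    by move=> a b; apply: (Ck_derivable (P_C1 l a b)); exact: in_ball0.
  have -> : pdmx i (P m) z - pdmx i (P l) z = A i z *m w z +
      ((pdmx i (P m) z - A i z *m P m z) - (pdmx i (P l) z - A i z *m P l z)).
    by rewrite /w mulmxBr opprB [RHS]addrACA (addrCA (A i z *m P m z)) subrr addr0 addKr.
  rewrite (le_trans (ler_normD _ _))// lerD//.
    by apply: norm_mulmx_bound; [exact: AK|exact: Hc].
  by rewrite (le_trans (ler_normB _ _))// lerD//; exact: P_approx.
have M0 : 0 <= M by exact: normr_ge0.
have w0 : w 0 = 0 by rewrite /w !P_at0 subrr.
have wz z : `|z| <= rho -> `|w z| <= n%:R * (rho * (N%:R * (K * M) + d)).
  move=> zr; rewrite -[w z]subr0 -w0.
  have H0 : 0 <= N%:R * (K * M) + d by rewrite addr_ge0 ?mulr_ge0.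
  have H1 : `|0 : 'rV[R]_n| <= rho by rewrite normr0 ltW.
  have /le_trans := mean_value_mx (@open_ball0 r0) cw rhoU H0 dw H1 zr; apply.
  by rewrite subr0 ler_wpM2l// ler_wpM2r.
have HM : M <= 2 * (n%:R * (rho * d)).
  have := wz c cr; rewrite -/M => H.
  have : n%:R * (rho * (N%:R * (K * M) + d)) <= 1 / 2 * M + n%:R * (rho * d).
    have := ler_wpM2r M0 small.
    by move: (n%:R : R) (N%:R : R) => a b; lra.
  lra.
rewrite (le_trans (Hc x xr))// (le_trans HM)// /d.
by rewrite le_eqVlt; apply/orP; left; apply/eqP; ring.
Qed.

(** The remainder bound [quad] has a coefficient of [s ^+ 2] independent of [m], while the cost of
    replacing the limit by [P m] tends to 0. Together with the Lipschitz bound inherited from the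
    approximations this gives derivative and continuity, and [bootstrap] gives smoothness. *)
Lemma approximate_solutions_limit : exists2 rho : R, 0 < rho /\ rho <= r &
  exists Y : 'rV[R]_n -> 'cV[R]_N, [/\ Y 0 = Y0,
    forall a b, smooth (ball 0 rho) (fun y => Y y a b) &
    forall i y, ball 0 rho y -> pdmx i Y y = A i y *m Y y].
Proof.
have r0' := ltW r_gt0.
have [||//|K K0 AK] := @bounded_mx_family _ N N (ball 0 r0) A r.
- by move=> i a b; exact: A_smooth.
- exact: in_ball0.
have [||//|K' K'0 AK'] := @bounded_mx_family ('I_n * 'I_n)%type N N (ball 0 r0)
    (fun t => pdmx t.1 (A t.2)) r.
- move=> [j i] a b /=.
  rewrite (_ : (fun y => _) = fun y => 'D_(e_ j) (fun z => A i z a b) y).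
    exact: (Ck_pd j (A_smooth i a b 1)).
  by apply/funext => y; rewrite mxE.
- exact: in_ball0.
pose c := n%:R * (N%:R * K).
have c0 : 0 <= c by rewrite !mulr_ge0.
have c10 : 0 < c + 1 by rewrite ltr_wpDl.
(* This radius makes the coefficient in the mean value inequality at most 1/2; adding 1 to [c]
   avoids dividing by 0. *)
pose rho := Num.min r (1 / 2 / (c + 1)).
have rho0 : 0 < rho by rewrite lt_min r_gt0 !divr_gt0.
have rhor : rho <= r by rewrite ge_min lexx.
have small : n%:R * (rho * (N%:R * K)) <= 1 / 2.
  rewrite mulrCA -/c; have : rho <= 1 / 2 / (c + 1) by rewrite ge_min lexx orbT.
  rewrite ler_pdivlMr// => H; rewrite (le_trans _ H)// ler_wpM2l ?ltW//.
  by rewrite ltrDl.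
have [C C0 HC] := approximate_solutions_cauchy K0 rho0 rhor AK small.
have /choice [Y HY] x : exists y : 'cV[R]_N, `|x| <= rho -> forall m, `|P m x - y| <= C / m.+1%:R.
  have [xr|] := boolP (`|x| <= rho); last by exists 0.
  have [y Hy] := cauchy_inv_nat_limit C0 (fun m l => HC x m l xr).
  by exists y.
exists rho => //; exists Y.
have Y00 : Y 0 = Y0.
  apply/eqP; rewrite -subr_eq0 -normr_le0; apply: (@ler_add_inv_nat _ _ _ C) => m.
  by rewrite add0r distrC -(P_at0 m); apply: HY; rewrite normr0 ltW.
pose L := N%:R * (K * Q) + D.
have L0 : 0 <= L by rewrite addr_ge0// !mulr_ge0.
have PL m i z : `|z| <= r -> `|pdmx i (P m) z| <= L.
  move=> zr; rewrite -[X in `|X|](subrK (A i z *m P m z)).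
  rewrite (le_trans (ler_normD _ _))// addrC lerD//.
    by apply: norm_mulmx_bound; [exact: AK|exact: P_bounded].
  rewrite (le_trans (P_approx m i zr))// ler_pdivrMr// ler_peMr//.
  by rewrite ler1n.
have PLip m x y : `|x| <= r -> `|y| <= r -> `|P m y - P m x| <= n%:R * (`|y - x| * L).
  exact: (mean_value_mx (@open_ball0 r0) (P_C1 m) in_ball0 L0 (PL m)).
have ALip i x y : `|x| <= r -> `|y| <= r ->
    `|A i y - A i x| <= n%:R * (`|y - x| * K').
  apply: (mean_value_mx (@open_ball0 r0) (fun a b => A_smooth i a b 1) in_ball0 K'0).
  by move=> j z; exact: (AK' (j, i)).
pose L1 := N%:R * (n%:R * K' * Q) + N%:R * (K * (n%:R * L)).
have quad i a b x (s : R) : `|x| < rho -> `|s| < rho - `|x| ->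
    `|Y (s *: e_ i + x) a b - Y x a b - s * (A i x *m Y x) a b| <= L1 * s ^+ 2.
  move=> xr sr.
  pose C2 := C + C + `|s| * (D + N%:R * (K * C)).
  apply: (@ler_add_inv_nat _ _ _ C2) => m.
  have inr (u : R) : `|u| <= `|s| -> `|u *: e_ i + x| <= rho.
    move=> us; rewrite (le_trans (ler_normD _ _))// -lerBrDr.
    by rewrite (le_trans (norm_delta _ _))// (le_trans us)// ltW.
  have inr' (u : R) : `|u| <= `|s| -> `|u *: e_ i + x| <= r.
    by move=> /inr /le_trans; apply.
  have xr1 : `|x| <= rho by rewrite ltW.
  have xr' : `|x| <= r by rewrite (le_trans xr1).
  have [|u us E] := @MVT_line R _ (fun z => P m z a b) x (e_ i) s.
    move=> u us; apply: (Ck_derivable (P_C1 m a b)); apply: in_ball0; exact: inr'.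
  set z := u *: e_ i + x in E; have zr : `|z| <= r by exact: inr'.
  have zx : `|z - x| <= `|s|.
    by rewrite /z addrK (le_trans (norm_delta _ _)).
  (* The remainder is split: [V0] replaces [Y] by [P m] at both ends, [V1] is the defect of [P m] at
     the intermediate point, [V2] the variation of [A i *m P m] from [x] to that point, [V3] goes
     back from [P m] to [Y]. All but [V2], which is O([s]), disappear as [m] grows. *)
  pose V0 := (Y (s *: e_ i + x) - P m (s *: e_ i + x)) + (P m x - Y x).
  pose V1 := pdmx i (P m) z - A i z *m P m z.
  pose V2 := (A i z - A i x) *m P m z + A i x *m (P m z - P m x).
  pose V3 := A i x *m (P m x - Y x).
  have -> : Y (s *: e_ i + x) a b - Y x a b - s * (A i x *m Y x) a b =
      (V0 + s *: (V1 + V2 + V3)) a b.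
    have -> : V1 + V2 + V3 = pdmx i (P m) z - A i x *m Y x.
      rewrite /V1 /V2 /V3 mulmxBl !mulmxBr.
      by rewrite [_ - _ + (_ - _)]addrA !addrA !subrK.
    rewrite /V0 !mxE mulrBr -E; ring.
  rewrite (le_trans (mx_entry_le _ _ _))//.
  have H0 : `|V0| <= C / m.+1%:R + C / m.+1%:R.
    rewrite (le_trans (ler_normD _ _))// lerD//; last exact: HY.
    by rewrite distrC; apply: HY => //; exact: inr.
  have H1 : `|V1| <= D / m.+1%:R by exact: P_approx.
  have H2 : `|V2| <= L1 * `|s|.
    have n0 : 0 <= n%:R :> R by [].
    have HA : `|A i z - A i x| <= n%:R * (`|s| * K').
      by rewrite (le_trans (ALip i _ _ xr' zr))// ler_wpM2l// ler_wpM2r.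
    have HP : `|P m z - P m x| <= n%:R * (`|s| * L).
      by rewrite (le_trans (PLip m _ _ xr' zr))// ler_wpM2l// ler_wpM2r.
    have B1 := norm_mulmx_bound HA (P_bounded m zr).
    have B2 := norm_mulmx_bound (AK i x xr') HP.
    rewrite (le_trans (ler_normD _ _))// (le_trans (lerD B1 B2))//.
    by rewrite le_eqVlt; apply/orP; left; apply/eqP; rewrite /L1; ring.
  have H3 : `|V3| <= N%:R * (K * (C / m.+1%:R)).
    by apply: norm_mulmx_bound; [exact: AK|exact: HY].
  rewrite (le_trans (ler_normD _ _))// normrZ.
  have B : `|V1 + V2 + V3| <= D / m.+1%:R + L1 * `|s| + N%:R * (K * (C / m.+1%:R)).
    rewrite (le_trans (ler_normD _ _))// lerD//.
    by rewrite (le_trans (ler_normD _ _))// lerD.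
  rewrite (le_trans (lerD H0 (ler_wpM2l (normr_ge0 s) B)))//.
  rewrite -real_normK ?num_real//.
  by rewrite le_eqVlt; apply/orP; left; apply/eqP; rewrite /C2; ring.
have dY i a b x : ball 0 rho x ->
    is_derive x (e_ i) (fun y => Y y a b) ((A i x *m Y x) a b).
  rewrite ball0E => xr; apply: (@is_derive_quadratic _ _ _ _ _ _ L1 (rho - `|x|)).
    by rewrite subr_gt0.
  by move=> s; exact: quad.
have YLip x y : `|x| <= rho -> `|y| <= rho -> `|Y y - Y x| <= n%:R * (`|y - x| * L).
  move=> xr yr; apply: (@ler_add_inv_nat _ _ _ (C + C)) => m.
  have -> : Y y - Y x = (P m y - P m x) + ((Y y - P m y) + (P m x - Y x)).
    by rewrite addrCA [P m y - P m x + _]addrA subrK addrA subrK.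
  rewrite (le_trans (ler_normD _ _))// lerD//.
    by apply: PLip; exact: le_trans rhor.
  rewrite (le_trans (ler_normD _ _))// mulrDl lerD//; last exact: HY.
  by rewrite distrC; exact: HY.
split=> //.
- move=> a b; rewrite (ord1 b).
  apply: (@bootstrap R n (ball 0 rho) 'I_N (fun a y => Y y a 0)
    (fun i a b y => A i y a b)) => //.
  + exact: open_ball0.
  + move=> i a' b' k; apply: Ck_sub (A_smooth i a' b' k).
    by move=> y; rewrite !ball0E => /lt_trans; apply; exact: le_lt_trans r_lt.
  + move=> a' y yb; have := yb; rewrite ball0E => yr.
    apply: (@locally_lipschitz_continuous _ _ _ _ y (n%:R * L) (rho - `|y|)).
      by rewrite subr_gt0.
    move=> z zy; have zr : `|z| <= rho.
      rewrite -[z](subrK y) (le_trans (ler_normD _ _))// ltW//.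
      by rewrite -ltrBrDr.
    have := mx_entry_le (Y z - Y y) a' 0; rewrite !mxE => /le_trans; apply.
    by rewrite (le_trans (YLip y z (ltW yr) zr))// -mulrA [L * _]mulrC.
  + move=> i a' y yb; apply: is_derive_eq (dY i a' 0 y yb) _.
    by rewrite mxE.
- move=> i y yb; apply/matrixP => a b; rewrite mxE.
  by have [_ ->] := dY i a b y yb.
Qed.

End Limit.
End FlatSystem.

Lemma is_derive_sumE (R : realType) (V : normedModType R) (I : Type) (r : seq I)
    (P : pred I) (f : I -> V -> R) (df : I -> R) (x v : V) :
  (forall i, P i -> is_derive x v (f i) (df i)) ->
  is_derive x v (fun y => \sum_(i <- r | P i) f i y) (\sum_(i <- r | P i) df i).
Proof.
move=> H; elim: r => [|i r IH].
  rewrite big_nil (_ : (fun y => _) = cst 0); first exact: is_derive_cst.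
  by apply/funext => y; rewrite big_nil.
rewrite big_cons (_ : (fun y => _) = fun y => if P i then +%R (f i y) (\sum_(i <- r | P i) f i y)
  else \sum_(i <- r | P i) f i y); last by apply/funext => y; rewrite big_cons.
by case Pi : (P i) => //; apply: is_deriveD; exact: H.
Qed.

Lemma is_deriveMR (R : realType) (V : normedModType R) (f g : V -> R) (df dg : R)
    (x v : V) : is_derive x v f df -> is_derive x v g dg ->
  is_derive x v (fun y => f y * g y) (df * g x + f x * dg).
Proof.
move=> Hf Hg; have := is_deriveM Hf Hg => H; apply: is_derive_eq H _.
by rewrite addrC mulrC.
Qed.

Section MatrixDerivative.
Variables (R : realType) (n : nat).
Implicit Types (x y z : 'rV[R]_n).

Local Notation e_ i := (delta_mx 0 i : 'rV[R]_n).

Definition is_dmx m p (i : 'I_n) x (F : 'rV[R]_n -> 'M[R]_(m, p)) (F' : 'M[R]_(m, p)) :=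
  forall a b, is_derive x (e_ i) (fun y => F y a b) (F' a b).

Lemma is_dmx_pdmx m p i x (F : 'rV[R]_n -> 'M[R]_(m, p)) F' :
  is_dmx i x F F' -> pdmx i F x = F'.
Proof. by move=> H; apply/matrixP => a b; rewrite mxE; have [_ ->] := H a b. Qed.

Lemma pdmxP m p i x (F : 'rV[R]_n -> 'M[R]_(m, p)) :
  (forall a b, derivable (fun y => F y a b) x (e_ i)) -> is_dmx i x F (pdmx i F x).
Proof. by move=> H a b; rewrite mxE; exact: derivableP. Qed.

Lemma is_dmx_add m p i x (F G : 'rV[R]_n -> 'M[R]_(m, p)) F' G' :
  is_dmx i x F F' -> is_dmx i x G G' -> is_dmx i x (fun y => F y + G y) (F' + G').
Proof.
move=> HF HG a b; rewrite mxE; have := HF a b; have := HG a b => H1 H2.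
rewrite (_ : (fun y => _) = (fun y => F y a b) + (fun y => G y a b)).
  exact: is_deriveD.
by apply/funext => y; rewrite mxE.
Qed.

Lemma is_dmx_scale m p i x (f : 'rV[R]_n -> R) (F : 'rV[R]_n -> 'M[R]_(m, p)) f' F' :
  is_derive x (e_ i) f f' -> is_dmx i x F F' ->
  is_dmx i x (fun y => f y *: F y) (f' *: F x + f x *: F').
Proof.
move=> Hf HF a b; rewrite !mxE; have := HF a b => H1.
rewrite (_ : (fun y => _) = (fun y => f y * F y a b)); first exact: is_deriveMR.
by apply/funext => y; rewrite mxE.
Qed.

Lemma is_dmx_scale_cst m p i x (c : R) (F : 'rV[R]_n -> 'M[R]_(m, p)) F' :
  is_dmx i x F F' -> is_dmx i x (fun y => c *: F y) (c *: F').
Proof.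
move=> HF; have := is_dmx_scale (is_derive_cst c x (e_ i)) HF.
by rewrite scale0r add0r.
Qed.

Lemma is_dmx_sum m p i x (I : Type) (r : seq I) (F : I -> 'rV[R]_n -> 'M[R]_(m, p)) F' :
  (forall k, is_dmx i x (F k) (F' k)) ->
  is_dmx i x (fun y => \sum_(k <- r) F k y) (\sum_(k <- r) F' k).
Proof.
move=> H a b; rewrite summxE.
rewrite (_ : (fun y => _) = (fun y => \sum_(k <- r) F k y a b)).
  by apply: is_derive_sumE => k _; exact: H.
by apply/funext => y; rewrite summxE.
Qed.

Lemma is_dmx_mul m p q i x (F : 'rV[R]_n -> 'M[R]_(m, p)) (G : 'rV[R]_n -> 'M[R]_(p, q))
    F' G' : is_dmx i x F F' -> is_dmx i x G G' ->
  is_dmx i x (fun y => F y *m G y) (F' *m G x + F x *m G').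
Proof.
move=> HF HG a b; rewrite !mxE -big_split/=.
rewrite (_ : (fun y => _) = (fun y => \sum_k F y a k * G y k b)).
  by apply: is_derive_sumE => k _; exact: is_deriveMR.
by apply/funext => y; rewrite mxE.
Qed.

Lemma is_derive_dilation i x (s : R) (f : 'rV[R]_n -> R) : differentiable f (s *: x) ->
  is_derive x (e_ i) (fun y => f (s *: y)) (s * 'D_(e_ i) f (s *: x)).
Proof.
move=> df.
have D j : is_derive x (e_ i) (fun y : 'rV[R]_n => (s *: y) 0 j) (s * (e_ i) 0 j).
  rewrite (_ : (fun y => _) = (fun y : 'rV[R]_n => cst s y * y 0 j)); last first.
    by apply/funext => y; rewrite mxE.
  apply: is_derive_eq (is_deriveMR (is_derive_cst s x (e_ i)) (is_derive_coord j x (e_ i))) _.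
  by rewrite mul0r add0r.
have dD j : derivable (fun y : 'rV[R]_n => (s *: y) 0 j) x (e_ i) by have [] := D j.
apply: is_derive_eq (is_derive_comp_rV (h := fun y => s *: y) dD df) _.
rewrite (bigD1 i)//= big1 ?addr0; last first.
  move=> j ji; have [_ ->] := D j; rewrite mxE eqxx/= (negbTE ji) mulr0 mul0r//.
by have [_ ->] := D i; rewrite mxE !eqxx mulr1.
Qed.

Lemma is_dmx_dilation m p i x (s : R) (F : 'rV[R]_n -> 'M[R]_(m, p)) :
  (forall a b, differentiable (fun y => F y a b) (s *: x)) ->
  is_dmx i x (fun y => F (s *: y)) (s *: pdmx i F (s *: x)).
Proof. by move=> dF a b; rewrite !mxE; exact: (is_derive_dilation i (dF a b)). Qed.

(** Second-order expansion along the ray through [x], with a bound uniform in [s] and [x]; [r <= 1]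
    absorbs the factors [x 0 k], and [s + h <= 1] keeps the segment in the ball. *)
Lemma taylor_mx m p (U : set 'rV[R]_n) (F : 'rV[R]_n -> 'M[R]_(m, p)) (r K s h : R) x :
  open U -> (forall a b, Ck 2 U (fun z => F z a b)) -> (forall z, `|z| <= r -> U z) ->
  0 <= K -> (forall k l z, `|z| <= r -> `|pdmx l (pdmx k F) z| <= K) ->
  `|x| <= r -> r <= 1 -> 0 <= s -> 0 <= h -> s + h <= 1 ->
  `|F ((s + h) *: x) - F (s *: x) - h *: \sum_k x 0 k *: pdmx k F (s *: x)|
    <= h ^+ 2 * (n%:R * (n%:R * K)).
Proof.
move=> oU F2 rU K0 HK xr r1 s0 h0 sh1.
have inr (u : R) : `|u| <= `|h| -> `|u *: x + s *: x| <= r.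
  rewrite (ger0_norm h0) => uh; rewrite -scalerDl normrZ (le_trans _ xr)// ler_piMl//.
  by rewrite (le_trans (ler_normD _ _))// (ger0_norm s0) addrC (le_trans _ sh1)// lerD2l.
have x1 : `|x| <= 1 by exact: le_trans r1.
apply: mx_norm_le; first by rewrite !mulr_ge0// exprn_ge0.
move=> a b; pose f z := F z a b.
have df z : `|z| <= r -> differentiable f z.
  by move=> zr; apply: (Ck_differentiable oU (F2 a b)); exact: rU.
have [|c ch E] := @MVT_line R _ f (s *: x) x h.
  by move=> u uh; apply: diff_derivable; apply: df; exact: inr.
rewrite -scalerDl [h + s]addrC diff_dir in E; last by apply: df; exact: inr.
rewrite !mxE summxE -/(f _) -/(f _) E -mulrBr -sumrB.
rewrite normrM (ger0_norm h0) expr2 -mulrA ler_wpM2l//.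
rewrite (le_trans (ler_norm_sum _ _ _))//.
apply: (@le_trans _ _ (\sum_(k < n) h * (n%:R * K))); last first.
  by rewrite sumr_const card_ord -[_ *+ n]mulr_natl mulrCA.
apply: ler_sum => k _; rewrite !mxE -mulrBr normrM.
have xk : `|x 0 k| <= 1 by rewrite (le_trans (coord_le_norm _ _)).
rewrite -[leRHS]mul1r ler_pM//.
have sxr : `|s *: x| <= r by have := inr 0; rewrite scale0r add0r; apply; rewrite normr0.
have C1 a' b' : Ck 1 U (fun z => pdmx k F z a' b').
  rewrite (_ : (fun y => _) = fun y => 'D_(e_ k) (fun z => F z a' b') y).
    exact: (Ck_pd k (F2 a' b')).
  by apply/funext => y; rewrite mxE.
have := mean_value_mx oU C1 rU K0 (HK k) sxr (inr c ch).
have := mx_entry_le (pdmx k F (c *: x + s *: x) - pdmx k F (s *: x)) a b.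
rewrite !mxE => /le_trans H /H /le_trans; apply.
rewrite addrK normrZ mulrCA ler_wpM2r ?mulr_ge0// -[leRHS]mulr1 ler_pM//.
by rewrite -(ger0_norm h0).
Qed.

End MatrixDerivative.

(** * Euler products and the solution of a flat system *)

Section Euler.
Variables (R : realType) (n N : nat).
Implicit Types (x y z : 'rV[R]_n).
Local Notation e_ i := (delta_mx 0 i : 'rV[R]_n).

Variables (A : 'I_n -> 'rV[R]_n -> 'M[R]_N) (Y0 : 'cV[R]_N).

(** Coefficient of the radial equation d/ds Y(s x) = (sum_k x_k A_k(s x)) Y(s x) at s = j h. *)
Definition euler_slope (h : R) (j : nat) x : 'M[R]_N :=
  \sum_k x 0 k *: A k ((j%:R * h) *: x).

(** Euler scheme for the radial equation, regarded as a function of the direction [x]: after [j]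
    steps it approximates the solution at [(j%:R * h) *: x], hence at [x] itself when
    [j%:R * h = 1]. *)
Fixpoint euler (h : R) (j : nat) x : 'cV[R]_N :=
  if j is j'.+1 then euler h j' x + h *: (euler_slope h j' x *m euler h j' x) else Y0.

Lemma euler_at0 h j : euler h j 0 = Y0.
Proof.
elim: j => //= j ->; rewrite /euler_slope big1 ?mul0mx ?scaler0 ?addr0// => k _.
by rewrite mxE scale0r.
Qed.

Variable r0 : R.
Hypothesis r0_gt0 : 0 < r0.
Hypothesis A_smooth : forall i a b, smooth (ball 0 r0) (fun y => A i y a b).
Hypothesis A_flat : forall i j x, ball 0 r0 x ->
  pdmx i (A j) x + A j x *m A i x = pdmx j (A i) x + A i x *m A j x.

Let oU : open (ball (0 : 'rV[R]_n) r0). Proof. exact: open_ball0. Qed.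

Lemma dilation_ball (s : R) x : 0 <= s -> s <= 1 -> ball 0 r0 x -> ball 0 r0 (s *: x).
Proof.
move=> s0 s1; rewrite !ball0E normrZ ger0_norm// => /(le_lt_trans _); apply.
exact: ler_piMl.
Qed.

Lemma euler_slope_smooth h j a b k : 0 <= h -> j%:R * h <= 1 ->
  Ck k (ball 0 r0) (fun x => euler_slope h j x a b).
Proof.
move=> h0 jh; rewrite /euler_slope.
rewrite (_ : (fun y => _) = fun x : 'rV[R]_n => \sum_l x 0 l * A l ((j%:R * h) *: x) a b).
  apply: Ck_sum => // l _; apply: Ck_mul => //; first exact: Ck_coord.
  apply: (@Ck_comp R n n k (ball 0 r0) (ball 0 r0) (fun y => A l y a b)
    (fun x => (j%:R * h) *: x)) => //; first by move=> y; apply: dilation_ball; rewrite ?mulr_ge0.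
    exact: A_smooth.
  move=> i; rewrite (_ : (fun y => _) = fun x : 'rV[R]_n => (j%:R * h) * x 0 i).
    by apply: Ck_mul => //; [exact: Ck_cst|exact: Ck_coord].
  by apply/funext => y; rewrite mxE.
by apply/funext => y; rewrite summxE; apply: eq_bigr => l _; rewrite mxE.
Qed.

Lemma euler_smooth h j a b k : 0 <= h -> j%:R * h <= 1 ->
  Ck k (ball 0 r0) (fun x => euler h j x a b).
Proof.
move=> h0; elim: j a b => [|j IH] a b jh /=; first exact: Ck_cst.
have jh' : j%:R * h <= 1 by rewrite (le_trans _ jh)// ler_wpM2r// ler_nat.
rewrite (_ : (fun y => _) = fun x : 'rV[R]_n => euler h j x a b +
    h * \sum_c euler_slope h j x a c * euler h j x c b).
  apply: Ck_add => //; first exact: IH.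
  apply: Ck_mul => //; first exact: Ck_cst.
  apply: Ck_sum => // c _; apply: Ck_mul => //; last exact: IH.
  exact: euler_slope_smooth.
by apply/funext => y; rewrite !mxE.
Qed.

Lemma euler_slope_derivative h j i x : 0 <= h -> j%:R * h <= 1 -> ball 0 r0 x ->
  is_dmx i x (euler_slope h j) (A i ((j%:R * h) *: x) +
    (j%:R * h) *: \sum_k x 0 k *: pdmx i (A k) ((j%:R * h) *: x)).
Proof.
move=> h0 jh xU; set s := j%:R * h; have s0 : 0 <= s by rewrite mulr_ge0.
have -> : A i (s *: x) + s *: \sum_k x 0 k *: pdmx i (A k) (s *: x) =
  \sum_k ((e_ i) 0 k *: A k (s *: x) + x 0 k *: (s *: pdmx i (A k) (s *: x))).
  have Ei : \sum_k (e_ i) 0 k *: A k (s *: x) = A i (s *: x).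
    rewrite (bigD1 i)//= mxE !eqxx scale1r big1 ?addr0// => k ki.
    by rewrite mxE eqxx/= (negbTE ki) scale0r.
  rewrite big_split/= Ei scaler_sumr; congr (_ + _); apply: eq_bigr => k _.
  by rewrite !scalerA mulrC.
apply: is_dmx_sum => k; apply: is_dmx_scale; first exact: is_derive_coord.
apply: is_dmx_dilation => a b; apply: (Ck_differentiable oU (A_smooth k a b 1)).
exact: dilation_ball.
Qed.

(** Since [euler h j x] stands for Y(s x) with s = j h, the chain rule puts a factor s in front of
    the coefficient matrix. *)
Definition euler_defect h j i x : 'cV[R]_N :=
  pdmx i (euler h j) x - (j%:R * h) *: (A i ((j%:R * h) *: x) *m euler h j x).

Lemma euler_defect0 h i x : euler_defect h 0 i x = 0.
Proof.
rewrite /euler_defect mul0r scale0r subr0; apply: is_dmx_pdmx => a b.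
rewrite mxE; exact: is_derive_cst.
Qed.

(* Flatness cancels the term [h * s], which is only O([h]); what one step adds to
   the defect is O([h ^+ 2]). *)
Lemma euler_defectS h j i x : 0 <= h -> j.+1%:R * h <= 1 -> ball 0 r0 x ->
  let s := j%:R * h in
  let W := \sum_k x 0 k *: pdmx k (A i) (s *: x) in
  let T := A i ((s + h) *: x) - A i (s *: x) - h *: W in
  let S := euler_slope h j x in
  let P := euler h j x in
  euler_defect h j.+1 i x = euler_defect h j i x + h *: (S *m euler_defect h j i x)
    - h ^+ 2 *: (A i (s *: x) *m (S *m P) + W *m P + (s + h) *: (W *m (S *m P)))
    - (s + h) *: (T *m euler h j.+1 x).
Proof.
move=> h0 jh xU s W T S P.
have jh' : s <= 1 by rewrite (le_trans _ jh)// ler_wpM2r// ler_nat.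
have s0 : 0 <= s by rewrite mulr_ge0.
have sE : j.+1%:R * h = s + h by rewrite -natr1 mulrDl mul1r.
pose V := \sum_k x 0 k *: pdmx i (A k) (s *: x).
set B := A i (s *: x).
(* [A_flat] at the point [s *: x], contracted with [x]: it trades the derivative of the slope in
   direction [i] for a radial derivative of [A i]. *)
have flat : V + S *m B = W + B *m S.
  rewrite /S /euler_slope -/s mulmx_suml mulmx_sumr -!big_split/=.
  apply: eq_bigr => k _; rewrite -scalemxAl -scalemxAr -!scalerDr.
  by rewrite A_flat//; exact: dilation_ball.
have dP : is_dmx i x (euler h j) (pdmx i (euler h j) x).
  by apply: pdmxP => a b; apply: (Ck_derivable (euler_smooth a b 1 h0 jh')).
have dS := euler_slope_derivative i h0 jh' xU.
have dP' := is_dmx_add dP (is_dmx_scale_cst h (is_dmx_mul dS dP)).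
rewrite {1}/euler_defect (is_dmx_pdmx dP') sE -/s -/V -/S -/P -/B.
set D := pdmx i (euler h j) x.
have DE : D = euler_defect h j i x + s *: (B *m P) by rewrite /euler_defect subrK.
set E := euler_defect h j i x in DE *.
have -> : A i ((s + h) *: x) = B + h *: W + T by rewrite /T -/B [RHS]addrC -[_ - B - _]addrA -opprD subrK.
rewrite [euler h j.+1 x]/= -/S -/P {}DE; move: E T => E T.
have key : s *: (V *m P) + s *: (S *m (B *m P)) = s *: (W *m P) + s *: (B *m (S *m P)).
  by rewrite -!scalerDr !mulmxA -!mulmxDl flat.
rewrite !(mulmxDl, mulmxDr) -!scalemxAl -!scalemxAr.
move: (B *m P) (S *m (B *m P)) (V *m P) (W *m P) (B *m (S *m P)) (W *m (S *m P))
  (T *m P) (T *m (S *m P)) (S *m E) key => X8 X1 X2 X3 X4 X5 X6 X7 X9 key.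
apply/matrixP => a b; have K := congr1 (fun M : 'cV[R]_N => h * M a b) key.
rewrite !mxE in K *; lra.
Qed.

(** Discrete Gronwall factor: it stays bounded as the step tends to 0 because [j] steps of length
    [h] cover at most the unit interval. *)
Lemma euler_factor_le (c h : R) j : 0 <= c -> 0 <= h -> j%:R * h <= 1 ->
  (1 + h * c) ^+ j <= expR c.
Proof.
move=> c0 h0 jh.
have hc : 0 <= h * c by rewrite mulr_ge0.
apply: (@le_trans _ _ (expR (h * c) ^+ j)).
  by rewrite lerXn2r ?nnegrE ?expR_ge0 ?addr_ge0// expR_ge1Dx.
rewrite -expRM_natl ler_expR mulrA -[leRHS]mul1r ler_wpM2r//.
Qed.

Lemma flat_system_solution : exists2 rho : R, 0 < rho /\ rho <= r0 &
  exists Y : 'rV[R]_n -> 'cV[R]_N, [/\ Y 0 = Y0,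
    forall a b, smooth (ball 0 rho) (fun y => Y y a b) &
    forall i y, ball 0 rho y -> pdmx i Y y = A i y *m Y y].
Proof.
(* A closed ball inside the open domain, so that compactness gives bounds; radius at most 1 also
   bounds every coordinate by 1. *)
pose r := Num.min (r0 / 2) 1.
have r_gt0 : 0 < r by rewrite lt_min ltr01 divr_gt0.
have r1 : r <= 1 by rewrite ge_min lexx orbT.
have rr0 : r < r0.
  by rewrite gt_min; apply/orP; left; rewrite ltr_pdivrMr// ltr_pMr// ltr1n.
have r_ge0 := ltW r_gt0.
have rU x : `|x| <= r -> ball 0 r0 x by rewrite ball0E => /le_lt_trans; apply.
have pdS k i a b : smooth (ball 0 r0) (fun z => pdmx k (A i) z a b).
  move=> m; rewrite (_ : (fun y => _) = fun y => 'D_(e_ k) (fun z => A i z a b) y).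
    exact: (Ck_pd k (A_smooth i a b m.+1)).
  by apply/funext => y; rewrite mxE.
have pdSS l k i a b : smooth (ball 0 r0) (fun z => pdmx l (pdmx k (A i)) z a b).
  move=> m; rewrite (_ : (fun y => _) = fun y => 'D_(e_ l) (fun z => pdmx k (A i) z a b) y).
    exact: (Ck_pd l (pdS k i a b m.+1)).
  by apply/funext => y; rewrite mxE.
have [|//|//|K1 K10 HK1] := @bounded_mx_family R n _ N N (ball 0 r0) A r.
  by move=> i a b; exact: A_smooth.
have [|//|//|K2 K20 HK2] := @bounded_mx_family R n ('I_n * 'I_n)%type N N (ball 0 r0)
    (fun t => pdmx t.1 (A t.2)) r.
  by move=> t a b; exact: pdS.
have [|//|//|K3 K30 HK3] := @bounded_mx_family R n ('I_n * 'I_n * 'I_n)%type N N (ball 0 r0)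
    (fun t => pdmx t.1.1 (pdmx t.1.2 (A t.2))) r.
  by move=> t a b; exact: pdSS.
pose K := K1 + K2 + K3.
have K0 : 0 <= K by rewrite !addr_ge0.
have AK i x : `|x| <= r -> `|A i x| <= K.
  by move=> xr; rewrite (le_trans (HK1 i x xr))// /K -addrA lerDl addr_ge0.
have dAK k i x : `|x| <= r -> `|pdmx k (A i) x| <= K.
  move=> xr; rewrite (le_trans (HK2 (k, i) x xr))// /K addrAC lerDr addr_ge0//.
have ddAK l k i x : `|x| <= r -> `|pdmx l (pdmx k (A i)) x| <= K.
  by move=> xr; rewrite (le_trans (HK3 (l, k, i) x xr))// /K lerDr addr_ge0.
pose kap := n%:R * K; pose c := N%:R * kap.
have kap0 : 0 <= kap by rewrite mulr_ge0.
have c0 : 0 <= c by rewrite mulr_ge0.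
pose Q := expR c * `|Y0|.
have Q0 : 0 <= Q by rewrite mulr_ge0 ?expR_ge0.
have sxr (s : R) x : 0 <= s -> s <= 1 -> `|x| <= r -> `|s *: x| <= r.
  by move=> s0 s1 xr; rewrite normrZ ger0_norm// (le_trans _ xr)// ler_piMl.
have comb (F : 'I_n -> 'M[R]_N) x : `|x| <= r -> (forall k, `|F k| <= K) ->
    `|\sum_k x 0 k *: F k| <= kap.
  move=> xr FK; rewrite (le_trans (ler_norm_sum _ _ _))//.
  apply: (@le_trans _ _ (\sum_(k < n) K)).
    apply: ler_sum => k _; rewrite normrZ -[leRHS]mul1r ler_pM//.
    by rewrite (le_trans (coord_le_norm _ _))// (le_trans xr).
  by rewrite sumr_const card_ord /kap mulr_natl.
have SK h j x : 0 <= h -> j%:R * h <= 1 -> `|x| <= r -> `|euler_slope h j x| <= kap.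
  by move=> h0 jh xr; apply: comb => // k; apply: AK; apply: sxr; rewrite ?mulr_ge0.
have jhS (h : R) j : 0 <= h -> j.+1%:R * h <= 1 -> j%:R * h <= 1.
  by move=> h0 jh; rewrite (le_trans _ jh)// ler_wpM2r// ler_nat.
have PK h j x : 0 <= h -> j%:R * h <= 1 -> `|x| <= r ->
    `|euler h j x| <= (1 + h * c) ^+ j * `|Y0|.
  move=> h0 + xr; elim: j => [|j IH] jh /=; first by rewrite expr0 mul1r.
  have jh' := jhS _ _ h0 jh.
  rewrite (le_trans (ler_normD _ _))// exprS -mulrA mulrDl mul1r lerD ?IH//.
  rewrite normrZ (ger0_norm h0) -mulrA ler_wpM2l// /c -mulrA.
  by apply: norm_mulmx_bound; [exact: SK|exact: IH].
have PQ h j x : 0 <= h -> j%:R * h <= 1 -> `|x| <= r -> `|euler h j x| <= Q.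
  move=> h0 jh xr; rewrite (le_trans (PK _ _ _ h0 jh xr))// ler_wpM2r//.
  exact: euler_factor_le.
(* Collects what [euler_defectS] adds per step, divided by [h ^+ 2]: the three explicit products and
   the Taylor remainder [T]. *)
pose B := N%:R * (K * (N%:R * (kap * Q))) + N%:R * (kap * Q)
  + N%:R * (kap * (N%:R * (kap * Q))) + N%:R * (n%:R * kap * Q).
have B0 : 0 <= B by rewrite !addr_ge0 ?mulr_ge0.
(* Discrete Gronwall: each step multiplies the defect by at most [1 + h * c] and adds at most
   [h ^+ 2 * B]. As [j%:R * h <= 1], the total is O([h]). *)
have EK h i j x : 0 <= h -> j%:R * h <= 1 -> `|x| <= r ->
    `|euler_defect h j i x| <= (1 + h * c) ^+ j * (j%:R * (h ^+ 2 * B)).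
  move=> h0 + xr; elim: j => [|j IH] jh.
    by rewrite euler_defect0 normr0 mul0r mulr0.
  have jh' := jhS _ _ h0 jh.
  have {}IH := IH jh'.
  have s0 : 0 <= j%:R * h by rewrite mulr_ge0.
  have h20 : 0 <= h ^+ 2 by rewrite exprn_ge0.
  have sh1 : j%:R * h + h <= 1 by move: jh; rewrite -natr1 mulrDl mul1r.
  have TK := @taylor_mx R n N N (ball 0 r0) (A i) r K _ _ x (@open_ball0 _ _ r0)
     (fun a b => A_smooth i a b 2) rU K0 (fun k l z => ddAK l k i z) xr r1 s0 h0 sh1.
  have := euler_defectS i h0 jh (rU _ xr) => /=.
  set s := j%:R * h in TK s0 sh1 *.
  set W := \sum_k _ in TK *; set T := _ - _ - _ in TK *.
  set S := euler_slope h j x; set P := euler h j x => ->.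
  have WK : `|W| <= kap by apply: comb => // k; apply: dAK; apply: sxr.
  have SP : `|S *m P| <= N%:R * (kap * Q).
    by apply: norm_mulmx_bound; [exact: SK|exact: PQ].
  have ASP : `|A i (s *: x) *m (S *m P)| <= N%:R * (K * (N%:R * (kap * Q))).
    by apply: norm_mulmx_bound => //; apply: AK; exact: sxr.
  have WP : `|W *m P| <= N%:R * (kap * Q).
    by apply: norm_mulmx_bound => //; exact: PQ.
  have WSP : `|W *m (S *m P)| <= N%:R * (kap * (N%:R * (kap * Q))).
    exact: norm_mulmx_bound.
  have TP : `|T *m euler h j.+1 x| <= N%:R * (h ^+ 2 * (n%:R * kap) * Q).
    by apply: norm_mulmx_bound => //; exact: PQ.
  have SE : `|S *m euler_defect h j i x|
      <= c * ((1 + h * c) ^+ j * (j%:R * (h ^+ 2 * B))).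
    by rewrite /c -mulrA; apply: norm_mulmx_bound => //; exact: SK.
  have sh0 : 0 <= s + h by rewrite addr_ge0.
  set E := euler_defect h j i x in IH SE *.
  have R1 : `|A i (s *: x) *m (S *m P) + W *m P + (s + h) *: (W *m (S *m P))| <=
     N%:R * (K * (N%:R * (kap * Q))) + N%:R * (kap * Q) + N%:R * (kap * (N%:R * (kap * Q))).
    rewrite (le_trans (ler_normD _ _))// lerD//.
      by rewrite (le_trans (ler_normD _ _))// lerD.
    by rewrite normrZ (ger0_norm sh0) -[leRHS]mul1r ler_pM.
  have R2 : `|(s + h) *: (T *m euler h j.+1 x)| <= N%:R * (h ^+ 2 * (n%:R * kap) * Q).
    by rewrite normrZ (ger0_norm sh0) -[leRHS]mul1r ler_pM.
  have R3 : `|h ^+ 2 *: (A i (s *: x) *m (S *m P) + W *m P + (s + h) *: (W *m (S *m P)))| <=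
     h ^+ 2 * (N%:R * (K * (N%:R * (kap * Q))) + N%:R * (kap * Q)
       + N%:R * (kap * (N%:R * (kap * Q)))).
    by rewrite normrZ (ger0_norm h20) ler_wpM2l.
  have R4 : `|E + h *: (S *m E)| <=
      (1 + h * c) * ((1 + h * c) ^+ j * (j%:R * (h ^+ 2 * B))).
    rewrite (le_trans (ler_normD _ _))// mulrDl mul1r lerD//.
    by rewrite normrZ (ger0_norm h0) -mulrA ler_wpM2l.
  rewrite (le_trans (ler_normB _ _))//.
  rewrite (le_trans (lerD (le_trans (ler_normB _ _) (lerD R4 R3)) R2))//.
  have F1 : 1 <= (1 + h * c) ^+ j.+1 by rewrite exprn_ege1// lerDl mulr_ge0.
  have : h ^+ 2 * B <= (1 + h * c) ^+ j.+1 * (h ^+ 2 * B) by rewrite ler_peMl// mulr_ge0.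
  have HB : h ^+ 2 * (N%:R * (K * (N%:R * (kap * Q))) + N%:R * (kap * Q)
       + N%:R * (kap * (N%:R * (kap * Q)))) + N%:R * (h ^+ 2 * (n%:R * kap) * Q) = h ^+ 2 * B.
    by rewrite /B; ring.
  rewrite -addrA HB (exprS _ j) -natr1 => F2.
  apply: (le_trans (lerD (lexx _) F2)); rewrite le_eqVlt; apply/orP; left; apply/eqP.
  by ring.
have hN m : 0 <= (m.+1%:R)^-1 :> R by rewrite invr_ge0.
have mh m : m.+1%:R * (m.+1%:R)^-1 = 1 :> R by rewrite mulfV.
have D0 : 0 <= expR c * B by rewrite mulr_ge0 ?expR_ge0.
(* Step [1 / m.+1] taken [m.+1] times: the scheme arrives at [x] with a defect of order
   [1 / m.+1]. *)
have [||||rho [rho0 rhor] [Y HY]] := @approximate_solutions_limit R n N A r0 r Y0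
   (fun m => euler (m.+1%:R)^-1 m.+1) Q (expR c * B) r_gt0 rr0 Q0 D0 A_smooth.
- by move=> m a b; apply: euler_smooth; rewrite ?mh.
- by move=> m; exact: euler_at0.
- by move=> m x; apply: PQ; rewrite ?mh.
- move=> m i x xr.
  have := EK (m.+1%:R)^-1 i m.+1 x (hN m).
  rewrite /euler_defect mh !scale1r => /(_ (lexx _) xr) /le_trans; apply.
  have -> : m.+1%:R * ((m.+1%:R)^-1 ^+ 2 * B) = B / m.+1%:R :> R.
    by rewrite expr2 !mulrA mh mul1r mulrC.
  rewrite mulrA ler_wpM2r// ler_wpM2r//.
  by apply: euler_factor_le => //; rewrite mh.
- by exists rho; [split=> //; rewrite (le_trans rhor)// ltW|exists Y].
Qed.

End Euler.

(** * Inverse function theorem *)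

Section SmoothMatrix.
Variables (R : realType) (n : nat).

Lemma Ck_det k (U : set 'rV[R]_n) m (F : 'rV[R]_n -> 'M[R]_m) : open U ->
  (forall a b, Ck k U (fun y => F y a b)) -> Ck k U (fun y => \det (F y)).
Proof.
move=> oU CF; rewrite /determinant; apply: Ck_sum => // s _.
by apply: Ck_mul => //; [exact: Ck_cst|exact: Ck_prod].
Qed.

(** Cramer's rule writes the entries of the inverse as quotients of polynomials in the entries of
    [F]. *)
Lemma Ck_invmx k (U : set 'rV[R]_n) m (F : 'rV[R]_n -> 'M[R]_m) a b : open U ->
  (forall y, U y -> F y \in unitmx) ->
  (forall a b, Ck k U (fun y => F y a b)) -> Ck k U (fun y => invmx (F y) a b).
Proof.
move=> oU uF CF.
apply: (@Ck_eq _ _ _ _ (fun y => (\det (F y))^-1 * ((-1) ^+ (b + a) *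
  \det (row' b (col' a (F y)))))) => //.
  by move=> y Uy; rewrite /invmx uF// !mxE.
apply: Ck_mul => //.
  apply: Ck_inv => //; last exact: Ck_det.
  by move=> y Uy; have := uF y Uy; rewrite unitmxE unitfE.
apply: Ck_mul => //; first exact: Ck_cst.
apply: Ck_det => // c d.
rewrite (_ : (fun y => _) = fun y => F y (lift b c) (lift a d)) //.
by apply/funext => y; rewrite !mxE.
Qed.

End SmoothMatrix.

Section InverseFunction.
Variables (R : realType) (n : nat).
Implicit Types (x y z : 'rV[R]_n).
Local Notation e_ i := (delta_mx 0 i : 'rV[R]_n).

Lemma half_contraction_fixed_point (r : R) (f : 'rV[R]_n -> 'rV[R]_n) : 0 <= r ->
  (forall x, `|x| <= r -> `|f x| <= r) ->
  (forall x y, `|x| <= r -> `|y| <= r -> `|f x - f y| <= 2^-1 * `|x - y|) ->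
  exists2 x, `|x| <= r & x = f x.
Proof.
move=> r0 fr fl; pose U := [set x : 'rV[R]_n | `|x| <= r].
have fU : {homo f : x / U x >-> U x} by move=> x; exact: fr.
pose g : {fun U >-> U} := mkfun_fun fU.
have cg : is_contraction g.
  exists (2^-1 : R)%:nng; split => /=; first by rewrite invf_lt1// ltr1n.
  by move=> [x y] /= [Ux Uy]; exact: fl.
have [||x Ux xE] := banach_fixed_point cg; last by exists x.
  rewrite /U (_ : [set x | _] = closed_ball_ (fun v => `|v|) 0 r).
    exact: closed_closed_ball_.
  by apply/seteqP; split => x; rewrite /closed_ball_ /= sub0r normrN.
by exists 0; rewrite /U /= normr0.
Qed.

(** Rows are indexed by the variable because points are row vectors: the differential is
    [v |-> v *m jacmx F x]. *)
Definition jacmx (F : 'rV[R]_n -> 'rV[R]_n) x : 'M[R]_n :=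
  \matrix_(i, j) 'D_(e_ i) (fun y => F y 0 j) x.

Lemma jacmx_smooth (U : set 'rV[R]_n) (F : 'rV[R]_n -> 'rV[R]_n) a b : (forall j, smooth U (fun y => F y 0 j)) ->
  smooth U (fun y => jacmx F y a b).
Proof.
move=> sF k; rewrite (_ : (fun y => _) = fun y => 'D_(e_ a) (fun y => F y 0 b) y).
  exact: (Ck_pd a (sF b k.+1)).
by apply/funext => y; rewrite mxE.
Qed.

Variables (F : 'rV[R]_n -> 'rV[R]_n) (r0 : R).
Hypotheses (r0_gt0 : 0 < r0) (F_smooth : forall j, smooth (ball 0 r0) (fun y => F y 0 j))
  (F0 : F 0 = 0) (dF0 : jacmx F 0 = 1%:M).

Let oU : open (ball (0 : 'rV[R]_n) r0). Proof. exact: open_ball0. Qed.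

(** The differential of [x - F x] vanishes at 0, hence is small near 0. The first clause feeds the
    fixed point theorem, the second the invertibility of the Jacobian. *)
Lemma near_identity_contraction : exists2 d : R, 0 < d /\ d < r0 &
  (forall x y, `|x| <= d -> `|y| <= d -> `|(x - F x) - (y - F y)| <= 2^-1 * `|x - y|) /\
  (forall x, `|x| <= d -> `|1%:M - jacmx F x| <= (2 * n.+1%:R)^-1).
Proof.
pose phi x := x - F x.
have phi_s j : smooth (ball 0 r0) (fun y => phi y 0 j).
  move=> k; apply: (@Ck_eq _ _ _ _ (fun y => y 0 j + (-1) * F y 0 j)) => //.
    by move=> y _; rewrite !mxE mulN1r.
  apply: Ck_add => //; first exact: Ck_coord.
  by apply: Ck_mul => //; [exact: Ck_cst|exact: F_smooth].
have U0 : ball (0 : 'rV[R]_n) r0 0 by rewrite ball0E normr0.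
have dphi i j z : ball 0 r0 z ->
    'D_(e_ i) (fun y => phi y 0 j) z = (1%:M - jacmx F z) i j.
  move=> zU; suff [_ ->] : is_derive z (e_ i) (fun y => phi y 0 j)
      ((1%:M - jacmx F z) i j) by [].
  rewrite !mxE (_ : (fun y => _) = (fun y : 'rV[R]_n => y 0 j) - (fun y => F y 0 j)).
    apply: is_deriveB.
      by apply: is_derive_eq (is_derive_coord j _ _) _; rewrite mxE eqxx eq_sym.
    by apply: derivableP; exact: (Ck_derivable (F_smooth j 1)).
  by apply/funext => y; rewrite !mxE.
have dphi0 i j : 'D_(e_ i) (fun y => phi y 0 j) 0 = 0.
  by rewrite dphi// dF0 subrr mxE.
(* The mean value inequality, and later the product of a vector with a matrix, cost a factor [n];
   this value leaves the constant 1/2. *)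
pose eps : R := (2 * n.+1%:R)^-1.
have eps0 : 0 < eps by rewrite invr_gt0.
have : \forall z \near (0 : 'rV[R]_n), ball 0 r0 z /\
    forall ij : 'I_n * 'I_n, `|'D_(e_ ij.1) (fun y => phi y 0 ij.2) z| <= eps.
  apply: (@filterI _ (nbhs (0 : 'rV[R]_n))); first exact: open_nbhs_nbhs.
  apply: (@filter_forall _ _ _ (nbhs (0 : 'rV[R]_n))) => -[i j] /=.
  have /cvgrPdist_le := Ck_cont (Ck_pd i (phi_s j 1%N)) U0.
  by move=> /(_ eps eps0); rewrite dphi0; apply: (@filterS _ (nbhs (0 : 'rV[R]_n))) => z;
    rewrite sub0r normrN.
move=> /nbhs_ballP[d /= d0 Hd].
have d20 : 0 < Num.min d r0 / 2 by rewrite divr_gt0// lt_min d0.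
have dd : Num.min d r0 / 2 < Num.min d r0.
  by rewrite ltr_pdivrMr// ltr_pMr ?ltr1n// lt_min d0.
exists (Num.min d r0 / 2).
  by split=> //; rewrite (lt_le_trans dd)// ge_min lexx orbT.
have inU z : `|z| <= Num.min d r0 / 2 -> ball 0 r0 z /\
    forall i j, `|'D_(e_ i) (fun y => phi y 0 j) z| <= eps.
  move=> zd; have [|? H] := Hd z.
    by rewrite ball0E (le_lt_trans zd)// (lt_le_trans dd)// ge_min lexx.
  by split=> // i j; exact: (H (i, j)).
split; last first.
  move=> x xd; apply: mx_norm_le; first exact: ltW.
  by move=> i j; rewrite -dphi; [exact: (inU x xd).2|exact: (inU x xd).1].
move=> x y xd yd; rewrite -/(phi x) -/(phi y).
apply: norm_le_coord; first by rewrite mulr_ge0.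
move=> j; rewrite !mxE.
have H (s : R) : 0 <= s <= 1 -> `|s *: (x - y) + y| <= Num.min d r0 / 2.
  by move=> s01; exact: norm_segment.
have /le_trans := mean_value_le (K := eps) oU (phi_s j 1%N)
   (fun s s01 => (inU _ (H s s01)).1) (fun i s s01 => (inU _ (H s s01)).2 i j).
rewrite !mxE; apply; rewrite mulrCA mulrC ler_wpM2r//.
rewrite /eps invfM mulrCA ler_piMr//.
by rewrite ler_pdivrMr// mul1r ler_nat.
Qed.

(** The linearisation is taken at the moving point [x], uniformly in both points; at [x = G y] it
    becomes the quadratic remainder of the inverse map. *)
Lemma second_order_bound (d : R) : 0 <= d -> d < r0 ->
  exists2 C : R, 0 <= C & forall x y, `|x| <= d -> `|y| <= d ->
    `|F y - F x - (y - x) *m jacmx F x| <= C * `|y - x| ^+ 2.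
Proof.
move=> d0 dr0.
have inU x : `|x| <= d -> ball 0 r0 x by rewrite ball0E => /le_lt_trans; apply.
have Cj k a b : smooth (ball 0 r0) (fun z => pdmx k (jacmx F) z a b).
  move=> m; rewrite (_ : (fun y => _) = fun y => 'D_(e_ k) (fun z => jacmx F z a b) y).
    exact: (Ck_pd k (jacmx_smooth a b F_smooth m.+1)).
  by apply/funext => y; rewrite mxE.
have [|//|//|K K0 HK] := @bounded_mx_family R n 'I_n n n (ball 0 r0) (fun k => pdmx k (jacmx F)) d.
  by move=> k a b; exact: Cj.
exists (n%:R * (n%:R * K)); first by rewrite !mulr_ge0.
move=> x y xd yd; apply: norm_le_coord; first by rewrite !mulr_ge0// exprn_ge0.
move=> j; rewrite !mxE.
have [c c01 E] := mean_value oU (F_smooth j 1%N) (fun s s01 => inU _ (norm_segment xd yd s01)).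
rewrite E -sumrB (le_trans (ler_norm_sum _ _ _))//.
apply: (@le_trans _ _ (\sum_(i < n) `|y - x| * (n%:R * (`|y - x| * K)))); last first.
  rewrite sumr_const card_ord -[_ *+ n]mulr_natl le_eqVlt; apply/orP; left; apply/eqP.
  by ring.
apply: ler_sum => i _; rewrite [jacmx F x i j]mxE -mulrBr normrM ler_pM ?coord_le_norm//.
set z := c *: (y - x) + x.
have zd : `|z| <= d by exact: norm_segment.
have := mean_value_mx oU (fun a b => jacmx_smooth a b F_smooth 1%N) inU K0 HK xd zd.
have := mx_entry_le (jacmx F z - jacmx F x) i j; rewrite !mxE => /le_trans H /H /le_trans.
apply; rewrite ler_wpM2l// ler_wpM2r// /z addrK normrZ ler_piMl//.
by have /andP[c0 c1] := c01; rewrite ger0_norm.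
Qed.

(* [x |-> x - F x + y] is a contraction of a small ball; the inverse is smooth since
   its Jacobian is [invmx (jacmx F (G y))]. *)
Theorem inverse_function : exists G : 'rV[R]_n -> 'rV[R]_n, exists2 r : R, 0 < r &
  exists2 d : R, d <= r0 &
  [/\ forall y, ball 0 r y -> ball 0 d (G y) /\ F (G y) = y,
      forall x, ball 0 d x -> ball 0 r (F x) -> G (F x) = x,
      forall x, ball 0 d x -> jacmx F x \in unitmx,
      forall j, smooth (ball 0 r) (fun y => G y 0 j) &
      G 0 = 0].
Proof.
have [d [d0 dr0] [Hd HJ]] := near_identity_contraction.
pose r := d / 2.
have r_gt0 : 0 < r by rewrite divr_gt0.
have /choice [G HG] y : exists x, `|y| <= r -> `|x| <= d /\ F x = y.
  have [yr|] := boolP (`|y| <= r); last by exists 0.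
  have [|||x xd xE] := @half_contraction_fixed_point d (fun x => x - F x + y).
  - exact: ltW.
  - move=> x xd; have := Hd x 0 xd; rewrite normr0 F0 !subr0 => /(_ (ltW d0)) H.
    rewrite (le_trans (ler_normD _ _))// (splitr d) lerD//.
    by rewrite (le_trans H)// mulrC ler_wpM2r// invr_ge0.
  - by move=> x z xd zd; rewrite opprD addrACA subrr addr0; exact: Hd.
  exists x => _; split=> //.
  apply/rowP => j; move/rowP/(_ j): xE; rewrite !mxE; lra.
(* The triangle inequality and the contraction bound show that [F] shrinks distances by at most a
   factor 2; this yields both the uniqueness of preimages and the Lipschitz bound for [G]. *)
have lip x z : `|x| <= d -> `|z| <= d -> `|x - z| <= 2 * `|F x - F z|.
  move=> xd zd; have := Hd x z xd zd.
  have : `|x - z| <= `|x - F x - (z - F z)| + `|F x - F z|.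
    rewrite (le_trans _ (ler_normD _ _))// le_eqVlt; apply/orP; left; apply/eqP.
    by congr (`|_|); apply/rowP => j; rewrite !mxE; ring.
  by move: `|x - z| `|x - F x - (z - F z)| `|F x - F z| => a b c; lra.
exists G, r => //; exists d; first exact: ltW.
have rd : r < d by rewrite /r ltr_pdivrMr// ltr_pMr// ltr1n.
have G1 y : ball 0 r y -> ball 0 d (G y) /\ F (G y) = y.
  rewrite ball0E => yr; have [Gd FG] := HG y (ltW yr); split=> //.
  have := lip (G y) 0 Gd; rewrite normr0 FG F0 !subr0 => /(_ (ltW d0)) H.
  rewrite ball0E (le_lt_trans H)// mulrC -ltr_pdivlMr//.
have G2 x : ball 0 d x -> ball 0 r (F x) -> G (F x) = x.
  rewrite ball0E => xd Fr; have [Gd FG] := G1 _ Fr.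
  apply/eqP; rewrite -subr_eq0 -normr_le0 (le_trans (lip _ _ _ _))//.
  - by rewrite ltW// -ball0E.
  - exact: ltW.
  - by rewrite FG subrr normr0 mulr0.
have inU x : `|x| <= d -> ball 0 r0 x by rewrite ball0E => /le_lt_trans; apply.
have [C C0 HC] := second_order_bound (ltW d0) dr0.
(* A row vector killed by the Jacobian equals its product with [1%:M - jacmx F x], whose norm is at
   most half of its own. *)
have uJ x : ball 0 d x -> jacmx F x \in unitmx.
  rewrite ball0E => xd; rewrite -row_free_unit; apply: inj_row_free => v vJ.
  apply/eqP; rewrite -normr_le0.
  have vE : v = v *m (1%:M - jacmx F x) by rewrite mulmxBr mulmx1 vJ subr0.
  have := norm_mulmx_bound (lexx `|v|) (HJ x (ltW xd)); rewrite -vE invfM.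
  have : n%:R * n.+1%:R^-1 <= 1 :> R by rewrite ler_pdivrMr// mul1r ler_nat.
  have := normr_ge0 v; move: (n%:R : R) (n.+1%:R^-1 : R) `|v| => a b c c0 ab H.
  have : c * (a * b) <= c * 1 by rewrite ler_wpM2l.
  have -> : c * (a * b) = 2 * (a * (c * (2^-1 * b))) by field.
  lra.
have Glip y z : ball 0 r y -> ball 0 r z -> `|G y - G z| <= 2 * `|y - z|.
  move=> yr zr; have [yd yE] := G1 _ yr; have [zd zE] := G1 _ zr.
  move: yd zd; rewrite !ball0E => /ltW yd /ltW zd.
  by have := lip _ _ yd zd; rewrite yE zE.
have dG i j y : ball 0 r y ->
    is_derive y (e_ i) (fun y => G y 0 j) (invmx (jacmx F (G y)) i j).
  move=> yr; have [Gd FG] := G1 _ yr.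
  have Jn := uJ _ Gd; set J := jacmx F (G y) in Jn *.
  apply: (@is_derive_quadratic _ _ _ _ _ _ (n%:R * (4 * C * `|invmx J|)) (r - `|y|)).
    by rewrite subr_gt0 -ball0E.
  move=> s sr.
  have y'r : ball 0 r (s *: e_ i + y).
    rewrite ball0E (le_lt_trans (ler_normD _ _))// -ltrBrDr.
    by rewrite (le_lt_trans (norm_delta _ _)).
  have [G'd FG'] := G1 _ y'r; set y' := s *: e_ i + y in y'r G'd FG' *.
  move: (Gd) (G'd); rewrite !ball0E => /ltW Gd1 /ltW G'd1.
  have := HC _ _ Gd1 G'd1; rewrite FG FG' -/J.
  have := Glip _ _ y'r yr; rewrite {1 2}/y' addrK => k1 k2.
  have k3 : `|G y' - G y| <= 2 * `|s|.
    by rewrite (le_trans k1)// ler_wpM2l// norm_delta.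
  have k4 : `|s *: e_ i - (G y' - G y) *m J| <= 4 * C * s ^+ 2.
    rewrite (le_trans k2)//; apply: (@le_trans _ _ (C * (2 * `|s|) ^+ 2)).
      by rewrite ler_wpM2l// lerXn2r ?nnegrE ?mulr_ge0.
    by rewrite exprMn real_normK ?num_real// le_eqVlt; apply/orP; left; apply/eqP; ring.
  have -> : G y' 0 j - G y 0 j - s * invmx J i j =
      (- ((s *: e_ i - (G y' - G y) *m J) *m invmx J)) 0 j.
    by rewrite mulmxBl mulmxK// -scalemxAl -rowE !mxE opprB.
  rewrite (le_trans (coord_le_norm _ _))// normrN.
  rewrite (le_trans (norm_mulmx_bound k4 (lexx _)))// le_eqVlt.
  by apply/orP; left; apply/eqP; ring.
have G0 : G 0 = 0.
  have := G2 0; rewrite F0; apply; first by rewrite ball0E normr0.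
  by rewrite ball0E normr0.
split=> // j k; elim: k j => [|k IH] j.
  split=> // y yr.
  apply: (@locally_lipschitz_continuous _ _ _ _ y 2 (r - `|y|)).
    by rewrite subr_gt0 -ball0E.
  move=> z zy; have zr : ball 0 r z.
    by rewrite ball0E -[z](subrK y) (le_lt_trans (ler_normD _ _))// -ltrBrDr.
  have := coord_le_norm (G z - G y) j; rewrite !mxE => /le_trans; apply.
  exact: Glip.
split=> [y yr|i]; first exact: (Ck_cont (IH j) yr).
split=> [y yr|]; first by have [] := dG i j y yr.
apply: (@Ck_eq _ _ _ _ ((fun x => invmx (jacmx F x) i j) \o G)).
- exact: open_ball0.
- by move=> y yr; have [_ ->] := dG i j y yr.
apply: (@Ck_comp R n n k (ball 0 d) (ball 0 r)) => //; first exact: open_ball0.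
- exact: open_ball0.
- by move=> y yr; have [] := G1 y yr.
- apply: Ck_invmx => //; first exact: open_ball0.
  move=> a b; apply: Ck_sub (jacmx_smooth a b F_smooth k).
  by move=> x; rewrite ball0E => /ltW; exact: inU.
Qed.

End InverseFunction.

(** * Projective flatness in coordinates *)

Section Bianchi.
Variables (R : realType) (n : nat).
Implicit Types (x y z : 'rV[R]_n).
Local Notation e_ i := (delta_mx 0 i : 'rV[R]_n).

Variables (U : set 'rV[R]_n) (g : 'I_n -> 'I_n -> 'I_n -> 'rV[R]_n -> R)
  (rho : 'I_n -> 'I_n -> 'rV[R]_n -> R).
Hypotheses (n_gt2 : (2 < n)%N) (oU : open U)
  (g_smooth : forall l i j, smooth U (g l i j))
  (g_sym : forall l i j y, U y -> g l i j y = g l j i y).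

Definition curvature l i j k y : R := 'D_(e_ i) (g l j k) y - 'D_(e_ j) (g l i k) y
  + \sum_m (g l i m y * g m j k y - g l j m y * g m i k y).

Hypotheses
  (g_curv : forall l i j k y, U y ->
     curvature l i j k y = rho j k y * (l == i)%:R - rho i k y * (l == j)%:R)
  (g_trace : forall i j y, U y ->
     'D_(e_ i) (fun z => \sum_k g k j k z) y = 'D_(e_ j) (fun z => \sum_k g k i k z) y).

Lemma exists_other (i j : 'I_n) : exists k : 'I_n, (k != i) && (k != j).
Proof.
have : (0 < #|~: [set i; j]|)%N.
  rewrite cardsCs finset.setCK card_ord subn_gt0; apply: leq_ltn_trans n_gt2.
  by rewrite cards2; case: (_ != _).
by case/card_gt0P => k; rewrite !inE negb_or => H; exists k.
Qed.

Lemma curvature_smooth l i j k : smooth U (curvature l i j k).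
Proof.
move=> m; apply: (@Ck_eq _ _ _ _ (fun y => 'D_(e_ i) (g l j k) y +
  (-1) * 'D_(e_ j) (g l i k) y
  + \sum_m (g l i m y * g m j k y + (-1) * (g l j m y * g m i k y)))) => //.
  move=> y Uy; rewrite /curvature mulN1r; congr (_ + _).
  by apply: eq_bigr => ? _; rewrite mulN1r.
apply: Ck_add => //; first apply: Ck_add => //.
- exact: (Ck_pd i (g_smooth l j k m.+1)).
- by apply: Ck_mul => //; [exact: Ck_cst|exact: (Ck_pd j (g_smooth l i k m.+1))].
- apply: Ck_sum => // a _; apply: Ck_add => //.
    by apply: Ck_mul => //; exact: g_smooth.
  by apply: Ck_mul => //; [exact: Ck_cst|apply: Ck_mul => //; exact: g_smooth].
Qed.

(** [rho] enters only as a coefficient in [g_curv]; with [l = i] and [i != j] that identity exhibits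
    it as a component of the smooth curvature. *)
Lemma schouten_smooth j k : smooth U (rho j k).
Proof.
move=> m; have [i /andP[ij _]] := exists_other j j.
apply: (@Ck_eq _ _ _ _ (curvature i i j k)) => //; last exact: curvature_smooth.
by move=> y Uy; rewrite g_curv// eqxx (negbTE ij) mulr1 mulr0 subr0.
Qed.

(** Take the trace of the curvature endomorphism in [g_curv]. On the left it is the exterior
    derivative of the trace of the connection, which is 0 by [g_trace]; on the right it is the skew
    part of [rho]. *)
Lemma schouten_sym i j y : U y -> rho i j y = rho j i y.
Proof.
move=> Uy.
have dg l a b c : derivable (g l a b) y (e_ c) by exact: (Ck_derivable (g_smooth l a b 1)).
have tr a b : 'D_(e_ a) (fun z => \sum_k g k b k z) y = \sum_k 'D_(e_ a) (g k b k) y.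
  have := @is_derive_sumE R _ _ (index_enum 'I_n) xpredT (fun k => g k b k)
     (fun k => 'D_(e_ a) (g k b k) y) y (e_ a).
  by move=> /(_ (fun k _ => derivableP (dg k b k a))) [_ ->].
have E : \sum_l curvature l i j l y = 0.
  rewrite /curvature big_split/= sumrB -!tr g_trace// subrr add0r.
  under eq_bigr do rewrite sumrB.
  rewrite sumrB [X in _ - X]exchange_big/=; apply/eqP; rewrite subr_eq0; apply/eqP.
  by apply: eq_bigr => l _; apply: eq_bigr => m _; rewrite mulrC.
move: E; under eq_bigr do rewrite g_curv//.
rewrite sumrB (bigD1 i)//= eqxx mulr1 big1 ?addr0; last first.
  by move=> l li; rewrite (negbTE li) mulr0.
rewrite (bigD1 j)//= eqxx mulr1 big1 ?addr0; last first.
  by move=> l li; rewrite (negbTE li) mulr0.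
by move/eqP; rewrite subr_eq0 => /eqP.
Qed.

Definition conn_mx (a : 'I_n) y : 'M[R]_n := \matrix_(l, j) g l a j y.

Definition curv_mx (a b : 'I_n) y : 'M[R]_n :=
  pdmx a (conn_mx b) y - pdmx b (conn_mx a) y
  + (conn_mx a y *m conn_mx b y - conn_mx b y *m conn_mx a y).

Lemma conn_mx_smooth a i j : smooth U (fun y => conn_mx a y i j).
Proof.
move=> k; rewrite (_ : (fun y => _) = g i a j); first exact: g_smooth.
by apply/funext => y; rewrite mxE.
Qed.

Lemma curv_mxE a b y : curv_mx a b y = \matrix_(l, k) curvature l a b k y.
Proof.
apply/matrixP => l k; rewrite !mxE /curvature -sumrB.
congr (_ - _ + _).
- by congr ('D_ _ _ _); apply/funext => z; rewrite mxE.
- by congr ('D_ _ _ _); apply/funext => z; rewrite mxE.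
- by apply: eq_bigr => m _; rewrite !mxE.
Qed.

Lemma pdmx_smooth m p i (F : 'rV[R]_n -> 'M[R]_(m, p)) a b :
  (forall a b, smooth U (fun y => F y a b)) -> smooth U (fun y => pdmx i F y a b).
Proof.
move=> sF k; rewrite (_ : (fun y => _) = fun y => 'D_(e_ i) (fun z => F z a b) y).
  exact: (Ck_pd i (sF a b k.+1)).
by apply/funext => y; rewrite mxE.
Qed.

Lemma pdmx_schwarz m p i j (F : 'rV[R]_n -> 'M[R]_(m, p)) y :
  (forall a b, smooth U (fun y => F y a b)) -> U y ->
  pdmx i (pdmx j F) y = pdmx j (pdmx i F) y.
Proof.
move=> sF Uy; apply/matrixP => a b; rewrite [LHS]mxE [RHS]mxE.
transitivity ('D_(e_ i) ('D_(e_ j) (fun z => F z a b)) y).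
  by congr ('D_ _ _ _); apply/funext => z; rewrite mxE.
rewrite (schwarz i j oU (sF a b 2%N) Uy).
by congr ('D_ _ _ _); apply/funext => z; rewrite mxE.
Qed.

(** With the curvature written as the matrix-valued form d Gamma + Gamma Gamma, the second
    derivatives cancel by Schwarz, and the remaining products cancel by associativity alone. *)
Lemma bianchi a b c y : U y ->
  (pdmx a (curv_mx b c) y + conn_mx a y *m curv_mx b c y - curv_mx b c y *m conn_mx a y)
  + (pdmx b (curv_mx c a) y + conn_mx b y *m curv_mx c a y - curv_mx c a y *m conn_mx b y)
  + (pdmx c (curv_mx a b) y + conn_mx c y *m curv_mx a b y - curv_mx a b y *m conn_mx c y)
  = 0.
Proof.
move=> Uy.
have d1 i j : is_dmx i y (conn_mx j) (pdmx i (conn_mx j) y).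
  by apply: pdmxP => k l; apply: (Ck_derivable (conn_mx_smooth j k l 1)).
have d2 i j k : is_dmx i y (pdmx j (conn_mx k)) (pdmx i (pdmx j (conn_mx k)) y).
  apply: pdmxP => l m; apply: (@Ck_derivable _ _ 0 U) => //.
  exact: (pdmx_smooth j l m (conn_mx_smooth k) 1).
have neg m p i (F : 'rV[R]_n -> 'M[R]_(m, p)) F' : is_dmx i y F F' ->
    is_dmx i y (fun z => - F z) (- F').
  move=> H; have := is_dmx_scale_cst (-1) H; rewrite scaleN1r.
  by rewrite (_ : (fun z => -1 *: F z) = fun z => - F z)//; apply/funext => z; rewrite scaleN1r.
have dK i j k : pdmx i (curv_mx j k) y = pdmx i (pdmx j (conn_mx k)) y
    - pdmx i (pdmx k (conn_mx j)) y +
    ((pdmx i (conn_mx j) y *m conn_mx k y + conn_mx j y *m pdmx i (conn_mx k) y)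
    - (pdmx i (conn_mx k) y *m conn_mx j y + conn_mx k y *m pdmx i (conn_mx j) y)).
  apply: is_dmx_pdmx; apply: is_dmx_add.
    by apply: is_dmx_add => //; exact: neg.
  by apply: is_dmx_add; [|apply: neg]; exact: is_dmx_mul.
rewrite !dK (pdmx_schwarz b a (conn_mx_smooth c) Uy)
  (pdmx_schwarz c b (conn_mx_smooth a) Uy) (pdmx_schwarz c a (conn_mx_smooth b) Uy).
rewrite /curv_mx.
move: (pdmx a (pdmx b (conn_mx c)) y) (pdmx a (pdmx c (conn_mx b)) y)
  (pdmx b (pdmx c (conn_mx a)) y) => T1 T2 T3.
move: (pdmx a (conn_mx b) y) (pdmx a (conn_mx c) y) (pdmx b (conn_mx a) y)
  (pdmx b (conn_mx c) y) (pdmx c (conn_mx a) y) (pdmx c (conn_mx b) y)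
  (conn_mx a y) (conn_mx b y) (conn_mx c y) => D1 D2 D3 D4 D5 D6 A B C.
rewrite !(mulmxDl, mulmxDr, mulNmx, mulmxN, mulmxA).
have addE (X Y : 'M[R]_n) i j : (X + Y) i j = X i j + Y i j by rewrite mxE.
have oppE (X : 'M[R]_n) i j : (- X) i j = - X i j by rewrite mxE.
apply/matrixP => i j; rewrite !(addE, oppE) [RHS]mxE.
ring.
Qed.

(* Taking the index [b] different from [a] and [c] in the Bianchi identity isolates
   this component; this is where [2 < n] is needed. *)
Lemma cotton_zero a c j y : U y ->
  'D_(e_ a) (rho c j) y - \sum_m rho c m y * g m a j y =
  'D_(e_ c) (rho a j) y - \sum_m rho a m y * g m c j y.
Proof.
move=> Uy; have [->//|ac] := eqVneq a c.
have [b /andP[ba bc]] := exists_other a c.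
have dr d i k : derivable (rho i k) y (e_ d) by exact: (Ck_derivable (schouten_smooth i k 1)).
have KE d f z l k : U z -> curv_mx d f z l k =
    rho f k z * (l == d)%:R - rho d k z * (l == f)%:R.
  by move=> Uz; rewrite curv_mxE mxE g_curv.
have dK h d f l k : pdmx h (curv_mx d f) y l k =
    'D_(e_ h) (rho f k) y * (l == d)%:R - 'D_(e_ h) (rho d k) y * (l == f)%:R.
  rewrite mxE.
  have D : is_derive y (e_ h) (fun z => rho f k z * (l == d)%:R - rho d k z * (l == f)%:R)
     ('D_(e_ h) (rho f k) y * (l == d)%:R - 'D_(e_ h) (rho d k) y * (l == f)%:R).
    have Dm s (q : R) t : is_derive y (e_ h) (fun z => rho s t z * q) ('D_(e_ h) (rho s t) y * q).
      apply: is_derive_eq (is_deriveMR (derivableP (dr h s t)) (is_derive_cst q y (e_ h))) _.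
      by rewrite mulr0 addr0.
    exact: is_deriveB (Dm f _ k) (Dm d _ k).
  have [_ <-] := D; apply: near_eq_derive.
  by apply: (near_eq_open oU) => // z Uz; exact: KE.
have GK h d f l k : (conn_mx h y *m curv_mx d f y) l k =
    g l h d y * rho f k y - g l h f y * rho d k y.
  rewrite mxE; under eq_bigr do rewrite KE// mxE mulrBr.
  rewrite sumrB (bigD1 d)//= eqxx big1 ?addr0 ?mulr1; last first.
    by move=> m /negbTE ->; rewrite !mulr0.
  rewrite (bigD1 f)//= eqxx big1 ?addr0 ?mulr1// => m /negbTE ->; by rewrite !mulr0.
have KG h d f l k : (curv_mx d f y *m conn_mx h y) l k =
    (l == d)%:R * (\sum_m rho f m y * g m h k y) - (l == f)%:R * (\sum_m rho d m y * g m h k y).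
  rewrite mxE !mulr_sumr -sumrB; apply: eq_bigr => m _.
  by rewrite KE// mxE; ring.
have := congr1 (fun X : 'M[R]_n => X b j) (bianchi a b c Uy).
have addE (X Y : 'M[R]_n) k l : (X + Y) k l = X k l + Y k l by rewrite mxE.
have oppE (X : 'M[R]_n) k l : (- X) k l = - X k l by rewrite mxE.
rewrite !(addE, oppE) [RHS]mxE !dK !GK !KG eqxx (negbTE ba) (negbTE bc).
rewrite (g_sym b b c)// (g_sym b b a)// (g_sym b c a)//.
move: ('D_(e_ a) (rho c j) y) ('D_(e_ c) (rho a j) y) => X1 X2.
move: ('D_(e_ b) (rho c j) y) ('D_(e_ b) (rho a j) y) ('D_(e_ a) (rho b j) y)
  ('D_(e_ c) (rho b j) y) => X3 X4 X5 X6; rewrite /= !mulr0 !mulr1 !mul0r !mul1r => H; lra.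
Qed.

End Bianchi.

(** * Projective coordinates from the linear system *)

Section Beltrami.
Variables (R : realType) (n : nat).
Implicit Types (x y z : 'rV[R]_n).
Local Notation e_ i := (delta_mx 0 i : 'rV[R]_n).

Variables (r0 : R) (g : 'I_n -> 'I_n -> 'I_n -> 'rV[R]_n -> R)
  (rho : 'I_n -> 'I_n -> 'rV[R]_n -> R).
Let U := ball (0 : 'rV[R]_n) r0.
Hypotheses (n_gt2 : (2 < n)%N) (r0_gt0 : 0 < r0)
  (g_smooth : forall l i j, smooth U (g l i j))
  (g_sym : forall l i j y, U y -> g l i j y = g l j i y)
  (g_curv : forall l i j k y, U y ->
     curvature g l i j k y = rho j k y * (l == i)%:R - rho i k y * (l == j)%:R)
  (g_trace : forall i j y, U y ->
     'D_(e_ i) (fun z => \sum_k g k j k z) y = 'D_(e_ j) (fun z => \sum_k g k i k z) y).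

Let oU : open U. Proof. exact: open_ball0. Qed.

Let rho_smooth j k : smooth U (rho j k).
Proof. exact: (schouten_smooth n_gt2 oU g_smooth g_curv). Qed.

(* Row [ord0] is the equation D_i y = y_i, row [lift ord0 j] is
   D_i y_j = Gamma^k_ij y_k - rho_ij y. *)
Definition tractor_entry (i : 'I_n) (a b : 'I_n.+1) y : R :=
  match unlift ord0 a, unlift ord0 b with
  | None, None => 0
  | None, Some k => (i == k)%:R
  | Some j, None => - rho i j y
  | Some j, Some k => g k i j y
  end.

Definition tractor_mx (i : 'I_n) y : 'M[R]_n.+1 :=
  \matrix_(a, b) tractor_entry i a b y.

Lemma tractor_smooth i a b : smooth U (fun y => tractor_mx i y a b).
Proof.
move=> k; rewrite (_ : (fun y => _) = tractor_entry i a b); last first.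
  by apply/funext => y; rewrite mxE.
rewrite /tractor_entry; case: (unlift ord0 a) => [j|]; case: (unlift ord0 b) => [l|].
- exact: g_smooth.
- apply: (@Ck_eq _ _ _ _ (fun y => (-1) * rho i j y)) => //.
    by move=> y _; rewrite mulN1r.
  by apply: Ck_mul => //; [exact: Ck_cst|exact: rho_smooth].
- exact: Ck_cst.
- exact: Ck_cst.
Qed.

(** The four blocks are four known identities: [g_curv] on the Gamma block, [cotton_zero] below the
    corner, absence of torsion to the right of it, and the symmetry of [rho] in the corner. *)
Lemma tractor_flat i j y : U y ->
  pdmx i (tractor_mx j) y + tractor_mx j y *m tractor_mx i y =
  pdmx j (tractor_mx i) y + tractor_mx i y *m tractor_mx j y.
Proof.
move=> Uy.
have pdE h l a b : pdmx h (tractor_mx l) y a b = 'D_(e_ h) (tractor_entry l a b) y.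
  by rewrite mxE; congr ('D_ _ _ _); apply/funext => z; rewrite mxE.
have dr s t h : derivable (rho s t) y (e_ h) by exact: (Ck_derivable (rho_smooth s t 1)).
have pdN h s t : 'D_(e_ h) (fun z => - rho s t z) y = - 'D_(e_ h) (rho s t) y.
  by rewrite [LHS](deriveN (dr s t h)).
have tE (h : 'I_n) (a b : 'I_n.+1) : tractor_mx h y a b = tractor_entry h a b y by rewrite mxE.
have sE (d : 'I_n) (f : 'I_n -> R) : \sum_(k < n) (d == k)%:R * f k = f d.
  rewrite (bigD1 d)//= eqxx mul1r big1 ?addr0// => k kd.
  by rewrite eq_sym (negbTE kd) mul0r.
apply/matrixP => a b; rewrite [LHS]mxE [RHS]mxE !pdE [(tractor_mx j y *m _) a b]mxE
  [(tractor_mx i y *m _) a b]mxE !big_ord_recl.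
have term h l c : tractor_mx h y a c * tractor_mx l y c b =
    tractor_entry h a c y * tractor_entry l c b y by rewrite !mxE.
rewrite !term; under eq_bigr do rewrite term.
under [in RHS]eq_bigr do rewrite term.
rewrite /tractor_entry !unlift_none.
under eq_bigr do rewrite !liftK.
under [in RHS]eq_bigr do rewrite !liftK.
case: (unliftP ord0 a) => [a'|] _; case: (unliftP ord0 b) => [b'|] _.
- have := g_curv b' i j a' Uy; rewrite /curvature sumrB.
  have E (h l : 'I_n) : \sum_(k < n) g k h a' y * g b' l k y =
     \sum_m g b' l m y * g m h a' y by apply: eq_bigr => m _; rewrite mulrC.
  rewrite !E !(eq_sym b'); lra.
- rewrite !mulr0 !add0r !pdN.
  have := cotton_zero n_gt2 oU g_smooth g_sym g_curv i j a' Uy.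
  have E (h l : 'I_n) : \sum_(k < n) g k h a' y * - rho l k y =
     - \sum_m rho l m y * g m h a' y.
    by rewrite -sumrN; apply: eq_bigr => m _; rewrite mulrN mulrC.
  rewrite !E; lra.
- by rewrite !derive_cst !mul0r !add0r !sE// g_sym.
- rewrite !derive_cst !mul0r !add0r.
  rewrite (sE j (fun k => - rho i k y)) (sE i (fun k => - rho j k y)).
  by rewrite (schouten_sym g_smooth g_curv g_trace i j Uy).
Qed.

(** The reciprocal of the sum of all the reciprocals lies below each of the numbers. *)
Lemma pos_family_min (I : finType) (r : I -> R) (b : R) : 0 < b -> (forall i, 0 < r i) ->
  exists2 s : R, 0 < s & s <= b /\ forall i, s <= r i.
Proof.
move=> b0 rp; pose q := b^-1 + \sum_i (r i)^-1.
have S0 : 0 <= \sum_i (r i)^-1 by apply: sumr_ge0 => i _; rewrite invr_ge0 ltW.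
have q0 : 0 < q by rewrite ltr_pwDl// invr_gt0.
exists q^-1; first by rewrite invr_gt0.
split=> [|i]; rewrite -[leRHS]invrK lef_pV2 ?posrE ?invr_gt0//.
  by rewrite lerDl.
rewrite /q (bigD1 i)//= addrCA lerDl addr_ge0 ?invr_ge0 ?(ltW b0)//.
by apply: sumr_ge0 => j _; rewrite invr_ge0 ltW.
Qed.

(** Numerator and denominator of each coordinate solve the same second-order equation, so the [rho]
    terms cancel in the second derivatives of the quotient; only Gamma and the first derivatives of
    the denominator [u] remain. *)
Theorem beltrami_coordinates : exists2 r : R, 0 < r /\ r <= r0 &
  exists (u : 'rV[R]_n -> R) (F : 'rV[R]_n -> 'rV[R]_n),
  [/\ smooth (ball 0 r) u /\ (forall y, ball 0 r y -> 0 < u y),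
      forall m, smooth (ball 0 r) (fun y => F y 0 m),
      F 0 = 0, jacmx F 0 = 1%:M &
      forall i j m y, ball 0 r y ->
        'D_(e_ i) ('D_(e_ j) (fun z => F z 0 m)) y =
        \sum_k g k i j y * 'D_(e_ k) (fun z => F z 0 m) y
        - ('D_(e_ i) u y * 'D_(e_ j) (fun z => F z 0 m) y
           + 'D_(e_ j) u y * 'D_(e_ i) (fun z => F z 0 m) y) / u y].
Proof.
(* The initial data are the basis vectors. Thus the denominator is 1 with zero gradient at 0, and
   the numerators vanish there with the coordinate gradients, which normalises [F] and its Jacobian
   at 0. *)
have /choice [r1 /all_and2 [r1P /choice [Y HY]]] (a : 'I_n.+1) : exists r : R,
    (0 < r /\ r <= r0) /\ exists Y : 'rV[R]_n -> 'cV[R]_n.+1, [/\ Y 0 = delta_mx a 0,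
    forall c d, smooth (ball 0 r) (fun y => Y y c d) &
    forall i y, ball 0 r y -> pdmx i Y y = tractor_mx i y *m Y y].
  have [r rP [Y HY]] := flat_system_solution (delta_mx a 0) r0_gt0 tractor_smooth tractor_flat.
  by exists r; split=> //; exists Y.
have [r2 r20 [r2r0 r2r]] := pos_family_min r0_gt0 (fun a => (r1P a).1).
pose w a y : R := Y a y ord0 0.
pose dw a (j : 'I_n) y : R := Y a y (lift ord0 j) 0.
have w_smooth r a c : r <= r2 -> smooth (ball 0 r) (fun y => Y a y c 0).
  move=> rr k; have [_ H _] := HY a; apply: Ck_sub (H c 0 k).
  by move=> y; rewrite !ball0E => /lt_le_trans; apply; exact: le_trans (r2r a).
have DY a i c y : ball 0 r2 y -> 'D_(e_ i) (fun y => Y a y c 0) y =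
    \sum_b tractor_entry i c b y * Y a y b 0.
  move=> yr; have [_ _ H] := HY a.
  have yr1 : ball 0 (r1 a) y by move: yr; rewrite !ball0E => /lt_le_trans; apply.
  have := congr1 (fun M : 'cV[R]_n.+1 => M c 0) (H i y yr1); rewrite !mxE => ->.
  by apply: eq_bigr => b _; rewrite mxE.
have Dw a i y : ball 0 r2 y -> 'D_(e_ i) (w a) y = dw a i y.
  move=> yr; rewrite DY// big_ord_recl /tractor_entry !unlift_none mul0r add0r.
  under eq_bigr do rewrite liftK.
  rewrite (bigD1 i)//= eqxx mul1r big1 ?addr0// => k ki.
  by rewrite eq_sym (negbTE ki) mul0r.
have Ddw a i j y : ball 0 r2 y -> 'D_(e_ i) (dw a j) y =
    - rho i j y * w a y + \sum_k g k i j y * dw a k y.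
  move=> yr; rewrite DY// big_ord_recl /tractor_entry !unlift_none liftK.
  by congr (_ + _); apply: eq_bigr => k _; rewrite liftK.
have w0 a : w a 0 = (a == ord0)%:R.
  by rewrite /w; have [-> _ _] := HY a; rewrite mxE eqxx andbT eq_sym.
have dw0 a j : dw a j 0 = (a == lift ord0 j)%:R.
  by rewrite /dw; have [-> _ _] := HY a; rewrite mxE eqxx andbT eq_sym.
have [r [r_gt0 rr2 u_gt0]] : exists r : R, [/\ 0 < r, r <= r2 &
    forall y, ball 0 r y -> 0 < w ord0 y].
  have U0 : ball (0 : 'rV[R]_n) r2 0 by rewrite ball0E normr0.
  have /cvgrPdist_lt /(_ 1 ltr01) := Ck_cont (w_smooth _ ord0 ord0 (lexx _) 0%N) U0.
  rewrite -/(w ord0 0) w0 eqxx => /nbhs_ballP[d /= d0 Hd].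
  exists (Num.min d r2); split; [by rewrite lt_min d0|by rewrite ge_min lexx orbT|].
  move=> y yd; have := Hd y; rewrite -/(w ord0 y).
  have yd' : ball 0 d y.
    by move: yd; rewrite !ball0E => /lt_le_trans; apply; rewrite ge_min lexx.
  by move=> /(_ yd') /=; have := ler_norm (1 - w ord0 y); move: `|_| => q; lra.
have sub y : ball 0 r y -> ball 0 r2 y by rewrite !ball0E => /lt_le_trans; apply.
pose u := w ord0.
pose F y : 'rV[R]_n := \row_m (w (lift ord0 m) y / u y).
have oR : open (ball (0 : 'rV[R]_n) r) by exact: open_ball0.
have u_s : smooth (ball 0 r) u by exact: w_smooth.
have F_s m : smooth (ball 0 r) (fun y => F y 0 m).
  move=> k; rewrite (_ : (fun y => _) = fun y => w (lift ord0 m) y * (u y)^-1).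
    apply: Ck_mul => //; first exact: w_smooth.
    by apply: Ck_inv => // y yr; rewrite gt_eqF// u_gt0.
  by apply/funext => y; rewrite mxE.
have wE m y : ball 0 r y -> w (lift ord0 m) y = u y * F y 0 m.
  by move=> yr; rewrite mxE mulrCA mulfV ?mulr1// gt_eqF// u_gt0.
have du i y : ball 0 r y -> is_derive y (e_ i) u (dw ord0 i y).
  move=> yr; rewrite -Dw; last exact: sub.
  by apply: derivableP; exact: (Ck_derivable (u_s 1%N)).
have dF i m y : ball 0 r y ->
    is_derive y (e_ i) (fun y => F y 0 m) ('D_(e_ i) (fun y => F y 0 m) y).
  by move=> yr; apply: derivableP; exact: (Ck_derivable (F_s m 1%N)).
have ddF i j m y : ball 0 r y -> is_derive y (e_ i) ('D_(e_ j) (fun y => F y 0 m))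
    ('D_(e_ i) ('D_(e_ j) (fun y => F y 0 m)) y).
  by move=> yr; apply: derivableP; exact: (Ck_derivable (Ck_pd j (F_s m 2%N))).
have ddu i j y : ball 0 r y -> is_derive y (e_ i) (dw ord0 j)
    (- rho i j y * u y + \sum_k g k i j y * dw ord0 k y).
  move=> yr; rewrite -Ddw; last exact: sub.
  by apply: derivableP; exact: (Ck_derivable (w_smooth _ ord0 (lift ord0 j) rr2 1%N)).
have dwE i m y : ball 0 r y -> dw (lift ord0 m) i y =
    dw ord0 i y * F y 0 m + u y * 'D_(e_ i) (fun y => F y 0 m) y.
  move=> yr; rewrite -Dw; last exact: sub.
  have [_ <-] := is_deriveMR (du i y yr) (dF i m y yr).
  by apply: near_eq_derive; apply: (near_eq_open oR) => // z zr; exact: wE.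
exists r; first by split=> //; exact: le_trans r2r0.
exists u, F; split=> //.
- by apply/rowP => m; rewrite !mxE w0 mul0r.
- apply/matrixP => i m; rewrite !mxE.
  have zr : ball (0 : 'rV[R]_n) r 0 by rewrite ball0E normr0.
  have Fm : F 0 0 m = 0 by rewrite mxE w0 mul0r.
  have := dwE i m 0 zr; rewrite Fm !dw0 [u 0]w0 mulr0 add0r eqxx mul1r => <-.
  by rewrite (inj_eq lift_inj) eq_sym.
move=> i j m y yr.
have u0 : u y != 0 by rewrite gt_eqF// u_gt0.
(* Product rule for the second derivative of [u] times [F]; comparing it with [Ddw] for the
   numerator and dividing by [u] gives the claim. *)
have E1 := is_deriveD (is_deriveMR (ddu i j y yr) (dF i m y yr))
   (is_deriveMR (du i y yr) (ddF i j m y yr)).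
have := Ddw (lift ord0 m) i j y (sub y yr).
have -> : 'D_(e_ i) (dw (lift ord0 m) j) y = 'D_(e_ i) ((fun y => dw ord0 j y * F y 0 m) +
    (fun y => u y * 'D_(e_ j) (fun y => F y 0 m) y)) y.
  by apply: near_eq_derive; apply: (near_eq_open oR) => // z zr; exact: dwE.
have [_ ->] := E1; rewrite wE//.
have -> : \sum_k g k i j y * dw (lift ord0 m) k y =
    F y 0 m * (\sum_k g k i j y * dw ord0 k y)
    + u y * \sum_k g k i j y * 'D_(e_ k) (fun z => F z 0 m) y.
  rewrite !mulr_sumr -big_split/=; apply: eq_bigr => k _; rewrite dwE//; ring.
have [_ ->] := du i y yr; have [_ ->] := du j y yr.
move: ('D_(e_ i) ('D_(e_ j) (fun y => F y 0 m)) y) => X.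
move: (\sum_k g k i j y * 'D_(e_ k) (fun z => F z 0 m) y) => Z.
move: (\sum_k g k i j y * dw ord0 k y) => W.
move: ('D_(e_ i) (fun y => F y 0 m) y) ('D_(e_ j) (fun y => F y 0 m) y) => a b.
move=> H; apply: (mulfI u0); rewrite mulrBr [u y * (_ / _)]mulrCA mulfV// mulr1.
lra.
Qed.

End Beltrami.

(** * Charts *)

Lemma open_preimage_on (T1 T2 : topologicalType) (U : set T1) (W : set T2) (f : T1 -> T2) :
  open U -> (forall x, U x -> {for x, continuous f}) -> open W -> open (U `&` f @^-1` W).
Proof.
move=> oU cf oW; rewrite openE => x [Ux Wx]; apply: filterI.
  exact: open_nbhs_nbhs.
by apply: (cf x Ux); exact: open_nbhs_nbhs.
Qed.

Section Charts.
Variables (R : realType) (n : nat) (M : topologicalType) (S : manifold R n M).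
Implicit Types (c : chart R n M) (x : M) (W : set M) (f : M -> R).
Local Notation e_ i := (delta_mx 0 i : 'rV[R]_n).

Lemma open_chart_preimage c W : open W -> open (chart_cod c `&` par c @^-1` W).
Proof.
move=> oW; apply: open_preimage_on => //; first exact: cod_open.
exact: par_continuous.
Qed.

(** The transition maps of the new chart are those of [c0] composed with [F] or [G], hence smooth,
    and the maximality of the atlas admits it. *)
Lemma subchart c0 (Vx Vy : set 'rV[R]_n) (F G : 'rV[R]_n -> 'rV[R]_n) :
  atlas S c0 -> open Vx -> Vx `<=` chart_cod c0 -> open Vy ->
  (forall y, Vx y -> Vy (F y)) -> (forall y, Vy y -> Vx (G y)) ->
  (forall y, Vx y -> G (F y) = y) -> (forall y, Vy y -> F (G y) = y) ->
  (forall j, smooth Vx (fun y => F y 0 j)) -> (forall j, smooth Vy (fun y => G y 0 j)) ->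
  exists c, [/\ atlas S c, chart_cod c = Vy,
    chart_dom c = chart_dom c0 `&` crd c0 @^-1` Vx,
    crd c = F \o crd c0 & par c = par c0 \o G].
Proof.
move=> ac0 oVx Vxc oVy FV GV GF FG sF sG.
pose D := chart_dom c0 `&` crd c0 @^-1` Vx.
have oD : open D.
  apply: open_preimage_on => //; first exact: dom_open.
  exact: crd_continuous.
have H1 x : D x -> Vy ((F \o crd c0) x) by move=> [_ /= ?]; exact: FV.
have H2 y : Vy y -> D ((par c0 \o G) y).
  move=> Vy_y; have /Vxc Gc := GV y Vy_y; split; first exact: par_dom.
  by rewrite /= parK//; exact: GV.
have H3 x : D x -> (par c0 \o G) ((F \o crd c0) x) = x.
  by move=> [xd /= xV]; rewrite GF// crdK.
have H4 y : Vy y -> (F \o crd c0) ((par c0 \o G) y) = y.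
  by move=> Vy_y /=; rewrite parK ?FG//; exact/Vxc/GV.
have H5 x : D x -> {for x, continuous (F \o crd c0)}.
  move=> [xd /= xV]; apply: continuous_comp; first exact: crd_continuous.
  by apply: continuous_rowP => j; exact: (Ck_cont (sF j 0%N) xV).
have H6 y : Vy y -> {for y, continuous (par c0 \o G)}.
  move=> Vy_y; apply: continuous_comp; last exact/par_continuous/Vxc/GV.
  by apply: continuous_rowP => j; exact: (Ck_cont (sG j 0%N) Vy_y).
pose c := Chart oD oVy H1 H2 H3 H4 H5 H6.
exists c; split=> //; apply: (atlas_maximal (m := S)) => c' ac'.
have [cmp1 cmp2] := atlas_compatible ac0 ac'.
split=> i k.
- apply: (@Ck_comp R n n k Vx _ (fun y => F y 0 i) (crd c0 \o par c')) => //.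
  + exact: open_chart_preimage.
  + by move=> y [_ []].
  + exact: sF.
  + by move=> j; apply: Ck_sub (cmp1 j k) => y [? []].
- apply: (@Ck_comp R n n k (chart_cod c0 `&` par c0 @^-1` chart_dom c') _
    (coordinate c' i \o par c0) G) => //.
  + by apply: open_chart_preimage; exact: dom_open.
  + by apply: (open_chart_preimage (c := c)); exact: dom_open.
  + by move=> y [/= yV yd]; split => //; exact/Vxc/GV.
  + exact: cmp2.
  + by move=> j; apply: Ck_sub (sG j k) => y [].
Qed.

Definition msmooth W f := forall c, atlas S c ->
  smooth (chart_cod c `&` par c @^-1` W) (f \o par c).

Lemma msmooth_chart c W f : atlas S c -> open W -> W `<=` chart_dom c ->
  smooth (chart_cod c `&` par c @^-1` W) (f \o par c) -> msmooth W f.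
Proof.
move=> ac oW Wc sf c' ac' k.
have oV := open_chart_preimage (c := c') oW.
apply: (@Ck_eq _ _ _ _ ((f \o par c) \o (crd c \o par c'))) => //.
  by move=> y [yc yW] /=; rewrite crdK//; exact: Wc.
apply: (@Ck_comp R n n k (chart_cod c `&` par c @^-1` W)) => //.
- exact: open_chart_preimage.
- move=> y [yc yW] /=; have yd := Wc _ yW.
  by split; [exact: crd_cod|rewrite /= crdK].
- move=> j; have [H _] := atlas_compatible ac ac'.
  by apply: Ck_sub (H j k) => y [? /= /Wc].
Qed.

Lemma msmooth_coordinate c i : atlas S c -> msmooth (chart_dom c) (coordinate c i).
Proof. by move=> ac c' ac'; have [H _] := atlas_compatible ac ac'; exact: H. Qed.

Lemma crd_in W c x : chart_dom c x -> W x -> (chart_cod c `&` par c @^-1` W) (crd c x).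
Proof. by move=> xd xW; split; [exact: crd_cod|rewrite /= crdK]. Qed.

Lemma msmooth_differentiable c W f x : atlas S c -> open W -> msmooth W f ->
  chart_dom c x -> W x -> differentiable (f \o par c) (crd c x).
Proof.
move=> ac oW sf xd xW; apply: (Ck_differentiable (open_chart_preimage (c := c) oW) (sf c ac 1%N)).
exact: crd_in.
Qed.

Lemma is_derive_pderiv c W f x i : atlas S c -> open W -> msmooth W f ->
  chart_dom c x -> W x -> is_derive (crd c x) (e_ i) (f \o par c) (pderiv c i f x).
Proof.
move=> ac oW sf xd xW; apply: derivableP; apply: diff_derivable.
exact: msmooth_differentiable sf xd xW.
Qed.

Lemma near_chart c W x : open W -> chart_dom c x -> W x ->
  \forall y \near crd c x, chart_cod c y /\ W (par c y).
Proof.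
move=> oW xd xW; apply: open_nbhs_nbhs; split; first exact: open_chart_preimage.
exact: crd_in.
Qed.

Lemma pderiv_change c c' W f x i : atlas S c -> atlas S c' -> open W -> msmooth W f ->
  chart_dom c x -> chart_dom c' x -> W x ->
  pderiv c' i f x = \sum_a jac c c' a i x * pderiv c a f x.
Proof.
move=> ac ac' oW sf xd xd' xW.
have hx : (crd c \o par c') (crd c' x) = crd c x by rewrite /= crdK.
have dh j : derivable (fun y => (crd c \o par c') y 0 j) (crd c' x) (e_ i).
  by have [] := is_derive_pderiv i ac' (dom_open c) (msmooth_coordinate j ac) xd' xd.
have df : differentiable (f \o par c) ((crd c \o par c') (crd c' x)).
  by rewrite hx; exact: msmooth_differentiable sf xd xW.
have [_ E] := is_derive_comp_rV dh df.
transitivity ('D_(e_ i) ((f \o par c) \o (crd c \o par c')) (crd c' x)).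
  apply: near_eq_derive.
  apply: (@filterS _ (nbhs (crd c' x))) (near_chart (dom_open c) xd' xd) => y [_ yd].
  by rewrite /= crdK.
by rewrite E hx.
Qed.

Lemma msmooth_pderiv c W f i : atlas S c -> open W -> msmooth W f ->
  msmooth (W `&` chart_dom c) (pderiv c i f).
Proof.
move=> ac oW sf.
have oW' : open (W `&` chart_dom c) by apply: openI => //; exact: dom_open.
apply: (msmooth_chart ac oW') => [x []//|k].
apply: (@Ck_eq _ _ _ _ (fun y => 'D_(e_ i) (f \o par c) y)).
- exact: open_chart_preimage.
- by move=> y [yc _]; rewrite /pderiv /= parK.
- by apply: Ck_sub (Ck_pd i (sf c ac k.+1)) => y [? []].
Qed.

Lemma msmooth_jac c c' a i : atlas S c -> atlas S c' ->
  msmooth (chart_dom c `&` chart_dom c') (jac c c' a i).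
Proof.
by move=> ac ac'; apply: msmooth_pderiv => //; [exact: dom_open|exact: msmooth_coordinate].
Qed.

Lemma pderiv_coordinate c a i x : chart_dom c x ->
  pderiv c i (coordinate c a) x = (a == i)%:R.
Proof.
move=> xd; rewrite -(pd_coord a i (crd c x)); apply: near_eq_derive.
apply: (@filterS _ (nbhs (crd c x))) (near_chart (dom_open c) xd xd) => y [yc _].
by rewrite /coordinate /= parK.
Qed.

Lemma jacK c c' x l i : atlas S c -> atlas S c' -> chart_dom c x -> chart_dom c' x ->
  \sum_a jac c' c l a x * jac c c' a i x = (l == i)%:R.
Proof.
move=> ac ac' xd xd'; rewrite -(pderiv_coordinate l i xd').
rewrite (pderiv_change i ac ac' (dom_open c') (msmooth_coordinate l ac') xd xd' xd').
by apply: eq_bigr => a _; rewrite mulrC.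
Qed.

(** Multiplying the transformation law by the Jacobian removes the inverse Jacobian. In this form it
    computes the second derivatives of the coordinates of [c] in the chart [c']. *)
Lemma conn_changeE (nabla : connection S) c c' x m i j : atlas S c -> atlas S c' ->
  chart_dom c x -> chart_dom c' x ->
  \sum_k jac c c' m k x * nabla c' x k i j =
  pderiv c' i (pderiv c' j (coordinate c m)) x
  + \sum_a \sum_b jac c c' a i x * jac c c' b j x * nabla c x m a b.
Proof.
move=> ac ac' xd xd'.
pose Q l := pderiv c' i (pderiv c' j (coordinate c l)) x
  + \sum_a \sum_b jac c c' a i x * jac c c' b j x * nabla c x l a b.
transitivity (\sum_k \sum_l jac c c' m k x * jac c' c k l x * Q l).
  apply: eq_bigr => k _; rewrite (conn_change nabla k i j ac ac' xd xd') mulr_sumr.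
  by apply: eq_bigr => l _; rewrite mulrA.
rewrite exchange_big/= (bigD1 m)//= -mulr_suml jacK// eqxx mul1r.
by rewrite big1 ?addr0// => l lm; rewrite -mulr_suml jacK// eq_sym (negbTE lm) mul0r.
Qed.

End Charts.

(** * The projectively flat chart *)

Section Skew.
Variables (R : realType) (n : nat).

Lemma skew_repeat p (w : p.-tuple 'I_n -> R) (t : p.-tuple 'I_n) (i j : 'I_p) :
  skew w -> i != j -> tnth t i = tnth t j -> w t = 0.
Proof.
move=> sw ij tij; have := sw t (tperm i j); rewrite odd_tperm ij expr1 mulN1r.
rewrite (_ : [tuple _ | m < p] = t); first by move=> H; lra.
apply: eq_from_tnth => m; rewrite tnth_mktuple.
by case: tpermP => // ->.
Qed.

(** The indices of a nonzero component are pairwise distinct, so as there are [n] of them they form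
    a permutation of the standard tuple. *)
Lemma skew_ord_tuple_neq0 (w : n.-tuple 'I_n -> R) : skew w ->
  (exists t, w t != 0) -> w (ord_tuple n) != 0.
Proof.
move=> sw [t wt].
have tinj : injective (tnth t).
  move=> i j tij; apply/eqP; apply: contraNT wt => ij.
  by rewrite (skew_repeat sw ij tij).
have := sw (ord_tuple n) (perm tinj).
rewrite (_ : [tuple _ | m < n] = t); last first.
  by apply: eq_from_tnth => m; rewrite tnth_mktuple tnth_ord_tuple permE.
by move=> H; apply: contraNneq wt => w0; rewrite H w0 mulr0.
Qed.

(** The transformation law of forms at a point where the Jacobian is diagonal, as for a reflection
    of one coordinate or a chart tangent to another. *)
Lemma sum_diagonal_change p (w : p.-tuple 'I_n -> R) (J : 'I_n -> 'I_n -> R)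
    (d : 'I_n -> R) (t : p.-tuple 'I_n) : (forall a i, J a i = (a == i)%:R * d i) ->
  \sum_(s : p.-tuple 'I_n) (\prod_(k < p) J (tnth s k) (tnth t k)) * w s =
  (\prod_(k < p) d (tnth t k)) * w t.
Proof.
move=> JE; rewrite (bigD1 t)//= [X in _ + X]big1 ?addr0.
  by congr (_ * _); apply: eq_bigr => k _; rewrite JE eqxx mul1r.
move=> s st; have [k sk] : exists k, tnth s k != tnth t k.
  apply/existsP; apply: contraNT st; rewrite negb_exists => /forallP H.
  by apply/eqP; apply: eq_from_tnth => k; apply/eqP; rewrite -[_ == _]negbK H.
by rewrite (bigD1 k)//= JE (negbTE sk) !mul0r.
Qed.

End Skew.

(** * Volume component and curvature components in a chart *)

Section VolumeCurvature.
Variables (R : realType) (n : nat) (M : topologicalType) (S : manifold R n M).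
Implicit Types (c : chart R n M) (x : M).
Local Notation e_ i := (delta_mx 0 i : 'rV[R]_n).
Variables (eta : pform S setT n) (nabla : connection S).
Hypotheses (n_gt2 : (2 < n)%N) (hea : equiaffine nabla eta) (hep : equiprojective nabla).

Lemma volume_neq0 c x : atlas S c -> chart_dom c x -> eta c x (ord_tuple n) != 0.
Proof.
move=> ac xd; apply: skew_ord_tuple_neq0; first exact: (form_skew eta ac xd I).
exact: (equiaffine_volume hea) ac xd.
Qed.

(** In the connection term of a top-degree form, replacing the [k]-th index by another one repeats
    an index, so only the trace of the Christoffel symbols survives. *)
Lemma volume_pderiv c x j : atlas S c -> chart_dom c x ->
  pderiv c j (fun z => eta c z (ord_tuple n)) x =
  (\sum_k nabla c x k j k) * eta c x (ord_tuple n).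
Proof.
move=> ac xd; have := equiaffine_parallel hea j (ord_tuple n) ac xd.
rewrite /cov_deriv => /eqP; rewrite subr_eq0 => /eqP ->.
rewrite /conn_term mulr_suml; apply: eq_bigr => k _.
rewrite (bigD1 j)//= [X in _ + X]big1 ?addr0; last first.
  move=> i ij; rewrite big1// => l _; rewrite mxE eqxx/= (negbTE ij) !mul0r//.
rewrite (bigD1 k)//= [X in _ + X]big1 ?addr0; last first.
  move=> l lk; have lk' : k != l by rewrite eq_sym.
  rewrite (@skew_repeat _ _ _ _ _ k l _ lk') ?mulr0//.
    exact: (form_skew eta ac xd I).
  by rewrite !tnth_mktuple eqxx (negbTE lk) tnth_ord_tuple.
rewrite mxE !eqxx mul1r tnth_ord_tuple; congr (_ * _); congr (eta c x _).
apply: eq_from_tnth => m; rewrite tnth_mktuple tnth_ord_tuple.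
by case: eqP => // ->.
Qed.

Lemma curv_compE c x l i j k : atlas S c -> chart_dom c x ->
  curv_comp nabla c x l i j k =
  (n%:R - 1)^-1 * ricci nabla c x (e_ j) (e_ k) * (l == i)%:R
  - (n%:R - 1)^-1 * ricci nabla c x (e_ i) (e_ k) * (l == j)%:R.
Proof.
move=> ac xd.
have := congr1 (fun v : 'rV[R]_n => v 0 l) (hep (e_ i) (e_ j) (e_ k) ac xd).
rewrite !mxE eqxx/= => E; rewrite -!mulrA -mulrBr -E.
rewrite (bigD1 i)//= [X in _ + X]big1 ?addr0; last first.
  move=> a ai; rewrite big1// => b _; rewrite big1// => d _.
  by rewrite mxE eqxx/= (negbTE ai) !mul0r.
rewrite (bigD1 j)//= [X in _ + X]big1 ?addr0; last first.
  move=> b bj; rewrite big1// => d _.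
  by rewrite [e_ j 0 b]mxE eqxx/= (negbTE bj) mulr0 !mul0r.
rewrite (bigD1 k)//= [X in _ + X]big1 ?addr0; last first.
  by move=> d dk; rewrite [e_ k 0 d]mxE eqxx/= (negbTE dk) mulr0 !mul0r.
by rewrite !mxE !eqxx !mul1r.
Qed.

Lemma curv_comp_curvature c l i j k y : atlas S c -> chart_cod c y ->
  curv_comp nabla c (par c y) l i j k =
  curvature (fun l i j y => nabla c (par c y) l i j) l i j k y.
Proof. by move=> ac yc; rewrite /curv_comp /curvature /pderiv parK. Qed.

(* Reflecting one coordinate makes the volume component positive. *)
Lemma centered_chart x0 : exists c, [/\ atlas S c, chart_dom c x0,
  crd c x0 = 0 & 0 < eta c x0 (ord_tuple n)].
Proof.
have [c0 ac0 xd0] := atlas_cover S x0.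
pose i0 : 'I_n := Ordinal (ltn_trans (isT : (0 < 2)%N) n_gt2).
pose b := eta c0 x0 (ord_tuple n) < 0.
pose eps (i : 'I_n) : R := if b && (i == i0) then -1 else 1.
have eps2 i : eps i * eps i = 1 by rewrite /eps; case: ifP => _; rewrite ?mulrNN mulr1.
pose F (y : 'rV[R]_n) : 'rV[R]_n := \row_i (eps i * (y 0 i - crd c0 x0 0 i)).
pose G (y : 'rV[R]_n) : 'rV[R]_n := \row_i (eps i * y 0 i + crd c0 x0 0 i).
have GF y : G (F y) = y by apply/rowP => i; rewrite !mxE mulrA eps2 mul1r subrK.
have FG y : F (G y) = y by apply/rowP => i; rewrite !mxE addrK mulrA eps2 mul1r.
have sF U j : open U -> smooth U (fun y => F y 0 j).
  move=> oU k; apply: (@Ck_eq _ _ _ _ (fun y => eps j * (y 0 j + - crd c0 x0 0 j))) => //.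
    by move=> y _; rewrite mxE.
  by apply: Ck_mul => //; [exact: Ck_cst|apply: Ck_add => //; [exact: Ck_coord|exact: Ck_cst]].
have sG U j : open U -> smooth U (fun y => G y 0 j).
  move=> oU k; apply: (@Ck_eq _ _ _ _ (fun y => eps j * y 0 j + crd c0 x0 0 j)) => //.
    by move=> y _; rewrite mxE.
  apply: Ck_add => //; last exact: Ck_cst.
  by apply: Ck_mul => //; [exact: Ck_cst|exact: Ck_coord].
have oVx : open (chart_cod c0) by exact: cod_open.
have oVy : open (G @^-1` chart_cod c0).
  rewrite -[X in open X]setTI; apply: open_preimage_on => //; first exact: openT.
  by move=> y _; apply: continuous_rowP => j; exact: (Ck_cont (sG setT j openT 0%N)).
have [c [ac codc domc crdc parc]] := subchart (F := F) (G := G) ac0 oVx (@subset_refl _ _) oVy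
   (fun y yc => (eq_ind_r (chart_cod c0) yc (GF y) : (G @^-1` chart_cod c0) (F y)))
   (fun y yc => yc) (fun y _ => GF y) (fun y _ => FG y) (fun j => sF _ j oVx) (fun j => sG _ j oVy).
have xd : chart_dom c x0 by rewrite domc; split=> //; exact: crd_cod.
have crd0 : crd c x0 = 0.
  by rewrite crdc /=; apply/rowP => i; rewrite !mxE subrr mulr0.
exists c; split=> //.
have J a i : jac c0 c a i x0 = (a == i)%:R * eps i.
  rewrite /jac /pderiv crd0 (@near_eq_derive _ _ _ _ (fun y : 'rV[R]_n => eps a * y 0 a + crd c0 x0 0 a)).
    have [_ ->] : is_derive (0 : 'rV[R]_n) (e_ i) (fun y : 'rV[R]_n => eps a * y 0 a + crd c0 x0 0 a)
       (0 * (0 : 'rV[R]_n) 0 a + eps a * (e_ i) 0 a + 0).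
      exact: is_deriveD (is_deriveMR (is_derive_cst (eps a) 0 (e_ i))
        (is_derive_coord a 0 (e_ i))) (is_derive_cst (crd c0 x0 0 a) 0 (e_ i)).
    rewrite mul0r add0r addr0 mxE eqxx/= mulrC.
    by have [->|] := eqVneq a i; rewrite ?mul0r.
  have oc : open (chart_cod c) by exact: cod_open.
  have c0c : chart_cod c 0 by rewrite -crd0; exact: crd_cod.
  apply: (near_eq_open oc _ c0c) => y yc; rewrite /= /coordinate parc /= parK.
    by rewrite mxE.
  by move: yc; rewrite codc.
rewrite (form_change eta _ ac0 ac xd0 xd) // (sum_diagonal_change _ _ J).
have -> : \prod_(k < n) eps (tnth (ord_tuple n) k) = if b then -1 else 1.
  rewrite (bigD1 i0)//= tnth_ord_tuple /eps eqxx andbT big1 ?mulr1// => k ki.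
  by rewrite tnth_ord_tuple (negbTE ki) andbF.
rewrite /b; case: (ltP (eta c0 x0 (ord_tuple n)) 0) => H; first by rewrite mulN1r oppr_gt0.
by rewrite mul1r lt_neqAle H andbT eq_sym volume_neq0.
Qed.

End VolumeCurvature.

(** * A chart with projectively flat Christoffel symbols *)

Section BeltramiChart.
Variables (R : realType) (n : nat) (M : topologicalType) (S : manifold R n M).
Implicit Types (c : chart R n M) (x : M).
Local Notation e_ i := (delta_mx 0 i : 'rV[R]_n).
Variables (eta : pform S setT n) (nabla : connection S).
Hypotheses (n_gt2 : (2 < n)%N) (hea : equiaffine nabla eta) (hep : equiprojective nabla).

(** By [volume_pderiv] the trace is the logarithmic derivative of the volume component; closedness
    is then the symmetry of its second derivatives. *)
Lemma connection_trace_closed c (U : set 'rV[R]_n) i j y : atlas S c -> open U ->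
  U `<=` chart_cod c -> U y ->
  'D_(e_ i) (fun z => \sum_k nabla c (par c z) k j k) y =
  'D_(e_ j) (fun z => \sum_k nabla c (par c z) k i k) y.
Proof.
move=> ac oU Uc Uy.
pose h z := eta c (par c z) (ord_tuple n).
have h0 z : U z -> h z != 0.
  by move=> Uz; apply: (volume_neq0 hea ac); exact/par_dom/Uc.
have h_smooth : smooth U h.
  by move=> k; apply: Ck_sub (form_smooth eta (ord_tuple n) ac k) => z /Uc.
have hE a z : U z -> 'D_(e_ a) h z = (\sum_k nabla c (par c z) k a k) * h z.
  move=> Uz; have zc := Uc _ Uz; rewrite -(volume_pderiv hea a ac); last exact: par_dom.
  by rewrite /pderiv parK.
have E a b : 'D_(e_ a) (fun z => \sum_k nabla c (par c z) k b k) y =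
    'D_(e_ a) ('D_(e_ b) h) y * (h y)^-1 + 'D_(e_ b) h y * (- (h y) ^- 2 * 'D_(e_ a) h y).
  have d1 : derivable ('D_(e_ b) h) y (e_ a).
    exact: (Ck_derivable (Ck_pd b (h_smooth 2%N))).
  have d2 : derivable h y (e_ a) by exact: (Ck_derivable (h_smooth 1%N)).
  have D2 : is_derive y (e_ a) (fun z => (h z)^-1) (- (h y) ^- 2 * 'D_(e_ a) h y).
    by apply: DeriveDef; [apply: derivableV => //; exact: h0|rewrite deriveV//; exact: h0].
  have [_ <-] := is_deriveMR (derivableP d1) D2.
  apply: near_eq_derive; apply: (near_eq_open oU) => // z Uz.
  by rewrite hE// mulfK//; exact: h0.
rewrite !E (schwarz i j oU (h_smooth 2%N) Uy).
by congr (_ + _); ring.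
Qed.

Lemma beltrami_chart x0 : exists c (r : R), [/\ atlas S c, chart_dom c x0, 0 < r,
    chart_cod c = ball 0 r &
    0 < eta c x0 (ord_tuple n) /\
    exists phi : 'I_n -> M -> R, forall x k i j, chart_dom c x ->
      nabla c x k i j = (k == j)%:R * phi i x + (k == i)%:R * phi j x].
Proof.
have [c1 [ac1 xd1 crd0 eta_gt0]] := centered_chart n_gt2 hea x0.
have oc1 : open (chart_cod c1) by exact: cod_open.
have c10 : chart_cod c1 0 by rewrite -crd0; exact: crd_cod.
have [r0 r0_gt0 r0c] : exists2 r0 : R, 0 < r0 & ball 0 r0 `<=` chart_cod c1.
  by have /nbhs_ballP[r0 /= r0_gt0 H] : nbhs (0 : 'rV[R]_n) (chart_cod c1);
    [exact: open_nbhs_nbhs|exists r0].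
pose g l i j y := nabla c1 (par c1 y) l i j.
pose rho j k y := (n%:R - 1)^-1 * ricci nabla c1 (par c1 y) (e_ j) (e_ k).
have g_smooth l i j : smooth (ball 0 r0) (g l i j).
  by move=> k; apply: Ck_sub (conn_smooth nabla l i j ac1 k).
have g_sym l i j y : ball 0 r0 y -> g l i j y = g l j i y.
  by move=> yr; apply: (equiaffine_torsion_free hea) => //; exact/par_dom/r0c.
have g_curv l i j k y : ball 0 r0 y ->
    curvature g l i j k y = rho j k y * (l == i)%:R - rho i k y * (l == j)%:R.
  move=> yr; have yc := r0c _ yr.
  by rewrite -(curv_comp_curvature nabla l i j k ac1 yc) (curv_compE hep)//; exact: par_dom.
have g_trace i j y : ball 0 r0 y -> 'D_(e_ i) (fun z => \sum_k g k j k z) y =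
    'D_(e_ j) (fun z => \sum_k g k i k z) y.
  by move=> yr; apply: (@connection_trace_closed c1 (ball 0 r0)) => //; exact: open_ball0.
have [r1 [r1_gt0 r10] [u [F [[u_s u_gt0] F_s F0 JF0 HF]]]] :=
  beltrami_coordinates n_gt2 r0_gt0 g_smooth g_sym g_curv g_trace.
have [G [r r_gt0 [d dr1 [G1 G2 _ G_s G0]]]] := inverse_function r1_gt0 F_s F0 JF0.
have dsub (y : 'rV[R]_n) : ball 0 d y -> ball 0 r1 y.
  by rewrite !ball0E => /lt_le_trans; apply.
(* Intersecting with the preimage makes the image of the new chart exactly the ball of radius [r],
   hence convex. *)
pose Vx := ball (0 : 'rV[R]_n) d `&` F @^-1` (ball 0 r).
have oVx : open Vx.
  apply: open_preimage_on; [exact: open_ball0| |exact: open_ball0].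
  move=> y yd; apply: continuous_rowP => j; exact: (Ck_cont (F_s j 0%N) (dsub _ yd)).
have Vxc : Vx `<=` chart_cod c1.
  move=> y [/dsub yr _]; apply: r0c.
  by move: yr; rewrite !ball0E => /lt_le_trans; apply.
have [|||||||c [ac codc domc crdc parc]] := @subchart R n M S c1 Vx (ball 0 r) F G ac1 oVx Vxc.
- exact: open_ball0.
- by move=> y [].
- by move=> y yr; have [yd yE] := G1 y yr; split=> //=; rewrite yE.
- by move=> y [yd yr]; exact: G2.
- by move=> y yr; have [] := G1 y yr.
- by move=> j k; apply: Ck_sub (F_s j k) => y [/dsub].
- by move=> j k; exact: G_s.
have d_gt0 : 0 < d.
  have [|+ _] := G1 0; first by rewrite ball0E normr0.
  by rewrite ball0E; exact: le_lt_trans.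
have xd : chart_dom c x0.
  by rewrite domc; split=> //; split; rewrite /= crd0 ?F0 ball0E normr0.
have coordE m y : chart_cod c1 y -> (coordinate c m \o par c1) y = F y 0 m.
  by move=> yc; rewrite /= /coordinate crdc /= parK.
have jacE m i x : chart_dom c1 x ->
    jac c c1 m i x = 'D_(e_ i) (fun y => F y 0 m) (crd c1 x).
  move=> x1; apply: near_eq_derive; apply: (near_eq_open oc1); last exact: crd_cod.
  exact: coordE.
exists c, r; split=> //; split.
  (* At [x0] the change of chart is tangent to the identity, so the positive volume component is
     carried over from [c1]. *)
  have J0 a i : jac c c1 a i x0 = (a == i)%:R.
    by rewrite jacE// crd0; have /matrixP/(_ i a) := JF0; rewrite !mxE eq_sym.
  have K0 a i : jac c1 c a i x0 = (a == i)%:R * 1.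
    rewrite mulr1 -(jacK a i ac ac1 xd xd1).
    rewrite (bigD1 i)//= J0 eqxx mulr1 big1 ?addr0// => b bi.
    by rewrite J0 (negbTE bi) mulr0.
  rewrite (form_change eta _ ac1 ac xd1 xd)// (sum_diagonal_change _ _ K0).
  by rewrite big1// mul1r.
(* Logarithmic derivative of the denominator [u]; the witness below is d ln u expressed in the new
   coordinates. *)
pose du i x := 'D_(e_ i) u (crd c1 x) / u (crd c1 x).
exists (fun a x => \sum_i jac c1 c i a x * du i x) => x m a b xc.
have x1 : chart_dom c1 x by move: xc; rewrite domc => -[].
have yr : ball 0 r1 (crd c1 x) by move: xc; rewrite domc => -[_ [/dsub]].
have u0 : u (crd c1 x) != 0 by rewrite gt_eqF// u_gt0.
pose J : 'M[R]_n := \matrix_(s, i) jac c c1 s i x.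
pose K : 'M[R]_n := \matrix_(i, s) jac c1 c i s x.
pose X : 'M[R]_n := \matrix_(s, t) nabla c x m s t.
pose v : 'rV[R]_n := \row_i du i x.
have JK : J *m K = 1%:M.
  apply/matrixP => s t; rewrite !mxE -(jacK s t ac1 ac x1 xc).
  by apply: eq_bigr => i _; rewrite !mxE.
(* For fixed upper index [m] the transformation law is a matrix identity in the two lower indices.
   The Christoffel symbols of [c1] occur both there and in [HF] and cancel. *)
have JXJ : J^T *m X *m J = v^T *m row m J + (row m J)^T *m v.
  apply/matrixP => i j; rewrite mxE.
  have := conn_changeE nabla m i j ac ac1 xc x1.
  have -> : pderiv c1 i (pderiv c1 j (coordinate c m)) x =
      'D_(e_ i) ('D_(e_ j) (fun z => F z 0 m)) (crd c1 x).
    apply: near_eq_derive; apply: (near_eq_open oc1); last exact: crd_cod.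
    move=> y yc; rewrite /= /pderiv parK//.
    apply: near_eq_derive; apply: (near_eq_open oc1) => //; exact: coordE.
  rewrite HF// /g crdK//.
  have -> : \sum_k nabla c1 x k i j * 'D_(e_ k) (fun z => F z 0 m) (crd c1 x) =
      \sum_k jac c c1 m k x * nabla c1 x k i j.
    by apply: eq_bigr => k _; rewrite jacE// mulrC.
  rewrite -!jacE// -addrA => /eqP; rewrite -subr_eq0 opprD addrA subrr add0r oppr_eq0.
  rewrite addrC subr_eq0 => /eqP E.
  transitivity (\sum_s \sum_t jac c c1 s i x * jac c c1 t j x * nabla c x m s t).
    rewrite exchange_big/=; apply: eq_bigr => t _; rewrite mxE mulr_suml.
    by apply: eq_bigr => s _; rewrite !mxE mulrAC.
  rewrite E [RHS]mxE !mxE !big_ord1 !mxE /du; field.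
  exact: u0.
have XE : X = (v *m K)^T *m delta_mx 0 m + (delta_mx 0 m)^T *m (v *m K).
  have rJK : row m J *m K = delta_mx 0 m by rewrite -row_mul JK row1.
  have : K^T *m (J^T *m X *m J) *m K = X.
    by rewrite -!mulmxA JK mulmx1 mulmxA -trmx_mul JK trmx1 mul1mx.
  move=> <-; rewrite JXJ mulmxDr mulmxDl !mulmxA -!trmx_mul rJK.
  by rewrite -!mulmxA rJK.
have := congr1 (fun Z : 'M[R]_n => Z a b) XE; rewrite !mxE !big_ord1 !mxE !eqxx/= => ->.
have pE s : \sum_j v 0 j * K j s = \sum_i jac c1 c i s x * du i x.
  by apply: eq_bigr => i _; rewrite !mxE mulrC.
by rewrite !pE mulrC (eq_sym b) (eq_sym a).
Qed.

End BeltramiChart.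

(** * Geodesics and parallel transport *)

Lemma is_derive_prodE (R : realType) (V : normedModType R) q (f : 'I_q -> V -> R)
    (df : 'I_q -> R) (x v : V) : (forall k, is_derive x v (f k) (df k)) ->
  is_derive x v (fun y => \prod_(k < q) f k y)
    (\sum_(k < q) \prod_(m < q) (if m == k then df m else f m x)).
Proof.
elim: q f df => [|q IH] f df H.
  rewrite big_ord0 (_ : (fun y => _) = cst 1); first exact: is_derive_cst.
  by apply/funext => y; rewrite big_ord0.
rewrite (_ : (fun y => _) = fun y => f ord0 y * \prod_(k < q) f (lift ord0 k) y); last first.
  by apply/funext => y; rewrite big_ord_recl.
apply: is_derive_eq (is_deriveMR (H ord0) (IH _ _ (fun k => H (lift ord0 k)))) _.
rewrite big_ord_recl; congr (_ + _).
  by rewrite big_ord_recl eqxx; congr (_ * _); apply: eq_bigr => m _; rewrite eq_sym (negbTE (neq_lift _ _)).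
rewrite mulr_sumr; apply: eq_bigr => k _; rewrite big_ord_recl (negbTE (neq_lift _ _)).
by congr (_ * _); apply: eq_bigr => m _; rewrite (inj_eq lift_inj).
Qed.

(** * Covariant derivatives of tensors under a change of frame *)

Section TensorTransport.
Variables (R : realType) (n q : nat) (J dJ om om' : 'I_n -> 'I_n -> R).
Hypothesis dJE : forall a i,
  dJ a i = \sum_k J a k * om' k i - \sum_d om a d * J d i.
Implicit Types (t s r : q.-tuple 'I_n) (w : q.-tuple 'I_n -> R).

(** The matrix [o] acting as a derivation on covariant tensors; [conn_term] is the case where [o] is
    the connection matrix in the direction of a velocity. *)
Definition omega_term (o : 'I_n -> 'I_n -> R) w t : R :=
  \sum_(k < q) \sum_(l < n) o l (tnth t k) * w (subst_index t k l).

Definition pull_tensor w s : R :=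
  \sum_r (\prod_(k < q) J (tnth r k) (tnth s k)) * w r.

Lemma tnth_subst t k l m : tnth (subst_index t k l) m = if m == k then l else tnth t m.
Proof. by rewrite tnth_mktuple. Qed.

Lemma subst_subst t k l : subst_index (subst_index t k l) k (tnth t k) = t.
Proof.
apply: eq_from_tnth => m; rewrite !tnth_subst.
by have [->|] := eqVneq m k.
Qed.

(* [dJ] is the derivative of the Jacobian along a curve, expressed through the two
   connection forms; the identity says that the tensor transformation law commutes
   with covariant differentiation. *)
Lemma pull_tensor_transport w s :
  \sum_r ((\sum_(k < q) \prod_(m < q)
             (if m == k then dJ (tnth r m) (tnth s m) else J (tnth r m) (tnth s m))) * w r
          + (\prod_(k < q) J (tnth r k) (tnth s k)) * omega_term om w r)
  = omega_term om' (pull_tensor w) s.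
Proof.
pose rest r (k : 'I_q) := \prod_(m < q | m != k) J (tnth r m) (tnth s m).
have E1 r k : \prod_(m < q)
    (if m == k then dJ (tnth r m) (tnth s m) else J (tnth r m) (tnth s m)) =
    dJ (tnth r k) (tnth s k) * rest r k.
  rewrite (bigD1 k)//= eqxx; congr (_ * _); apply: eq_bigr => m /negbTE -> //.
have E2 r k : \prod_(m < q) J (tnth r m) (tnth s m) = J (tnth r k) (tnth s k) * rest r k.
  by rewrite (bigD1 k).
have E3 r k l : \prod_(m < q) J (tnth r m) (tnth (subst_index s k l) m) =
    J (tnth r k) l * rest r k.
  rewrite (bigD1 k)//= tnth_subst eqxx; congr (_ * _); apply: eq_bigr => m mk.
  by rewrite tnth_subst (negbTE mk).
have rest_subst r k l : rest (subst_index r k l) k = rest r k.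
  by apply: eq_bigr => m mk; rewrite tnth_subst (negbTE mk).
transitivity (\sum_(k < q) \sum_r (dJ (tnth r k) (tnth s k) * rest r k * w r
    + \sum_l J (tnth r k) (tnth s k) * rest r k * (om l (tnth r k) * w (subst_index r k l)))).
  rewrite exchange_big/=; apply: eq_bigr => r _; rewrite big_split/=; congr (_ + _).
    by rewrite mulr_suml; apply: eq_bigr => k _; rewrite E1.
  rewrite /omega_term mulr_sumr; apply: eq_bigr => k _; rewrite mulr_sumr.
  by apply: eq_bigr => l _; rewrite (E2 r k).
apply: eq_bigr => k _; rewrite big_split/=.
have -> : \sum_r \sum_l J (tnth r k) (tnth s k) * rest r k *
      (om l (tnth r k) * w (subst_index r k l)) =
    \sum_r \sum_d om (tnth r k) d * J d (tnth s k) * rest r k * w r.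
  rewrite pair_big [RHS]pair_big/=.
  (* Exchanging the [k]-th entry of the multi-index with the summation index is an involution; it
     moves the substitution from the tensor to the Jacobian factor. *)
  pose h (u : q.-tuple 'I_n * 'I_n) := (subst_index u.1 k u.2, tnth u.1 k).
  have hK : involutive h.
    by move=> [r l]; rewrite /h /= subst_subst tnth_subst eqxx.
  rewrite (reindex_inj (inv_inj hK)); apply: eq_bigr => -[r d] _ /=.
  rewrite tnth_subst eqxx rest_subst subst_subst; ring.
rewrite -big_split/=.
have -> : \sum_l om' l (tnth s k) * pull_tensor w (subst_index s k l) =
    \sum_r (\sum_l J (tnth r k) l * om' l (tnth s k)) * rest r k * w r.
  under [RHS]eq_bigr do rewrite -mulrA mulr_suml.
  rewrite exchange_big/=; apply: eq_bigr => l _; rewrite /pull_tensor mulr_sumr.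
  by apply: eq_bigr => r _; rewrite E3; ring.
apply: eq_bigr => r _; rewrite dJE -!mulr_suml; ring.
Qed.

End TensorTransport.

Lemma conn_termE (R : realType) (n q : nat) (G : 'I_n -> 'I_n -> 'I_n -> R)
    (v : 'rV[R]_n) (w : q.-tuple 'I_n -> R) (t : q.-tuple 'I_n) :
  conn_term G v w t = omega_term (fun l j => \sum_i v 0 i * G l i j) w t.
Proof.
apply: eq_bigr => k _; rewrite exchange_big/=; apply: eq_bigr => l _.
by rewrite mulr_suml.
Qed.

(** * Change of chart for geodesics and parallel tensors *)

Section Curves.
Variables (R : realType) (n : nat) (M : topologicalType) (S : manifold R n M).
Variable nabla : connection S.
Implicit Types (c : chart R n M) (x : M) (W : set M) (f : M -> R) (g : R -> M) (t : R).
Local Notation e_ i := (delta_mx 0 i : 'rV[R]_n).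

Lemma near_curve W g t : open W -> {for t, continuous g} -> W (g t) ->
  \forall u \near t, W (g u).
Proof. by move=> oW cg gW; apply: (cg); exact: open_nbhs_nbhs. Qed.

Lemma curve_chain c W f g t : atlas S c -> open W -> msmooth S W f -> W (g t) ->
  chart_dom c (g t) -> {for t, continuous g} ->
  (forall k, derivable (coordinate c k \o g) t 1) ->
  is_derive t (1 : R) (f \o g) (\sum_j velocity c g t 0 j * pderiv c j f (g t)).
Proof.
move=> ac oW sf gW gd cg dg.
have df : differentiable (f \o par c) ((crd c \o g) t).
  exact: (msmooth_differentiable ac oW sf gd gW).
have := is_derive_comp_rV (h := crd c \o g) dg df => H.
have E : \forall u \near t, ((f \o par c) \o (crd c \o g)) u = (f \o g) u.
  have := near_curve (dom_open c) cg gd; apply: filterS => u ud.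
  by rewrite /= crdK.
apply: is_derive_eq (near_eq_is_derive E H) _.
by apply: eq_bigr => j _; rewrite mxE derive1E.
Qed.

Lemma velocity_change c c' g t k : atlas S c -> atlas S c' -> chart_dom c (g t) ->
  chart_dom c' (g t) -> {for t, continuous g} ->
  (forall k, derivable (coordinate c k \o g) t 1) ->
  velocity c' g t 0 k = \sum_j velocity c g t 0 j * jac c' c k j (g t).
Proof.
move=> ac ac' gd gd' cg dg; rewrite mxE derive1E.
by have [_ ->] := curve_chain ac (dom_open c') (msmooth_coordinate k ac') gd' gd cg dg.
Qed.

Lemma derivable_coordinate_change c c' g t k : atlas S c -> atlas S c' ->
  chart_dom c (g t) -> chart_dom c' (g t) -> {for t, continuous g} ->
  (forall k, derivable (coordinate c k \o g) t 1) -> derivable (coordinate c' k \o g) t 1.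
Proof.
move=> ac ac' gd gd' cg dg.
by have [] := curve_chain ac (dom_open c') (msmooth_coordinate k ac') gd' gd cg dg.
Qed.

(** A geodesic must satisfy its equation in every chart; one chart containing the curve suffices,
    since the second derivatives of the coordinate change cancel against the inhomogeneous term in
    the transformation law of the connection. *)
Lemma geodesic_of_chart c (I : set R) g : atlas S c -> open I ->
  (forall t, I t -> chart_dom c (g t)) -> (forall t, I t -> {for t, continuous g}) ->
  (forall t, I t -> forall k : 'I_n,
     [/\ derivable (coordinate c k \o g) t 1,
         derivable (fun u => velocity c g u 0 k) t 1 &
         derive1 (fun u => velocity c g u 0 k) t +
           \sum_(i < n) \sum_(j < n) nabla c (g t) k i j *
             velocity c g t 0 i * velocity c g t 0 j = 0]) ->
  geodesic nabla I g.
Proof.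
move=> ac oI Id cg H; split=> // c' t ac' It gd' k.
have gd := Id t It; have cgt := cg t It.
have dg u : I u -> forall k, derivable (coordinate c k \o g) u 1.
  by move=> Iu l; have [] := H u Iu l.
have d1 := derivable_coordinate_change (k := k) ac ac' gd gd' cgt (dg t It).
have dv j : is_derive t (1 : R) (fun u => velocity c g u 0 j)
    (- \sum_(a < n) \sum_(b < n) nabla c (g t) j a b *
             velocity c g t 0 a * velocity c g t 0 b).
  have [_ d2 /eqP] := H t It j; rewrite addr_eq0 derive1E => /eqP <-.
  exact: derivableP.
have oW : open (chart_dom c' `&` chart_dom c) by apply: openI; exact: dom_open.
have dJ j := curve_chain ac oW (msmooth_jac k j ac' ac) (conj gd' gd) gd cgt (dg t It).
have D : is_derive t (1 : R) (fun u => velocity c' g u 0 k)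
   (\sum_j ((- \sum_(a < n) \sum_(b < n) nabla c (g t) j a b *
             velocity c g t 0 a * velocity c g t 0 b) * jac c' c k j (g t) +
     velocity c g t 0 j *
       \sum_i velocity c g t 0 i * pderiv c i (jac c' c k j) (g t))).
  apply: near_eq_is_derive (is_derive_sumE (index_enum 'I_n) (P := xpredT)
    (fun j _ => is_deriveMR (dv j) (dJ j))).
  have N1 : \forall u \near t, I u by exact: open_nbhs_nbhs.
  have N2 := near_curve (dom_open c') cgt gd'.
  apply: filterS2 N1 N2 => u Iu ud'.
  by rewrite (velocity_change k ac ac' (Id u Iu) ud' (cg u Iu) (dg u Iu)).
split; [exact: d1|by case: D|].
rewrite derive1E; have [_ ->] := D.
have vE a : velocity c' g t 0 a = \sum_j velocity c g t 0 j * jac c' c a j (g t).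
  exact: velocity_change (dg t It).
have CE i j := conn_changeE nabla k i j ac' ac gd' gd.
set v := fun j => velocity c g t 0 j.
rewrite -/(v _) in vE *.
have -> : \sum_i \sum_j nabla c' (g t) k i j * velocity c' g t 0 i * velocity c' g t 0 j =
    \sum_i \sum_j v i * v j * \sum_a \sum_b jac c' c a i (g t) * jac c' c b j (g t) *
       nabla c' (g t) k a b.
  transitivity (\sum_a \sum_b \sum_i \sum_j v i * v j * (jac c' c a i (g t) * jac c' c b j (g t) *
       nabla c' (g t) k a b)).
    apply: eq_bigr => a _; apply: eq_bigr => b _; rewrite !vE -mulrA mulr_suml mulr_sumr.
    apply: eq_bigr => i _; rewrite !mulr_sumr; apply: eq_bigr => j _; rewrite /v; ring.
  under eq_bigr do rewrite exchange_big/=; rewrite exchange_big/=.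
  apply: eq_bigr => i _; under eq_bigr do rewrite exchange_big/=; rewrite exchange_big/=.
  apply: eq_bigr => j _; rewrite mulr_sumr; apply: eq_bigr => a _.
  by rewrite mulr_sumr.
have -> : \sum_i \sum_j v i * v j * \sum_a \sum_b jac c' c a i (g t) * jac c' c b j (g t) *
       nabla c' (g t) k a b =
   \sum_i \sum_j v i * v j * (\sum_l jac c' c k l (g t) * nabla c (g t) l i j
      - pderiv c i (jac c' c k j) (g t)).
  by apply: eq_bigr => i _; apply: eq_bigr => j _; rewrite CE addrAC subrr add0r.
rewrite big_split/=.
have -> : \sum_i \sum_j v i * v j * (\sum_l jac c' c k l (g t) * nabla c (g t) l i j
      - pderiv c i (jac c' c k j) (g t)) =
   \sum_i \sum_j v i * v j * (\sum_l jac c' c k l (g t) * nabla c (g t) l i j)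
   - \sum_j v j * \sum_i v i * pderiv c i (jac c' c k j) (g t).
  have -> : \sum_j v j * \sum_i v i * pderiv c i (jac c' c k j) (g t) =
      \sum_i \sum_j v i * v j * pderiv c i (jac c' c k j) (g t).
    rewrite exchange_big/=; apply: eq_bigr => j _; rewrite mulr_sumr.
    by apply: eq_bigr => i _; ring.
  rewrite -sumrB; apply: eq_bigr => i _; rewrite -sumrB; apply: eq_bigr => j _.
  by rewrite mulrBr.
rewrite addrACA subrr addr0.
apply/eqP; rewrite addrC addr_eq0 -sumrN; apply/eqP.
under [RHS]eq_bigr do rewrite mulNr opprK mulr_suml.
transitivity (\sum_l \sum_i \sum_j v i * v j * (jac c' c k l (g t) * nabla c (g t) l i j)).
  rewrite [RHS]exchange_big/=; apply: eq_bigr => i _; rewrite [RHS]exchange_big/=.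
  by apply: eq_bigr => j _; rewrite mulr_sumr.
apply: eq_bigr => l _; apply: eq_bigr => i _.
rewrite mulr_suml; apply: eq_bigr => j _; rewrite /v; ring.
Qed.

(** The analogue of [geodesic_of_chart] for tensors along a curve: differentiating the Jacobian
    along the curve produces the two connection matrices required by [pull_tensor_transport]. *)
Lemma parallel_change c c' g t q (th : chart R n M -> R -> q.-tuple 'I_n -> R) :
  atlas S c -> atlas S c' -> chart_dom c (g t) -> chart_dom c' (g t) ->
  {for t, continuous g} -> (forall k, derivable (coordinate c k \o g) t 1) ->
  (\forall u \near t, forall s, th c' u s = \sum_(r : q.-tuple 'I_n)
     (\prod_(k < q) jac c c' (tnth r k) (tnth s k) (g u)) * th c u r) ->
  (forall s, derivable (fun u => th c u s) t 1 /\
     derive1 (fun u => th c u s) t - conn_term (nabla c (g t)) (velocity c g t) (th c t) s = 0) ->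
  forall s, derivable (fun u => th c' u s) t 1 /\
     derive1 (fun u => th c' u s) t
       - conn_term (nabla c' (g t)) (velocity c' g t) (th c' t) s = 0.
Proof.
move=> ac ac' gd gd' cg dg thE H s.
have dg' k : derivable (coordinate c' k \o g) t 1.
  exact: derivable_coordinate_change dg.
have oW : open (chart_dom c `&` chart_dom c') by apply: openI; exact: dom_open.
have dJ a i := curve_chain ac' oW (msmooth_jac a i ac ac') (conj gd gd') gd' cg dg'.
pose J a i := jac c c' a i (g t).
pose DJ a i := \sum_j velocity c' g t 0 j * pderiv c' j (jac c c' a i) (g t).
pose om l j := \sum_i velocity c g t 0 i * nabla c (g t) l i j.
pose om' l j := \sum_i velocity c' g t 0 i * nabla c' (g t) l i j.
(* [conn_changeE] contracted with the velocity. *)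
have DJE a i : DJ a i = \sum_k J a k * om' k i - \sum_d om a d * J d i.
  have CE j := conn_changeE nabla a j i ac ac' gd gd'.
  have -> : DJ a i = \sum_j velocity c' g t 0 j * (\sum_k J a k * nabla c' (g t) k j i
     - \sum_b \sum_d jac c c' b j (g t) * jac c c' d i (g t) * nabla c (g t) a b d).
    by apply: eq_bigr => j _; rewrite CE addrK.
  under eq_bigr do rewrite mulrBr; rewrite sumrB; congr (_ - _).
    under eq_bigr do rewrite mulr_sumr; rewrite exchange_big/=.
    by apply: eq_bigr => k _; rewrite /om' mulr_sumr; apply: eq_bigr => j _; ring.
  have vE b : velocity c g t 0 b = \sum_j velocity c' g t 0 j * jac c c' b j (g t).
    exact: velocity_change dg'.
  transitivity (\sum_d \sum_b velocity c g t 0 b * nabla c (g t) a b d * J d i); last first.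
    by apply: eq_bigr => d _; rewrite /om mulr_suml.
  rewrite exchange_big/=; under eq_bigr do rewrite mulr_sumr; rewrite exchange_big/=.
  apply: eq_bigr => b _; under eq_bigr do rewrite mulr_sumr; rewrite exchange_big/=.
  apply: eq_bigr => d _; rewrite vE !mulr_suml; apply: eq_bigr => j _; rewrite /J; ring.
have dth r : is_derive t (1 : R) (fun u => th c u r) (omega_term om (th c t) r).
  have [d1 /eqP] := H r; rewrite subr_eq0 derive1E conn_termE => /eqP <-.
  exact: derivableP.
have D := is_derive_sumE (index_enum (q.-tuple 'I_n)) (P := xpredT)
  (fun r _ => is_deriveMR (is_derive_prodE (fun k => dJ (tnth r k) (tnth s k))) (dth r)).
have E : \forall u \near t, \sum_(r : q.-tuple 'I_n)
     (\prod_(k < q) jac c c' (tnth r k) (tnth s k) (g u)) * th c u r = th c' u s.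
  by apply: filterS thE => u ->.
have D' := near_eq_is_derive E D.
split; first by case: D'.
rewrite derive1E; have [_ ->] := D'.
rewrite conn_termE; apply/eqP; rewrite subr_eq0; apply/eqP.
have -> : th c' t = pull_tensor J (th c t).
  by apply/funext => r; rewrite (nbhs_singleton thE).
exact: (pull_tensor_transport DJE).
Qed.

End Curves.

(** * An autonomous equation and the existence of geodesics *)

Section ODE.
Variable R : realType.
Local Notation e0 := (delta_mx 0 0 : 'rV[R]_1).

(* [s] is the inverse of the antiderivative of [1 / K], which solves a linear system
   in one variable. *)
Lemma autonomous_ode (d : R) (K : R -> R) : 0 < d ->
  smooth (ball (0 : 'rV[R]_1) d) (fun z => K (z 0 0)) ->
  (forall s, `|s| < d -> K s != 0) -> K 0 = 1 ->
  exists2 eps : R, 0 < eps & exists s : R -> R, s 0 = 0 /\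
    forall t, `|t| < eps -> `|s t| < d /\ is_derive t (1 : R) s (K (s t)).
Proof.
move=> d0 sK K0 K1.
have inb (z : 'rV[R]_1) : ball 0 d z -> `|z 0 0| < d.
  by rewrite ball0E; apply: le_lt_trans; exact: coord_le_norm.
pose k (z : 'rV[R]_1) := (K (z 0 0))^-1.
have sk : smooth (ball (0 : 'rV[R]_1) d) k.
  move=> m; apply: Ck_inv => //; first exact: open_ball0.
  by move=> z /inb; exact: K0.
(* The system Y_0' = k Y_1, Y_1' = 0. With initial value (0, 1) the first component is the
   antiderivative of 1 / [K] vanishing at 0. *)
pose A (i : 'I_1) (z : 'rV[R]_1) : 'M[R]_2 :=
  \matrix_(a, b) (((a == 0) && (b == 1))%:R * k z).
have sA i a b : smooth (ball 0 d) (fun z => A i z a b).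
  move=> m; rewrite (_ : (fun z => _) = fun z => ((a == 0) && (b == 1))%:R * k z).
    by apply: Ck_mul => //; [exact: open_ball0|exact: Ck_cst].
  by apply/funext => z; rewrite mxE.
have fA i j (x : 'rV[R]_1) : ball 0 d x ->
    pdmx i (A j) x + A j x *m A i x = pdmx j (A i) x + A i x *m A j x.
  by rewrite (ord1 i) (ord1 j).
have [rho [rho0 rhod] [Y [Y0 sY dY]]] := flat_system_solution (delta_mx 1 0) d0 sA fA.
have oB : open (ball (0 : 'rV[R]_1) rho) by exact: open_ball0.
have sub (z : 'rV[R]_1) : ball 0 rho z -> ball 0 d z.
  by rewrite !ball0E => /lt_le_trans; apply.
have b0 : ball (0 : 'rV[R]_1) rho 0 by rewrite ball0E normr0.
have DY i a z : ball 0 rho z -> 'D_(delta_mx 0 i) (fun y => Y y a 0) z =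
    (a == 0)%:R * k z * Y z 1 0.
  move=> zr; have := congr1 (fun M : 'cV[R]_2 => M a 0) (dY i z zr).
  rewrite !mxE => ->; rewrite big_ord_recl big_ord1 !mxE /= andbF !mul0r add0r.
  by rewrite (_ : lift ord0 ord0 = 1) ?eqxx ?andbT//; apply: val_inj.
have Y1 z : ball 0 rho z -> Y z 1 0 = 1.
  move=> zr.
  rewrite (@zero_derivatives_cst _ _ (ball 0 rho) (fun y => Y y 1 0) z 0) //.
  - by rewrite Y0 mxE !eqxx.
  - exact: segment_closed_ball.
  - exact: sY.
  - by move=> i y yr; rewrite DY// !mul0r.
pose F (z : 'rV[R]_1) : 'rV[R]_1 := \row__ Y z 0 0.
have FE j : (fun z => F z 0 j) = (fun z => Y z 0 0) by apply/funext => z; rewrite mxE.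
have sF j : smooth (ball 0 rho) (fun z => F z 0 j) by rewrite FE; exact: sY.
have F0 : F 0 = 0 by apply/rowP => j; rewrite !mxE Y0 mxE.
have k0 : k 0 = 1 by rewrite /k mxE K1 invr1.
have J0 : jacmx F 0 = 1%:M.
  apply/matrixP => i j; rewrite mxE FE DY// Y1// k0 !ord1 !mxE eqxx !mulr1//.
have [G [r r0 [dl dlr [G1 _ _ sG G0]]]] := inverse_function rho0 sF F0 J0.
exists r => //; exists (fun t => G (t *: e0) 0 0).
split; first by rewrite scale0r G0 mxE.
move=> t tr.
have tb : ball 0 r (t *: e0).
  by rewrite ball0E (le_lt_trans (norm_delta _ _)).
have [Gd FG] := G1 _ tb.
have Gr : ball 0 rho (G (t *: e0)).
  by move: Gd; rewrite !ball0E => /lt_le_trans; apply.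
split; first exact/inb/sub.
have dG j : derivable (fun y => G y 0 j) (t *: e0) (delta_mx 0 0).
  exact: (Ck_derivable (sG j 1%N)).
have dT : differentiable (fun z => Y z 0 0) (G (t *: e0)).
  exact: (Ck_differentiable oB (sY 0 0 1%N)).
have [_ E] := is_derive_comp_rV dG dT.
have E1 : 'D_(delta_mx 0 0) ((fun z => Y z 0 0) \o G) (t *: e0) = 1.
  transitivity ('D_e0 (fun z : 'rV[R]_1 => z 0 0) (t *: e0)); last first.
    by rewrite pd_coord eqxx.
  apply: near_eq_derive.
  apply: (near_eq_open (@open_ball0 R 1 r)) => // y yr.
  by have [_ <-] := G1 y yr; rewrite mxE (G1 y yr).2.
move: E; rewrite E1 big_ord1 DY// Y1// eqxx mul1r mulr1 => E.
have KG : K (G (t *: e0) 0 0) != 0 by exact/K0/inb/sub.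
have := @is_derive_line R _ _ (fun y => G y 0 0) 0 e0 t; rewrite addr0 => /(_ (dG 0)).
rewrite (_ : (fun u : R => _) = (fun u : R => G (u *: e0) 0 0)); last first.
  by apply/funext => u; rewrite addr0.
move=> D; apply: is_derive_eq D _.
by apply: (mulIf (invr_neq0 KG)); rewrite -/(k _) -E mulfV.
Qed.

End ODE.

Section Geodesics.
Variables (R : realType) (n : nat) (M : topologicalType) (S : manifold R n M).
Variable nabla : connection S.
Variables (c : chart R n M) (r : R) (phi : 'I_n -> M -> R) (Q : 'rV[R]_n -> R).
Hypotheses (ac : atlas S c) (codc : chart_cod c = ball 0 r)
  (nablaE : forall x k i j, chart_dom c x ->
      nabla c x k i j = (k == j)%:R * phi i x + (k == i)%:R * phi j x)
  (Q_smooth : smooth (ball 0 r) Q) (Q_gt0 : forall y, ball 0 r y -> 0 < Q y)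
  (dQ : forall j y, ball 0 r y -> 'D_(delta_mx 0 j) Q y = - 2 * phi j (par c y) * Q y).

(** The quadratic term of the geodesic equation is proportional to the velocity, so straight lines
    are geodesics up to parametrisation. *)
Lemma flat_conn_quadratic (v : 'I_n -> R) k x : chart_dom c x ->
  \sum_(i < n) \sum_(j < n) nabla c x k i j * v i * v j =
  2 * (\sum_j v j * phi j x) * v k.
Proof.
move=> xd.
transitivity (\sum_i (v i * phi i x * v k + (k == i)%:R * v i * \sum_j v j * phi j x)).
  apply: eq_bigr => i _; rewrite mulr_sumr.
  have -> : v i * phi i x * v k = \sum_j (k == j)%:R * (v i * phi i x * v j).
    rewrite (bigD1 k)//= eqxx mul1r big1 ?addr0// => j jk.
    by rewrite eq_sym (negbTE jk) mul0r.
  by rewrite -big_split/=; apply: eq_bigr => j _; rewrite nablaE//; ring.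
rewrite big_split/= -mulr_suml -mulr_suml.
have -> : \sum_i (k == i)%:R * v i = v k.
  rewrite (bigD1 k)//= eqxx mul1r big1 ?addr0// => j jk.
  by rewrite eq_sym (negbTE jk) mul0r.
ring.
Qed.

(** On the line [s t *: v + y0] the geodesic equation becomes s'' = -2 phi(v) s'^2. The equation
    [dQ] makes s' = Q(s v + y0) / Q(y0) a first integral, normalised so that the initial velocity is
    [v]. *)
Lemma geodesic_exists (y0 v : 'rV[R]_n) : ball 0 r y0 ->
  exists (I : set R) (g : R -> M), [/\ open I, is_interval I, I 0,
    (forall t, I t -> chart_dom c (g t)) &
    [/\ geodesic nabla I g, g 0 = par c y0 & velocity c g 0 = v]].
Proof.
move=> y0r; have := y0r; rewrite ball0E => y0r'.
have oB : open (ball (0 : 'rV[R]_n) r) by exact: open_ball0.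
(* For parameters below [d] the line stays in the ball; the added 1 covers [v = 0]. *)
pose d := (r - `|y0|) / (`|v| + 1).
have v1 : 0 < `|v| + 1 by rewrite ltr_wpDl.
have d0 : 0 < d by rewrite divr_gt0// subr_gt0.
have inr (s : R) : `|s| < d -> ball 0 r (s *: v + y0).
  move=> sd; rewrite ball0E (le_lt_trans (ler_normD _ _))// -ltrBrDr normrZ.
  apply: (@le_lt_trans _ _ (`|s| * (`|v| + 1))); first by rewrite ler_wpM2l// lerDl.
  by rewrite -ltr_pdivlMr.
pose K s := Q (s *: v + y0) / Q y0.
have Q00 : Q y0 != 0 by rewrite gt_eqF// Q_gt0.
have sK : smooth (ball (0 : 'rV[R]_1) d) (fun z => K (z 0 0)).
  move=> m; apply: Ck_mul; [exact: open_ball0| |exact: Ck_cst].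
  apply: (@Ck_comp R 1 n m (ball 0 r) (ball 0 d) Q (fun z : 'rV[R]_1 => z 0 0 *: v + y0)) => //.
  - exact: open_ball0.
  - move=> z; rewrite ball0E => zd; apply: inr.
    by apply: le_lt_trans zd; exact: coord_le_norm.
  - move=> j; rewrite (_ : (fun z => _) = fun z : 'rV[R]_1 => z 0 0 * v 0 j + y0 0 j); last first.
      by apply/funext => z; rewrite !mxE.
    apply: Ck_add; [exact: open_ball0| |exact: Ck_cst].
    by apply: Ck_mul; [exact: open_ball0|exact: Ck_coord|exact: Ck_cst].
have K_neq0 s : `|s| < d -> K s != 0.
  by move=> sd; rewrite mulf_neq0 ?invr_neq0// gt_eqF// Q_gt0//; exact: inr.
have K1 : K 0 = 1 by rewrite /K scale0r add0r mulfV.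
have [eps eps0 [s [s0 Hs]]] := autonomous_ode d0 sK K_neq0 K1.
pose I : set R := [set t | `|t| < eps].
pose g t := par c (s t *: v + y0).
have gb t : I t -> ball 0 r (s t *: v + y0) by move=> /Hs[sd _]; exact: inr.
have gc t : I t -> chart_cod c (s t *: v + y0) by rewrite codc; exact: gb.
have gd t : I t -> chart_dom c (g t) by move=> It; apply: par_dom; exact: gc.
have oI : open I.
  rewrite (_ : I = ball 0 eps); first exact: ball_open.
  by apply/seteqP; split => t; rewrite /I /= -ball_normE /= sub0r normrN.
have dx k t : I t -> is_derive t (1 : R) (fun u => s u * v 0 k + y0 0 k) (K (s t) * v 0 k).
  move=> It; have [_ ds] := Hs t It.
  apply: is_derive_eq (is_deriveD (is_deriveMR ds (is_derive_cst (v 0 k) t (1 : R)))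
    (is_derive_cst (y0 0 k) t (1 : R))) _.
  by rewrite mulr0 !addr0.
have xE k t : I t -> (coordinate c k \o g) t = s t * v 0 k + y0 0 k.
  by move=> It; rewrite /= /coordinate /g parK; [rewrite !mxE|exact: gc].
have dc k t : I t -> is_derive t (1 : R) (coordinate c k \o g) (K (s t) * v 0 k).
  move=> It; apply: near_eq_is_derive (dx k t It).
  have : \forall u \near t, I u by exact: open_nbhs_nbhs.
  by apply: filterS => u Iu; rewrite xE.
have velE k t : I t -> velocity c g t 0 k = K (s t) * v 0 k.
  by move=> It; rewrite mxE derive1E; have [_ ->] := dc k t It.
have dK t : I t -> is_derive t (1 : R) (K \o s)
    (- 2 * (\sum_j v 0 j * phi j (g t)) * K (s t) * K (s t)).
  move=> It; have [sd ds] := Hs t It.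
  have dQs : derivable Q (s t *: v + y0) v.
    apply: diff_derivable; apply: (Ck_differentiable oB (Q_smooth 1%N)); exact: gb.
  have D1 := is_deriveMR (is_derive_line dQs) (is_derive_cst (Q y0)^-1 (s t) (1 : R)).
  have := is_derive1_comp D1 ds => D2; apply: is_derive_eq D2 _.
  rewrite mulr0 addr0 diff_dir; last first.
    by apply: (Ck_differentiable oB (Q_smooth 1%N)); exact: gb.
  rewrite (_ : \sum_j _ = - 2 * (\sum_j v 0 j * phi j (g t)) * Q (s t *: v + y0)).
    by rewrite /K /cst; ring.
  rewrite mulr_sumr mulr_suml; apply: eq_bigr => j _.
  rewrite dQ; last exact: gb.
  by rewrite /g; ring.
have I0 : I 0 by rewrite /I /= normr0.
exists I, g; split=> //.
  move=> a b /= aI bI z /andP[az zb]; rewrite /I /= ltr_norml.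
  move: aI bI; rewrite /I /= !ltr_norml => /andP[a1 _] /andP[_ b1].
  by rewrite (lt_le_trans a1 az) (le_lt_trans zb b1).
split.
- apply: (geodesic_of_chart ac oI gd).
    move=> t It; apply: (@continuous_comp _ _ _ (fun u => s u *: v + y0) (par c)).
      apply: continuous_rowP => k; rewrite (_ : (fun u => _) = fun u => s u * v 0 k + y0 0 k).
        apply: differentiable_continuous; apply/derivable1_diffP.
        by case: (dx k t It).
      by apply/funext => u; rewrite !mxE.
    by apply: par_continuous; exact: gc.
  move=> t It k.
  have dv : is_derive t (1 : R) (fun u => velocity c g u 0 k)
      (- 2 * (\sum_j v 0 j * phi j (g t)) * K (s t) * K (s t) * v 0 k).
    have D := is_deriveMR (dK t It) (is_derive_cst (v 0 k) t (1 : R)).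
    have N : \forall u \near t, (K \o s) u * v 0 k = velocity c g u 0 k.
      have : \forall u \near t, I u by exact: open_nbhs_nbhs.
      by apply: filterS => u Iu; rewrite velE.
    apply: is_derive_eq (near_eq_is_derive N D) _.
    by rewrite mulr0 addr0.
  split; [by case: (dc k t It)|by case: dv|].
  rewrite derive1E; have [_ ->] := dv.
  rewrite (flat_conn_quadratic (fun j => velocity c g t 0 j)); last exact: gd.
  rewrite velE//.
  have -> : \sum_j velocity c g t 0 j * phi j (g t) = K (s t) * \sum_j v 0 j * phi j (g t).
    by rewrite mulr_sumr; apply: eq_bigr => j _; rewrite velE// mulrA.
  ring.
- by rewrite /g s0 scale0r add0r.
- by apply/rowP => k; rewrite velE// s0 K1 mul1r.
Qed.

End Geodesics.

(** * Killing-Yano tensors in a projectively flat chart *)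

Section SkewCons.
Variables (R : realType) (n : nat).

Definition act_tuple q (s : 'S_q) (t : q.-tuple 'I_n) : q.-tuple 'I_n :=
  [tuple tnth t (s m) | m < q].

Lemma tnth_cons0 q (i : 'I_n) (t : q.-tuple 'I_n) : tnth [tuple of i :: t] ord0 = i.
Proof. by rewrite (tnth_nth i). Qed.

Lemma tnth_consS q (i : 'I_n) (t : q.-tuple 'I_n) k :
  tnth [tuple of i :: t] (lift ord0 k) = tnth t k.
Proof. by rewrite (tnth_nth i) (tnth_nth i t). Qed.

Lemma tuple_cons_ext q (t : q.+1.-tuple 'I_n) :
  t = [tuple of tnth t ord0 :: [tuple tnth t (lift ord0 k) | k < q]].
Proof.
apply: eq_from_tnth => m; case: (unliftP ord0 m) => [k ->|->].
  by rewrite tnth_consS tnth_mktuple.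
by rewrite tnth_cons0.
Qed.

Lemma sum_tuple_cons q (F : q.+1.-tuple 'I_n -> R) :
  \sum_t F t = \sum_a \sum_(r : q.-tuple 'I_n) F [tuple of a :: r].
Proof.
rewrite pair_big/=.
pose h (u : 'I_n * q.-tuple 'I_n) := [tuple of u.1 :: u.2].
pose h' (t : q.+1.-tuple 'I_n) := (tnth t ord0, [tuple tnth t (lift ord0 k) | k < q]).
rewrite (reindex h)//; exists h' => [[a r] _|t _].
  rewrite /h /h' tnth_cons0; congr (_, _).
  by apply: eq_from_tnth => k; rewrite tnth_mktuple tnth_consS.
by rewrite /h /h' [RHS]tuple_cons_ext.
Qed.

Lemma skew_tperm_generate q (w : q.-tuple 'I_n -> R) :
  (forall i j t, i != j -> w (act_tuple (tperm i j) t) = - w t) -> skew w.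
Proof.
move=> H t s; rewrite -/(act_tuple s t).
have [ts -> Hts] := prod_tpermP s; elim: ts Hts t => [_ t|[i j] ts IH /= /andP[ij Hts] t].
  rewrite big_nil odd_perm1 mul1r; congr w.
  by apply: eq_from_tnth => m; rewrite tnth_mktuple perm1.
rewrite big_cons /=.
have -> (a b : 'S_q) : act_tuple (a * b) t = act_tuple a (act_tuple b t).
  by apply: eq_from_tnth => m; rewrite !tnth_mktuple permM.
rewrite H// IH// odd_permM odd_tperm (ij : i != j) addTb.
by rewrite signrN mulNr.
Qed.

Lemma skew_act_tperm q (w : q.-tuple 'I_n -> R) i j t :
  skew w -> i != j -> w (act_tuple (tperm i j) t) = - w t.
Proof. by move=> sw ij; rewrite sw odd_tperm ij mulN1r. Qed.

Lemma skew_swap_head q (w : q.+1.-tuple 'I_n -> R) (s : q.-tuple 'I_n) k i j : skew w ->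
  w [tuple of j :: subst_index s k i] = - w [tuple of i :: subst_index s k j].
Proof.
move=> sw; rewrite -(@skew_act_tperm _ w ord0 (lift ord0 k))//.
congr w; apply: eq_from_tnth => m; rewrite tnth_mktuple.
case: tpermP => [->|->|].
- by rewrite tnth_cons0 tnth_consS tnth_subst eqxx.
- by rewrite tnth_cons0 tnth_consS tnth_subst eqxx.
case: (unliftP ord0 m) => [l ->|->]// _ /eqP; rewrite (inj_eq lift_inj) => lk.
by rewrite !tnth_consS !tnth_subst (negbTE lk).
Qed.

(** Transpositions inside the tail and the one of the first two slots are given; a transposition of
    the head with any later slot is conjugate to the latter by a tail transposition. *)
Lemma skew_cons q (w : q.+2.-tuple 'I_n -> R) :
  (forall a, skew (fun t : q.+1.-tuple 'I_n => w [tuple of a :: t])) ->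
  (forall a b (s : q.-tuple 'I_n),
     w [tuple of a :: [tuple of b :: s]] = - w [tuple of b :: [tuple of a :: s]]) ->
  skew w.
Proof.
move=> Ht Hh; pose o1 : 'I_q.+2 := lift ord0 ord0.
have tailP i j t : i != j -> w (act_tuple (tperm (lift ord0 i) (lift ord0 j)) t) = - w t.
  move=> ij; rewrite [in RHS](tuple_cons_ext t) -(skew_act_tperm _ (Ht _) ij).
  congr w; apply: eq_from_tnth => m; rewrite tnth_mktuple.
  case: (unliftP ord0 m) => [k ->|->]; last by rewrite tnth_cons0 tpermD.
  rewrite tnth_consS !tnth_mktuple; congr (tnth t _).
  case: (tpermP i j k) => [->|->|/eqP ki /eqP kj]; rewrite ?tpermL ?tpermR//.
  by rewrite tpermD// (inj_eq lift_inj) eq_sym.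
have headP t : w (act_tuple (tperm ord0 o1) t) = - w t.
  pose s : q.-tuple 'I_n := [tuple tnth t (lift ord0 (lift ord0 k)) | k < q].
  have tE : t = [tuple of tnth t ord0 :: [tuple of tnth t o1 :: s]].
    rewrite {1}(tuple_cons_ext t); apply: eq_from_tnth => m.
    case: (unliftP ord0 m) => [k ->|->]; last by rewrite !tnth_cons0.
    rewrite !tnth_consS tnth_mktuple; case: (unliftP ord0 k) => [l ->|->].
      by rewrite tnth_consS tnth_mktuple.
    by rewrite tnth_cons0.
  rewrite [in RHS]tE -Hh; congr w; apply: eq_from_tnth => m; rewrite tnth_mktuple.
  case: tpermP => [->|->|]; rewrite ?tnth_cons0//.
  case: (unliftP ord0 m) => [k ->|->]// _ /eqP; rewrite (inj_eq lift_inj).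
  case: (unliftP ord0 k) => [l ->|->]; last by rewrite eqxx.
  by move=> _; rewrite !tnth_consS tnth_mktuple.
have actM (a b : 'S_q.+2) t : act_tuple (a * b) t = act_tuple a (act_tuple b t).
  by apply: eq_from_tnth => m; rewrite !tnth_mktuple permM.
have zeroP j t : w (act_tuple (tperm ord0 (lift ord0 j)) t) = - w t.
  have [->|j0] := eqVneq j ord0; first exact: headP.
  have -> : tperm ord0 (lift ord0 j) =
      (tperm o1 (lift ord0 j) * tperm ord0 o1 * tperm o1 (lift ord0 j))%g.
    rewrite -{1}(tpermV o1 (lift ord0 j)) -mulgA -conjgE tpermJ tpermL tpermD//.
  by rewrite !actM tailP 1?eq_sym// headP opprK tailP// eq_sym.
apply: skew_tperm_generate => i j t ij.
case: (unliftP ord0 i) ij => [i' ->|->]; case: (unliftP ord0 j) => [j' ->|->] ij.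
- by apply: tailP; rewrite (inj_eq lift_inj) in ij.
- by rewrite tpermC.
- exact: zeroP.
- by rewrite eqxx in ij.
Qed.

End SkewCons.

Lemma is_derive_comp1 (R : realType) (V : normedModType R) (g : R -> R) (f : V -> R)
    (y v : V) (a b : R) :
  is_derive (f y) (1 : R) g a -> is_derive y v f b -> is_derive y v (g \o f) (a * b).
Proof.
move=> Hg Hf.
have L0 (h : V -> R) : derivable h y v ->
    is_derive (0 : R) (1 : R) (fun t : R => h (t *: v + y)) ('D_v h y).
  move=> dh; have := @is_derive_line R V R h y v 0.
  by rewrite scale0r add0r; apply.
have [df <-] := Hf.
have Hg' : is_derive ((fun t : R => f (t *: v + y)) 0) (1 : R) g a.
  by rewrite scale0r add0r.
have D := is_derive1_comp Hg' (L0 _ df).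
have d1 : derivable (g \o f) y v by apply/derivable1P; case: D.
apply: DeriveDef => //.
by have [_ <-] := L0 _ d1; have [_ <-] := D.
Qed.

Lemma skew_gradient_affine (R : realType) (n q : nat) (r : R)
    (th : q.+1.-tuple 'I_n -> 'rV[R]_n -> R) : 0 < r ->
  (forall t, smooth (ball 0 r) (th t)) ->
  (forall y, ball 0 r y -> skew (fun t => th t y)) ->
  (forall a b (s : q.-tuple 'I_n) y, ball 0 r y ->
     'D_(delta_mx 0 a) (th [tuple of b :: s]) y
     + 'D_(delta_mx 0 b) (th [tuple of a :: s]) y = 0) ->
  exists (A : q.+2.-tuple 'I_n -> R) (B : q.+1.-tuple 'I_n -> R),
    [/\ skew A, skew B & forall y, ball 0 r y -> forall t,
      th t y = \sum_(a < n) A [tuple of a :: t] * y 0 a + B t].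
Proof.
(* Alternately exchanging the first two indices, without sign, and the last two, with sign, returns
   to the start after six moves with three sign changes. *)
have zero (x1 x2 x3 x4 x5 x6 : R) : x1 = - x2 -> x2 = x3 -> x3 = - x4 -> x4 = x5 ->
     x5 = - x6 -> x6 = x1 -> x1 = 0 by lra.
move=> r0 sth skth dth.
have oU : open (ball (0 : 'rV[R]_n) r) by exact: open_ball0.
have U0 : ball (0 : 'rV[R]_n) r 0 by rewrite ball0E normr0.
pose T c a t y := 'D_(delta_mx 0 c) ('D_(delta_mx 0 a) (th t)) y.
have Tsym c a t y : ball 0 r y -> T c a t y = T a c t y.
  by move=> yr; apply: (schwarz c a oU (sth t 2%N)).
have d2 c a t y : ball 0 r y ->
    is_derive y (delta_mx 0 c) ('D_(delta_mx 0 a) (th t)) (T c a t y).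
  by move=> yr; apply: derivableP; exact: (Ck_derivable (Ck_pd a (sth t 2%N))).
have Tskew c a b (s : q.-tuple 'I_n) y : ball 0 r y ->
    T c a [tuple of b :: s] y = - T c b [tuple of a :: s] y.
  move=> yr; apply/eqP; rewrite -addr_eq0; apply/eqP.
  have [_ <-] := is_deriveD (d2 c a [tuple of b :: s] y yr) (d2 c b [tuple of a :: s] y yr).
  rewrite -(derive_cst (0 : R) y (delta_mx 0 c)); apply: near_eq_derive.
  by apply: (near_eq_open oU) => // z zr; exact: dth.
have T0 c a t y : ball 0 r y -> T c a t y = 0.
  move=> yr; rewrite (tuple_cons_ext t); set b := tnth t ord0; set s := [tuple _ | k < q].
  have E1 := Tskew c a b s y yr; have E2 := Tsym c b [tuple of a :: s] y yr.
  have E3 := Tskew b c a s y yr; have E4 := Tsym b a [tuple of c :: s] y yr.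
  have E5 := Tskew a b c s y yr; have E6 := Tsym a c [tuple of b :: s] y yr.
  exact: zero E1 E2 E3 E4 E5 E6.
(* The gradient at 0 with the differentiation index in front: skewness in the first two slots comes
   from [dth], in the remaining ones from [skth]. *)
pose A (u : q.+2.-tuple 'I_n) :=
  'D_(delta_mx 0 (tnth u ord0)) (th [tuple tnth u (lift ord0 k) | k < q.+1]) 0.
have AE a (t : q.+1.-tuple 'I_n) : A [tuple of a :: t] = 'D_(delta_mx 0 a) (th t) 0.
  rewrite /A tnth_cons0; congr ('D_ _ (th _) _).
  by apply: eq_from_tnth => k; rewrite tnth_mktuple tnth_consS.
have gradE a (t : q.+1.-tuple 'I_n) y : ball 0 r y -> 'D_(delta_mx 0 a) (th t) y = A [tuple of a :: t].
  move=> yr; rewrite AE.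
  apply: (@zero_derivatives_cst _ _ _ ('D_(delta_mx 0 a) (th t)) y 0 oU) => //.
  - exact: segment_closed_ball.
  - exact: (Ck_pd a (sth t 2%N)).
  - by move=> c z zr; exact: T0.
exists A, (fun t => th t 0); split.
- apply: skew_cons => [a|a b s]; last first.
    by rewrite !AE; apply/eqP; rewrite -addr_eq0 dth.
  apply: skew_tperm_generate => i j t ij; rewrite !AE.
  have [_ <-] := is_deriveN (derivableP (Ck_derivable (i := a) (sth t 1%N) U0)).
  apply: near_eq_derive; apply: (near_eq_open oU) => // z zr.
  exact: (skew_act_tperm t (skth z zr) ij).
- exact: skth.
move=> y yr t.
pose f z := th t z + (-1) * \sum_(a < n) A [tuple of a :: t] * z 0 a.
have sf : smooth (ball 0 r) f.
  move=> k; apply: Ck_add => //; first exact: sth.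
  apply: Ck_mul => //; first exact: Ck_cst.
  by apply: Ck_sum => // a _; apply: Ck_mul => //; [exact: Ck_cst|exact: Ck_coord].
have : f y = f 0.
  apply: (@zero_derivatives_cst _ _ _ f y 0 oU) => //; first exact: segment_closed_ball.
  move=> c z zr.
  have D1 := derivableP (Ck_derivable (i := c) (sth t 1%N) zr).
  have D2 := is_derive_sumE (index_enum 'I_n) (P := xpredT) (fun a _ =>
    is_deriveMR (is_derive_cst (A [tuple of a :: t]) z (delta_mx 0 c)) (is_derive_coord a z (delta_mx 0 c))).
  have [_ ->] := is_deriveD D1 (is_deriveMR (is_derive_cst (-1 : R) z (delta_mx 0 c)) D2).
  rewrite gradE// mul0r add0r (bigD1 c)//= big1 => [|a ac]; rewrite mxE.
    by rewrite !eqxx mulr1 mul0r add0r addr0 /cst mulN1r subrr.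
  by rewrite eqxx/= (negbTE ac) mulr0 mul0r addr0.
have S0 : \sum_(a < n) A [tuple of a :: t] * (0 : 'rV[R]_n) 0 a = 0.
  by rewrite big1// => a _; rewrite mxE mulr0.
by rewrite /f S0 mulr0 addr0 mulN1r => <-; rewrite addrC subrK.
Qed.

(** * Powers of the volume density in the flat chart *)

Section FlatChart.
Variables (R : realType) (n : nat) (M : topologicalType) (S : manifold R n M).
Variables (eta : pform S setT n) (nabla : connection S).
Hypothesis hea : equiaffine nabla eta.
Variables (c : chart R n M) (r : R) (phi : 'I_n -> M -> R) (x0 : M).
Hypotheses (ac : atlas S c) (codc : chart_cod c = ball 0 r)
  (x0c : chart_dom c x0) (eta_x0 : 0 < eta c x0 (ord_tuple n))
  (nablaE : forall x k i j, chart_dom c x ->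
      nabla c x k i j = (k == j)%:R * phi i x + (k == i)%:R * phi j x).
Local Notation e_ i := (delta_mx 0 i : 'rV[R]_n).
Local Notation vol x := (eta c x (ord_tuple n)).
Local Notation B := (ball (0 : 'rV[R]_n) r).

Let oB : open B. Proof. exact: open_ball0. Qed.
Let B_dom y : B y -> chart_dom c (par c y).
Proof. by move=> yB; apply: par_dom; rewrite codc. Qed.
Let B_cod y : B y -> chart_cod c y. Proof. by rewrite codc. Qed.
Let crd_B x : chart_dom c x -> B (crd c x). Proof. by move=> xc; rewrite -codc; exact: crd_cod. Qed.

Definition volc y := vol (par c y).

Lemma volc_smooth : smooth B volc.
Proof.
by move=> k; apply: Ck_sub (form_smooth eta (ord_tuple n) ac k) => y yB; split=> //; exact: B_cod.
Qed.

(** A negative value would force a zero on the segment to the image of [x0], where the component is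
    positive; the segment lies in the ball, on which the component never vanishes. *)
Lemma volc_gt0 y : B y -> 0 < volc y.
Proof.
move=> yB; have nz z : B z -> volc z != 0.
  by move=> zB; apply: (volume_neq0 hea ac); exact: B_dom.
rewrite lt_neqAle eq_sym nz//= leNgt; apply/negP => y0.
pose z0 := crd c x0; have z0B : B z0 by exact: crd_B.
have z0_gt0 : 0 < volc z0 by rewrite /volc /z0 crdK.
have inB (s : R) : 0 <= s <= 1 -> B (s *: (y - z0) + z0).
  by move=> s01; apply: segment_closed_ball.
have [||s /[!in_itv]/= s01 sE] := @IVT R (fun s : R => volc (s *: (y - z0) + z0)) 0 1 0 ler01.
- apply: derivable_within_continuous => s /[!in_itv]/= s01.
  have [] // := @is_derive_line R _ _ volc z0 (y - z0) s.
  by apply: diff_derivable; apply: (Ck_differentiable oB (volc_smooth 1%N)); exact: inB.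
- rewrite scale0r add0r scale1r subrK ge_min le_max.
  by rewrite (ltW y0) (ltW z0_gt0) orbT.
- by have := nz _ (inB _ s01); rewrite sE eqxx.
Qed.

Lemma vol_gt0 x : chart_dom c x -> 0 < vol x.
Proof. by move=> xc; have := volc_gt0 (crd_B xc); rewrite /volc crdK. Qed.

(** The trace of [nablaE] is n phi_j + phi_j; this is the origin of the factor 1/(n + 1) in [psi],
    whose gradient is then phi. *)
Lemma volc_pd j y : B y -> 'D_(e_ j) volc y = n.+1%:R * phi j (par c y) * volc y.
Proof.
move=> yB; have := volume_pderiv hea j ac (B_dom yB).
rewrite /pderiv parK; last exact: B_cod.
move=> ->; congr (_ * _).
transitivity (\sum_k (phi j (par c y) + (k == j)%:R * phi k (par c y))).
  by apply: eq_bigr => k _; rewrite nablaE ?eqxx ?mul1r//; exact: B_dom.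
rewrite big_split/= sumr_const card_ord (bigD1 j)//= eqxx mul1r big1 ?addr0.
  by rewrite -natr1 mulrDl mul1r mulr_natl.
by move=> k /negbTE ->; rewrite mul0r.
Qed.

Definition psi x : R := (n.+1)%:R^-1 * ln (vol x).

(** The exponents in use are p + 1 and its opposite, for rescaling the form, and -2, for the speed
    of geodesics. *)
Definition expsi (q : R) y : R := expR (q * psi (par c y)).

Lemma expsi_gt0 q y : 0 < expsi q y. Proof. exact: expR_gt0. Qed.

Lemma expsi_derive q j y : B y ->
  is_derive y (e_ j) (expsi q) (q * phi j (par c y) * expsi q y).
Proof.
move=> yB.
have D1 : is_derive y (e_ j) volc (n.+1%:R * phi j (par c y) * volc y).
  by rewrite -volc_pd//; apply: derivableP; exact: (Ck_derivable (volc_smooth 1%N)).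
have D2 := is_derive_comp1 (is_derive1_ln (volc_gt0 yB)) D1.
have D3 := is_deriveMR (is_derive_cst (q * n.+1%:R^-1) y (e_ j)) D2.
have D4 := is_derive_comp1 (is_derive_expR _) D3.
rewrite (_ : expsi q = expR \o (fun z => cst (q * n.+1%:R^-1) z * (@ln R \o volc) z)).
  apply: is_derive_eq D4 _.
  rewrite mul0r add0r /= /cst /expsi /psi -/(volc y).
  rewrite [LHS]mulrC; congr (_ * _).
  have v0 : volc y != 0 by rewrite gt_eqF// volc_gt0.
  by field; rewrite v0 /= addrC natr1 pnatr_eq0.
by apply/funext => z; rewrite /expsi /psi /= /cst mulrA.
Qed.

(** No regularity of [phi] is given; [volc_pd] recovers it as a multiple of a logarithmic derivative
    of the volume component. *)
Lemma phi_smooth j : smooth B (fun y => phi j (par c y)).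
Proof.
move=> k; apply: (@Ck_eq _ _ _ _ (fun y => n.+1%:R^-1 * ('D_(e_ j) volc y * (volc y)^-1))) => //.
  move=> y yB; rewrite volc_pd// mulfK; last by rewrite gt_eqF// volc_gt0.
  by rewrite mulrA mulVf ?mul1r ?pnatr_eq0.
apply: Ck_mul => //; first exact: Ck_cst.
apply: Ck_mul => //; first exact: (Ck_pd j (volc_smooth k.+1)).
by apply: Ck_inv => //; [move=> y yB; rewrite gt_eqF// volc_gt0|exact: volc_smooth].
Qed.

(** [expsi_derive] is a linear first-order system with smooth coefficients, so continuity upgrades
    to smoothness by [bootstrap]. *)
Lemma expsi_smooth q : smooth B (expsi q).
Proof.
apply: (@bootstrap R n B 'I_1 (fun _ => expsi q) (fun i _ _ y => q * phi i (par c y))) => //.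
- by move=> i _ _ k; apply: Ck_mul => //; [exact: Ck_cst|exact: phi_smooth].
- move=> _ y yB.
  rewrite (_ : expsi q = expR \o (fun z => q * n.+1%:R^-1 * (@ln R \o volc) z)).
    apply: continuous_comp; last exact: continuous_expR.
    apply: continuousM; first exact: (@cst_continuous _ _ (q * n.+1%:R^-1)).
    apply: continuous_comp; first exact: (Ck_cont (volc_smooth 0%N) yB).
    exact: (continuous_ln (volc_gt0 yB)).
  by apply/funext => z; rewrite /expsi /psi /= mulrA.
- by move=> i _ y yB; rewrite big_ord1; exact: expsi_derive.
- exact: ord0.
Qed.

End FlatChart.

Lemma polarization (R : realType) (n : nat) (T : 'M[R]_n) :
  (forall v : 'rV[R]_n, \sum_i \sum_j v 0 i * v 0 j * T i j = 0) ->
  forall a b, T a b + T b a = 0.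
Proof.
move=> H a b.
have qE (v : 'rV[R]_n) : (v *m T *m v^T) 0 0 = 0.
  rewrite -[RHS](H v) exchange_big/= mxE; apply: eq_bigr => j _.
  by rewrite !mxE mulr_suml; apply: eq_bigr => i _; rewrite mulrAC.
have dE (i j : 'I_n) : (delta_mx 0 i *m T *m (delta_mx 0 j)^T) (0 : 'I_1) (0 : 'I_1) = T i j.
  by rewrite trmx_delta -rowE -colE !mxE.
have diag i : T i i = 0 by rewrite -dE qE.
have addE (X Y : 'M[R]_1) : (X + Y) 0 0 = X 0 0 + Y 0 0 by rewrite mxE.
have := qE (delta_mx 0 a + delta_mx 0 b).
by rewrite linearD/= !(mulmxDl, mulmxDr) !addE !dE !diag add0r addr0.
Qed.

(** * The Killing-Yano equation in the flat chart *)

Section KillingYano.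
Variables (R : realType) (n : nat) (M : topologicalType) (S : manifold R n M).
Variables (eta : pform S setT n) (nabla : connection S).
Hypothesis hea : equiaffine nabla eta.
Variables (c : chart R n M) (r : R) (phi : 'I_n -> M -> R) (x0 : M).
Hypotheses (ac : atlas S c) (codc : chart_cod c = ball 0 r) (r_gt0 : 0 < r)
  (x0c : chart_dom c x0) (eta_x0 : 0 < eta c x0 (ord_tuple n))
  (nablaE : forall x k i j, chart_dom c x ->
      nabla c x k i j = (k == j)%:R * phi i x + (k == i)%:R * phi j x).
Local Notation e_ i := (delta_mx 0 i : 'rV[R]_n).
Local Notation B := (ball (0 : 'rV[R]_n) r).
Local Notation expsi := (expsi eta c).

Let oB : open B. Proof. exact: open_ball0. Qed.
Let B_dom y : B y -> chart_dom c (par c y).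
Proof. by move=> yB; apply: par_dom; rewrite codc. Qed.
Let B_cod y : B y -> chart_cod c y. Proof. by rewrite codc. Qed.
Let crd_B x : chart_dom c x -> B (crd c x). Proof. by move=> xc; rewrite -codc; exact: crd_cod. Qed.

Variables (q : nat) (omega : pform S (chart_dom c) q.+1).

(** The form theta, for degree p = q + 1. *)
Definition rescaled t y : R := expsi (- q.+2%:R) y * omega c (par c y) t.

Lemma omega_rescaled t y : omega c (par c y) t = expsi q.+2%:R y * rescaled t y.
Proof. by rewrite /rescaled mulrA -expRD mulNr subrr expR0 mul1r. Qed.

Lemma rescaled_smooth t : smooth B (rescaled t).
Proof.
move=> k; apply: Ck_mul => //.
  exact: (expsi_smooth hea ac codc x0c eta_x0 nablaE).
apply: Ck_sub (form_smooth omega t ac k) => y yB; split; first exact: B_cod.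
exact: B_dom.
Qed.

Lemma rescaled_skew y : B y -> skew (fun t => rescaled t y).
Proof.
move=> yB t s; have xc := B_dom yB.
by rewrite /rescaled (form_skew omega ac xc xc) mulrCA.
Qed.

Lemma msmooth_component t : msmooth S (chart_dom c) (fun x => omega c x t).
Proof.
apply: (msmooth_chart ac) => //; first exact: dom_open.
exact: form_smooth.
Qed.

Lemma pderiv_component t x j : chart_dom c x ->
  pderiv c j (fun z => omega c z t) x = q.+2%:R * phi j x * omega c x t
  + expsi q.+2%:R (crd c x) * 'D_(e_ j) (rescaled t) (crd c x).
Proof.
move=> xc; have yB := crd_B xc.
have D1 := expsi_derive hea ac codc x0c eta_x0 nablaE q.+2%:R j yB.
have D2 := derivableP (Ck_derivable (i := j) (rescaled_smooth t 1%N) yB).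
have [_] := is_deriveMR D1 D2.
rewrite -mulrA -omega_rescaled crdK// => <-.
by congr ('D_ _ _ _); apply/funext => y; rewrite /= omega_rescaled.
Qed.

(** In each slot the first half of [nablaE] multiplies by phi(v), while the second half inserts [v]
    a second time into the skew tensor and contributes 0. *)
Lemma conn_term_contraction (v : 'rV[R]_n) x (s : q.-tuple 'I_n) : chart_dom c x ->
  let w (t : q.-tuple 'I_n) := \sum_i v 0 i * omega c x [tuple of i :: t] in
  conn_term (nabla c x) v w s = q%:R * (\sum_j v 0 j * phi j x) * w s.
Proof.
move=> xc w; set F := \sum_j _.
transitivity (\sum_(k < q) F * w s); last first.
  by rewrite sumr_const card_ord -[(F * w s) *+ q]mulr_natl mulrA.
apply: eq_bigr => k _.
have sk := form_skew omega ac xc xc.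
have zero : \sum_i v 0 i * w (subst_index s k i) = 0.
  have E : \sum_i v 0 i * w (subst_index s k i) = - \sum_i v 0 i * w (subst_index s k i).
    transitivity (\sum_i \sum_j v 0 i * (v 0 j * omega c x [tuple of j :: subst_index s k i])).
      by apply: eq_bigr => i _; rewrite /w mulr_sumr.
    rewrite exchange_big/= -sumrN; apply: eq_bigr => j _.
    rewrite /w mulr_sumr -sumrN; apply: eq_bigr => i _.
    by rewrite (skew_swap_head s k i j sk); ring.
  by move: E; move: (\sum_i _) => z E; lra.
have ss : subst_index s k (tnth s k) = s.
  by apply: eq_from_tnth => m; rewrite tnth_subst; have [->|] := eqVneq m k.
transitivity (\sum_i (v 0 i * phi i x * w s
    + phi (tnth s k) x * (v 0 i * w (subst_index s k i)))).
  apply: eq_bigr => i _.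
  transitivity (\sum_l ((l == tnth s k)%:R * (v 0 i * phi i x * w (subst_index s k l))
     + (l == i)%:R * (v 0 i * phi (tnth s k) x * w (subst_index s k l)))).
    by apply: eq_bigr => l _; rewrite nablaE//; ring.
  rewrite big_split/= (bigD1 (tnth s k))//= eqxx big1 => [|l /negbTE ->]; last by rewrite mul0r.
  rewrite (bigD1 i)//= eqxx big1 => [|l /negbTE ->]; last by rewrite mul0r.
  by rewrite ss mulr1n; ring.
by rewrite big_split/= -mulr_suml -mulr_sumr zero mulr0 addr0.
Qed.

Definition radial_defect (v : 'rV[R]_n) y (s : q.-tuple 'I_n) : R :=
  \sum_i \sum_j v 0 i * v 0 j * 'D_(e_ j) (rescaled [tuple of i :: s]) y.

(** Three multiples of phi(v) times the contraction arise: -2 from the acceleration, q + 2 from the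
    exponential factor, -q from the connection term. Their cancellation dictates the exponent p + 1
    = q + 2. *)
Lemma contraction_transport (g : R -> M) (t : R) (s : q.-tuple 'I_n) : chart_dom c (g t) ->
  {for t, continuous g} ->
  (forall k : 'I_n,
     [/\ derivable (coordinate c k \o g) t 1,
         derivable (fun u => velocity c g u 0 k) t 1 &
         derive1 (fun u => velocity c g u 0 k) t +
           \sum_(i < n) \sum_(j < n) nabla c (g t) k i j *
             velocity c g t 0 i * velocity c g t 0 j = 0]) ->
  let th u := contraction (velocity c g u) (omega c (g u)) in
  derivable (fun u => th u s) t 1 /\
  derive1 (fun u => th u s) t - conn_term (nabla c (g t)) (velocity c g t) (th t) s =
  expsi q.+2%:R (crd c (g t)) * radial_defect (velocity c g t) (crd c (g t)) s.
Proof.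
move=> gd cg H th.
have dg k : derivable (coordinate c k \o g) t 1 by have [] := H k.
set v := velocity c g t.
have [F FE] : exists F, F = \sum_j v 0 j * phi j (g t) by eexists.
have dv k : is_derive t (1 : R) (fun u => velocity c g u 0 k) (- (2 * F * v 0 k)).
  have [_ d2 /eqP] := H k.
  rewrite (flat_conn_quadratic nablaE (fun j => v 0 j) k gd) -FE addr_eq0 derive1E => /eqP <-.
  exact: derivableP.
have df i := curve_chain ac (dom_open c) (msmooth_component [tuple of i :: s]) gd gd cg dg.
have D := is_derive_sumE (index_enum 'I_n) (P := xpredT)
  (fun i _ => is_deriveMR (dv i) (df i)).
split; first by case: D.
rewrite derive1E; have [_ ->] := D.
rewrite (conn_term_contraction v s gd) -FE.
rewrite /radial_defect !mulr_sumr -sumrB; apply: eq_bigr => i _ /=.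
have -> : \sum_j v 0 j * pderiv c j (fun x => omega c x [tuple of i :: s]) (g t) =
   q.+2%:R * F * omega c (g t) [tuple of i :: s] + expsi q.+2%:R (crd c (g t)) *
     \sum_j v 0 j * 'D_(e_ j) (rescaled [tuple of i :: s]) (crd c (g t)).
  rewrite FE !mulr_sumr mulr_suml -big_split/=; apply: eq_bigr => j _.
  by rewrite pderiv_component//; ring.
have -> : expsi q.+2%:R (crd c (g t)) *
    \sum_j v 0 i * v 0 j * 'D_(e_ j) (rescaled [tuple of i :: s]) (crd c (g t)) =
  v 0 i * (expsi q.+2%:R (crd c (g t)) *
     \sum_j v 0 j * 'D_(e_ j) (rescaled [tuple of i :: s]) (crd c (g t))).
  by rewrite mulrCA; congr (_ * _); rewrite mulr_sumr; apply: eq_bigr => j _; rewrite mulrA.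
move: (expsi _ _ * _) => X; rewrite -(natr1 q.+1) -(natr1 q) -/v; ring.
Qed.

Lemma contraction_change (g : R -> M) (u : R) c' (s : q.-tuple 'I_n) : atlas S c' -> chart_dom c (g u) ->
  chart_dom c' (g u) -> {for u, continuous g} ->
  (forall k, derivable (coordinate c' k \o g) u 1) ->
  contraction (velocity c' g u) (omega c' (g u)) s =
  \sum_(t : q.-tuple 'I_n) (\prod_(k < q) jac c c' (tnth t k) (tnth s k) (g u)) *
     contraction (velocity c g u) (omega c (g u)) t.
Proof.
move=> ac' gd gd' cg dg' /=.
have vE a := velocity_change a ac' ac gd' gd cg dg'.
transitivity (\sum_(t : q.-tuple 'I_n) \sum_a \sum_i velocity c' g u 0 i *
   (jac c c' a i (g u) * (\prod_(k < q) jac c c' (tnth t k) (tnth s k) (g u)) *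
    omega c (g u) [tuple of a :: t])).
  rewrite exchange_big/=; under [RHS]eq_bigr do rewrite exchange_big/=.
  rewrite [RHS]exchange_big/=; apply: eq_bigr => i _.
  rewrite (form_change omega _ ac ac' gd gd' gd) sum_tuple_cons mulr_sumr.
  apply: eq_bigr => a _; rewrite mulr_sumr; apply: eq_bigr => t _.
  congr (_ * (_ * _)); rewrite big_ord_recl !tnth_cons0; congr (_ * _).
  by apply: eq_bigr => k _; rewrite !tnth_consS.
apply: eq_bigr => t _; rewrite mulr_sumr; apply: eq_bigr => a _.
rewrite vE mulr_suml mulr_sumr; apply: eq_bigr => i _; ring.
Qed.

(** For necessity, the defect is evaluated at time 0 on a geodesic with prescribed point and
    velocity, and polarisation extracts the skewness of the gradient. For sufficiency, the defect is
    computed in [c] along an arbitrary geodesic and [parallel_change] transfers the conclusion to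
    every other chart. *)
Theorem killing_yano_flat_chart :
  killing_yano nabla omega <->
  exists (A : q.+2.-tuple 'I_n -> R) (B0 : q.+1.-tuple 'I_n -> R),
    [/\ skew A, skew B0 & forall y, B y -> forall t,
       rescaled t y = \sum_(a < n) A [tuple of a :: t] * y 0 a + B0 t].
Proof.
split=> [KY|[A [B0 [skA skB0 thE]]] I g oI iI Ic [cg gg]].
  apply: (skew_gradient_affine r_gt0 rescaled_smooth rescaled_skew) => a b s y yB.
  pose T : 'M[R]_n := \matrix_(i, j) 'D_(e_ j) (rescaled [tuple of i :: s]) y.
  suff /polarization /(_ b a) : forall v : 'rV[R]_n, \sum_i \sum_j v 0 i * v 0 j * T i j = 0.
    by rewrite !mxE.
  move=> v.
  (* The function e^(-2 psi) satisfies the logarithmic equation that [geodesic_exists] asks of [Q],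
     because phi is the gradient of psi. *)
  have Q_s := expsi_smooth hea ac codc x0c eta_x0 nablaE (- 2).
  have Q_gt0 z : B z -> 0 < expsi (- 2) z by move=> _; exact: expsi_gt0.
  have dQ j z : B z -> 'D_(e_ j) (expsi (- 2)) z = - 2 * phi j (par c z) * expsi (- 2) z.
    by move=> zB; have [_ ->] := expsi_derive hea ac codc x0c eta_x0 nablaE (- 2) j zB.
  have [I [g [oI iI I0 Ic [geo g0 v0]]]] := geodesic_exists ac codc nablaE Q_s Q_gt0 dQ v yB.
  have [cg gg] := geo.
  have gd := Ic 0 I0.
  have [_ E] := contraction_transport s gd (cg 0 I0) (gg c 0 ac I0 gd).
  have [_] := KY I g oI iI Ic geo c 0 ac I0 gd s.
  rewrite E v0 g0 parK; last exact: B_cod.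
  move=> /eqP; rewrite mulf_eq0 gt_eqF ?expsi_gt0//= => /eqP E2; rewrite -[RHS]E2.
  by apply: eq_bigr => i _; apply: eq_bigr => j _; rewrite mxE.
move=> c' t ac' It gd'.
have gd := Ic t It.
have dg u : I u -> forall k, derivable (coordinate c k \o g) u 1.
  by move=> Iu k; have [] := gg c u ac Iu (Ic u Iu) k.
have dth a t' y : B y -> 'D_(e_ a) (rescaled t') y = A [tuple of a :: t'].
  move=> yB.
  have D2 := is_derive_sumE (index_enum 'I_n) (P := xpredT) (fun b _ =>
    is_deriveMR (is_derive_cst (A [tuple of b :: t']) y (e_ a)) (is_derive_coord b y (e_ a))).
  have [_ E] := is_deriveD D2 (is_derive_cst (B0 t') y (e_ a)).
  transitivity (\sum_i (0 * y 0 i + cst (A [tuple of i :: t']) y * (e_ a) 0 i) + 0).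
    rewrite -E; apply: near_eq_derive; apply: (near_eq_open oB) => // z zB.
    by rewrite thE.
  rewrite addr0 (bigD1 a)//= big1 => [|b /negbTE ba]; rewrite mxE.
    by rewrite !eqxx mulr1 mul0r add0r addr0.
  by rewrite eqxx/= ba mulr0 mul0r addr0.
(* The gradient is the constant tensor [A], whose first two slots both receive [v]; skewness makes
   the value equal to its opposite. *)
have radial0 v y s : B y -> radial_defect v y s = 0.
  move=> yB.
  have E : radial_defect v y s = - radial_defect v y s.
    rewrite {1}/radial_defect exchange_big/= -sumrN; apply: eq_bigr => i _.
    rewrite -sumrN; apply: eq_bigr => j _; rewrite !dth//.
    have := @skew_act_tperm R n _ A ord0 (lift ord0 ord0) [tuple of j :: [tuple of i :: s]] skA.
    move=> /(_ isT) H; rewrite (mulrC (v 0 j)) -mulrN; congr (_ * _).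
    rewrite -H; congr A; apply: eq_from_tnth => m.
    rewrite tnth_mktuple; case: tpermP => [->|->|].
    - by rewrite tnth_cons0 tnth_consS tnth_cons0.
    - by rewrite tnth_cons0 tnth_consS tnth_cons0.
    case: (unliftP ord0 m) => [k ->|->]// _ /eqP; rewrite (inj_eq lift_inj).
    case: (unliftP ord0 k) => [l ->|->]; last by rewrite eqxx.
    by rewrite !tnth_consS.
  by move: E; move: (radial_defect v y s) => z E; lra.
apply: (@parallel_change _ _ _ _ nabla c c' g t q
  (fun c t => contraction (velocity c g t) (omega c (g t)))) => //.
- exact: cg.
- exact: dg.
- have N1 : \forall u \near t, I u by exact: open_nbhs_nbhs.
  have N2 := near_curve (dom_open c') (cg t It) gd'.
  apply: filterS2 N1 N2 => u Iu ud' s.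
  apply: contraction_change => //; [exact: Ic|exact: cg|].
  by move=> k; have [] := gg c' u ac' Iu ud' k.
- move=> s; have [d E] := contraction_transport s gd (cg t It) (gg c t ac It gd).
  by split=> //; rewrite E radial0 ?mulr0//; exact: crd_B.
Qed.

End KillingYano.

Theorem theorem1 (R : realType) (n : nat) (hn : (2 < n)%N)
    (M : topologicalType) (S : manifold R n M)
    (hM : connected [set: M])
    (eta : pform S setT n) (nabla : connection S)
    (hequiaffine : equiaffine nabla eta)
    (hequiprojective : equiprojective nabla)
    (p : nat) (hp : (1 <= p <= n - 1)%N) (x0 : M) :
  exists c : chart R n M,
    [/\ atlas S c,
        chart_dom c x0,
        (forall x, chart_dom c x -> 0 < eta c x (ord_tuple n)) &
        let psi x := (n.+1)%:R^-1 * ln (eta c x (ord_tuple n)) in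
        forall omega : pform S (chart_dom c) p,
          killing_yano nabla omega <->
          exists (A : p.+1.-tuple 'I_n -> R) (B : p.-tuple 'I_n -> R),
            [/\ skew A, skew B &
                forall x, chart_dom c x -> forall t : p.-tuple 'I_n,
                  omega c x t =
                    expR ((p.+1)%:R * psi x) *
                    (\sum_(i0 < n) A [tuple of i0 :: t] * coordinate c i0 x
                     + B t)]].
Proof.
have [c [r [ac x0c r_gt0 codc [eta_x0 [phi nablaE]]]]] :=
  beltrami_chart hn hequiaffine hequiprojective x0.
exists c; split=> //.
  by move=> x xc; exact: (vol_gt0 hequiaffine ac codc x0c eta_x0).
case: p hp => [//|q] _ psi omega.
have KY := killing_yano_flat_chart hequiaffine ac codc r_gt0 x0c eta_x0 nablaE omega.
apply: (iff_trans KY); split=> -[A [B [skA skB H]]]; exists A, B; split=> //.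
  move=> x xc t; have yB : ball 0 r (crd c x) by rewrite -codc; exact: crd_cod.
  have := omega_rescaled eta omega t (crd c x).
  by rewrite H// crdK// => ->; rewrite /expsi crdK.
move=> y yB t; have yc : chart_cod c y by rewrite codc.
rewrite /rescaled H; last exact: par_dom.
rewrite mulrA /expsi -expRD mulNr addNr expR0 mul1r.
by congr (_ + _); apply: eq_bigr => i _; rewrite /coordinate parK.
Qed.
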